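(* Let $\mathfrak g$ be a symmetrizable Kac–Moody Lie algebra with simple roots $\alpha_i$ and simple coroots $h_i$ ($i\in I$, $I$ finite), and let $\underline i=(i_1,\dots,i_r)$ be a reduced word in $I$. Then $L_{\underline i}\subseteq S_{\underline i}(\infty)$, i.e. the tight monomial cone of $\underline i$ is contained in the set of adapted strings of $\underline i$.
   Context: The root datum is simply connected: the weight lattice $P$ contains $\varpi_i$ with $\langle h_i,\varpi_j\rangle=\delta_{ij}$. A word $\underline i$ is reduced if $s_{i_1}\cdots s_{i_r}$ is a reduced expression in the Weyl group generated by the simple reflections $s_i\lambda=\lambda-\langle h_i,\lambda\rangle\alpha_i$. Tight monomial cone: $L_{\underline i}$ is the set of $(a_1,\dots,a_r)\in\mathbb Z_{\ge0}^r$ such that for every pair $1\le p<s\le r$ with $i_p=i_s=:i$ one has $a_p+a_s+\sum_{p<k<s}\langle h_i,\alpha_{i_k}\rangle a_k\le 0$. Adapted strings: for a dominant weight $\lambda$, let $B(\lambda)$ be the crystal of the irreducible highest weight module of $U_q(\mathfrak g)$ of highest weight $\lambda$, with highest weight element $b_\lambda$ and Kashiwara operators $\tilde e_i,\tilde f_i$. A vector $(a_1,\dots,a_r)\in\mathbb Z_{\ge0}^r$ is an adapted string of $b\in B(\lambda)$ if $b=\tilde f_{i_1}^{a_1}\cdots\tilde f_{i_r}^{a_r}b_\lambda$ (in particular this is nonzero) and $\tilde e_{i_k}\tilde f_{i_{k+1}}^{a_{k+1}}\cdots\tilde f_{i_r}^{a_r}b_\lambda=0$ for all $k\in[1,r]$.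 $S_{\underline i}(\lambda)$ is the set of all vectors that are adapted strings of some $b\in B(\lambda)$, and $S_{\underline i}(\infty)=\bigcup_\lambda S_{\underline i}(\lambda)$ over all dominant weights $\lambda$. *)

(* Defs.v *)
From HB Require Import structures.
From mathcomp Require Import all_boot all_order all_algebra.
From mathcomp Require Import boolp classical_sets.
Set Implicit Arguments.
Unset Strict Implicit.
Unset Printing Implicit Defensive.
Import Order.TTheory GRing.Theory Num.Theory.
Local Open Scope classical_set_scope.
Local Open Scope ring_scope.

(* The weight lattice P is 'rV[int]_n and its dual P^v is 'cV[int]_n. *)
Definition pairing (n : nat) (h : 'cV[int]_n) (lam : 'rV[int]_n) : int :=
  (lam *m h) 0 0.

(* Simply connected root datum of a symmetrizable Kac-Moody algebra.  The
   matrix (<h_i, alpha_j>) is a generalized Cartan matrix, and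
   rd_d i = (alpha_i, alpha_i) / 2 for the chosen invariant form.  The coroots
   are linearly independent because of rd_fweightP. *)
Record root_datum (I : finType) := RootDatum {
  rd_rank : nat;
  rd_root : I -> 'rV[int]_rd_rank;
  rd_coroot : I -> 'cV[int]_rd_rank;
  rd_fweight : I -> 'rV[int]_rd_rank;
  rd_d : I -> nat;
  rd_diag : forall i, pairing (rd_coroot i) (rd_root i) = 2;
  rd_offdiag : forall i j, i != j -> pairing (rd_coroot i) (rd_root j) <= 0;
  rd_d_gt0 : forall i, (0 < rd_d i)%N;
  rd_symmetrizable : forall i j,
    (rd_d i)%:Z * pairing (rd_coroot i) (rd_root j)
    = (rd_d j)%:Z * pairing (rd_coroot j) (rd_root i);
  rd_root_free : forall c : I -> int,
    \sum_i c i *: rd_root i = 0 -> forall i, c i = 0;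
  rd_fweightP : forall i j,
    pairing (rd_coroot i) (rd_fweight j) = (i == j)%:R
}.

Notation weight D := ('rV[int]_(rd_rank D)).
Notation coweight D := ('cV[int]_(rd_rank D)).

Definition cartan (I : finType) (D : root_datum I) (i j : I) : int :=
  pairing (rd_coroot D i) (rd_root D j).

Definition dominant (I : finType) (D : root_datum I) (lam : weight D) : bool :=
  [forall i, 0 <= pairing (rd_coroot D i) lam].

Notation dominant_weight D := {lam : weight D | dominant lam}.

Definition simple_reflection (I : finType) (D : root_datum I) (i : I)
    (lam : weight D) : weight D :=
  lam - pairing (rd_coroot D i) lam *: rd_root D i.

Definition weyl_word (I : finType) (D : root_datum I) (w : seq I)
    (lam : weight D) : weight D :=
  foldr (@simple_reflection I D) lam w.

(* The Weyl group acts faithfully on P, so two words have the same product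
   in it iff they act on P in the same way. *)
Definition reduced (I : finType) (D : root_datum I) (w : seq I) : Prop :=
  forall w' : seq I,
    @weyl_word I D w' =1 @weyl_word I D w -> (size w <= size w')%N.

Definition tight_cone (I : finType) (D : root_datum I) (r : nat)
    (w : r.-tuple I) : set (r.-tuple nat) :=
  [set a | forall p s : 'I_r, (p < s)%N -> tnth w p = tnth w s ->
     (tnth a p)%:Z + (tnth a s)%:Z
     + \sum_(k < r | (p < k < s)%N) cartan D (tnth w p) (tnth w k)
                                     * (tnth a k)%:Z <= 0].

(* Q(q) *)
Definition Qq : fieldType := {fraction {poly rat}}.
Definition qvar : Qq := tofrac ('X : {poly rat}).
Definition Qq_const (c : rat) : Qq := tofrac (c%:P).

(* The local ring of rational functions that are regular at q = 0. *)
Definition regular0 : set Qq :=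
  [set x | exists n d : {poly rat}, d.[0] != 0 /\ x = tofrac n / tofrac d].

Definition qi (I : finType) (D : root_datum I) (i : I) : Qq := qvar ^+ rd_d D i.

Definition qint (v : Qq) (n : nat) : Qq := (v ^+ n - v ^- n) / (v - v^-1).
Definition qfact (v : Qq) (n : nat) : Qq := \prod_(1 <= k < n.+1) qint v k.

Definition divpow (v : Qq) (V : lmodType Qq) (f : V -> V) (n : nat) (u : V) : V :=
  (qfact v n)^-1 *: iter n f u.

(* A module over U_q(g), given by the action of the generators e_i, f_i and
   q^h (h in P^v) subject to the defining relations; here t_i = q^{d_i h_i}. *)
Record Uq_module (I : finType) (D : root_datum I) := UqModule {
  um_space :> lmodType Qq;
  um_e : I -> {linear um_space -> um_space};
  um_f : I -> {linear um_space -> um_space};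
  um_k : coweight D -> {linear um_space -> um_space};
  um_k0 : forall u, um_k 0 u = u;
  um_kD : forall h h' u, um_k (h + h') u = um_k h (um_k h' u);
  um_ke : forall h i u,
    um_k h (um_e i u) = qvar ^ pairing h (rd_root D i) *: um_e i (um_k h u);
  um_kf : forall h i u,
    um_k h (um_f i u) = qvar ^ (- pairing h (rd_root D i)) *: um_f i (um_k h u);
  um_ef : forall i j u,
    um_e i (um_f j u) - um_f j (um_e i u)
    = if i == j then
        (qi D i - (qi D i)^-1)^-1 *:
          (um_k (rd_coroot D i *+ rd_d D i) u
           - um_k (- (rd_coroot D i *+ rd_d D i)) u)
      else 0;
  um_serre_e : forall i j u, i != j ->
    let N := `|1 - cartan D i j|%N in
    \sum_(k < N.+1) (-1) ^+ k *:
      divpow (qi D i) (um_e i) k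
        (um_e j (divpow (qi D i) (um_e i) (N - k)%N u)) = 0;
  um_serre_f : forall i j u, i != j ->
    let N := `|1 - cartan D i j|%N in
    \sum_(k < N.+1) (-1) ^+ k *:
      divpow (qi D i) (um_f i) k
        (um_f j (divpow (qi D i) (um_f i) (N - k)%N u)) = 0
}.

Arguments um_e {I D} M i : rename.
Arguments um_f {I D} M i : rename.
Arguments um_k {I D} M h : rename.

Definition wtspace (I : finType) (D : root_datum I) (M : Uq_module D)
    (xi : weight D) : set M :=
  [set u | forall h, um_k M h u = qvar ^ pairing h xi *: u].

Definition fdiv (I : finType) (D : root_datum I) (M : Uq_module D)
    (i : I) (n : nat) (u : M) : M :=
  divpow (qi D i) (um_f M i) n u.

Definition Uq_irreducible (I : finType) (D : root_datum I) (M : Uq_module D)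
    : Prop :=
  (exists u : M, u != 0) /\
  forall W : set M,
    W 0 -> (forall c u v, W u -> W v -> W (c *: u + v)) ->
    (forall i u, W u -> W (um_e M i u)) ->
    (forall i u, W u -> W (um_f M i u)) ->
    (forall h u, W u -> W (um_k M h u)) ->
    W = [set 0] \/ W = setT.

Definition integrable (I : finType) (D : root_datum I) (M : Uq_module D)
    : Prop :=
  (forall u : M, exists s : seq M,
     (forall x, x \in s -> exists xi, wtspace xi x) /\ u = \sum_(x <- s) x) /\
  (forall i (u : M), exists n, iter n (um_e M i) u = 0) /\
  (forall i (u : M), exists n, iter n (um_f M i) u = 0).

(* u is the sum of the f_i^{(n)} x over the pairs (n, x) of s, where
   x is a weight vector killed by e_i and n <= <h_i, wt x>. *)
Definition string_decomposition (I : finType) (D : root_datum I)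
    (M : Uq_module D) (i : I) (u : M) (s : seq (nat * M)) : Prop :=
  (forall p, p \in s -> um_e M i p.2 = 0 /\
     exists xi : weight D, wtspace xi p.2 /\ p.1%:Z <= pairing (rd_coroot D i) xi) /\
  u = \sum_(p <- s) fdiv i p.1 p.2.

(* Kashiwara operators.  In an integrable module every vector has a string
   decomposition and the values below do not depend on the one chosen. *)
Definition etilde (I : finType) (D : root_datum I) (M : Uq_module D)
    (i : I) (u : M) : M :=
  xget 0 [set w | exists s, string_decomposition i u s /\
    w = \sum_(p <- s | (0 < p.1)%N) fdiv i p.1.-1 p.2].

Definition ftilde (I : finType) (D : root_datum I) (M : Uq_module D)
    (i : I) (u : M) : M :=
  xget 0 [set w | exists s, string_decomposition i u s /\
    w = \sum_(p <- s) fdiv i p.1.+1 p.2].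

Definition lspan (V : lmodType Qq) (S : set Qq) (X : set V) : set V :=
  [set u | exists s : seq (Qq * V),
     (forall p, p \in s -> S p.1 /\ X p.2) /\ u = \sum_(p <- s) p.1 *: p.2].

Definition lin_indep (V : lmodType Qq) (X : set V) : Prop :=
  forall (s : seq V) (c : V -> Qq), uniq s -> (forall x, x \in s -> X x) ->
    \sum_(x <- s) c x *: x = 0 -> forall x, x \in s -> c x = 0.

(* Elements of L/qL are the cosets x + qL, as subsets of V; the zero element
   is qL itself. *)
Definition qlat (V : lmodType Qq) (L : set V) : set V :=
  [set y | exists2 x, L x & y = qvar *: x].

Definition lat_coset (V : lmodType Qq) (L : set V) (x : V) : set V :=
  [set y | qlat L (y - x)].

Definition lat_map (V : lmodType Qq) (L : set V) (g : V -> V) (C : set V)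
    : set V :=
  [set y | exists2 x, C x & qlat L (y - g x)].

(* (L, B) is a crystal base (at q = 0) of the integrable module M.  The first
   clause on L says that L is free over regular0 with Q(q) (x) L = M. *)
Record is_crystal_base (I : finType) (D : root_datum I) (M : Uq_module D)
    (L : set M) (B : set (set M)) : Prop := IsCrystalBase {
  cb_integrable : integrable M;
  cb_lattice : exists X : set M,
    [/\ lin_indep X, lspan setT X = setT & L = lspan regular0 X];
  cb_lattice_wt : forall u, L u -> exists s : seq M,
    (forall x, x \in s -> L x /\ exists xi, wtspace xi x) /\ u = \sum_(x <- s) x;
  cb_lattice_e : forall i u, L u -> L (etilde i u);
  cb_lattice_f : forall i u, L u -> L (ftilde i u);
  cb_base_sub : forall C, B C -> exists2 x, L x & C = lat_coset L x;
  cb_base_indep : forall (s : seq M) (c : M -> rat), uniq s ->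
    (forall x, x \in s -> L x /\ B (lat_coset L x)) ->
    (forall x y, x \in s -> y \in s -> lat_coset L x = lat_coset L y -> x = y) ->
    qlat L (\sum_(x <- s) Qq_const (c x) *: x) ->
    forall x, x \in s -> c x = 0;
  cb_base_span : forall u, L u -> exists s : seq (rat * M),
    (forall p, p \in s -> L p.2 /\ B (lat_coset L p.2)) /\
    qlat L (u - \sum_(p <- s) Qq_const p.1 *: p.2);
  cb_base_wt : forall C, B C ->
    exists x xi, [/\ L x, wtspace xi x & C = lat_coset L x];
  cb_base_e : forall i C, B C ->
    B (lat_map L (etilde i) C) \/ lat_map L (etilde i) C = qlat L;
  cb_base_f : forall i C, B C ->
    B (lat_map L (ftilde i) C) \/ lat_map L (ftilde i) C = qlat L;
  cb_base_ef : forall i C C', B C -> B C' ->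
    (C' = lat_map L (ftilde i) C <-> C = lat_map L (etilde i) C')
}.

(* Kashiwara's L(lambda) and B(lambda), for a highest weight vector v:
   L(lambda) is spanned over regular0 by the vectors ftilde_{i_1} ...
   ftilde_{i_l} v, and B(lambda) is the set of their nonzero classes. *)
Definition crystal_lattice (I : finType) (D : root_datum I) (M : Uq_module D)
    (v : M) : set M :=
  lspan regular0 [set u | exists w : seq I, u = foldr (@ftilde I D M) v w].

Definition crystal_set (I : finType) (D : root_datum I) (M : Uq_module D)
    (v : M) : set (set M) :=
  [set C | exists w : seq I,
     C = lat_coset (crystal_lattice v) (foldr (@ftilde I D M) v w)
     /\ C <> qlat (crystal_lattice v)].

(* The irreducible highest weight module of highest weight lam with its
   crystal base (L(lam), B(lam)).  That such data exist for every dominant lam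
   is Kashiwara's existence theorem for crystal bases. *)
Record hw_crystal (I : finType) (D : root_datum I) (lam : weight D) := HwCrystal {
  hw_module :> Uq_module D;
  hw_vector : hw_module;
  hw_irreducible : Uq_irreducible hw_module;
  hw_vector_neq0 : hw_vector != 0;
  hw_vector_wt : wtspace lam hw_vector;
  hw_vector_e : forall i, um_e hw_module i hw_vector = 0;
  hw_crystal_base :
    is_crystal_base (crystal_lattice hw_vector) (crystal_set hw_vector)
}.

Arguments hw_vector {I D lam} V : rename.

Section CrystalOperators.
Context (I : finType) (D : root_datum I) (lam : weight D) (V : hw_crystal lam).

Definition hwL : set V := crystal_lattice (hw_vector V).
Definition hwB : set (set V) := crystal_set (hw_vector V).
Definition hwb : set V := lat_coset hwL (hw_vector V).
Definition cr_zero : set V := qlat hwL.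
Definition cr_e (i : I) : set V -> set V := lat_map hwL (etilde i).
Definition cr_f (i : I) : set V -> set V := lat_map hwL (ftilde i).

(* ftilde_{i_k}^{a_k} ... ftilde_{i_r}^{a_r} b_lambda, for the positions
   numbered from k on (starting at 0) *)
Definition string_tail (r : nat) (w : r.-tuple I) (a : r.-tuple nat) (k : nat)
    : set V :=
  foldr (fun j b => iter (tnth a j) (cr_f (tnth w j)) b) hwb (drop k (enum 'I_r)).

Definition adapted_string (r : nat) (w : r.-tuple I) (a : r.-tuple nat)
    (b : set V) : Prop :=
  b = string_tail w a 0 /\
  forall k : 'I_r, cr_e (tnth w k) (string_tail w a k.+1) = cr_zero.

Definition adapted_strings (r : nat) (w : r.-tuple I) : set (r.-tuple nat) :=
  [set a | exists2 b, hwB b & adapted_string w a b].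

End CrystalOperators.

Definition adapted_strings_infty (I : finType) (D : root_datum I)
    (V : forall lam : dominant_weight D, hw_crystal (sval lam))
    (r : nat) (w : r.-tuple I) : set (r.-tuple nat) :=
  \bigcup_(lam : dominant_weight D) adapted_strings (V lam) w.

(* Main.v *)
(* Induction on the word, removing its last letter (i, a).  Say that lam fits
   the word if each exponent a_k is at most the pairing of h_{i_k} with the
   weight of the vector that the k-th power of ftilde acts on.  For lam fitting
   the word, let lam' = lam + N rho with N large, and write lam' = mu + nu with
   <h_i, mu> = 0 and nu a multiple of varpi_i.  The tight inequalities between an
   earlier letter i and the last one say that mu fits the shorter word, with a to
   spare at each letter i.  So the shorter word is adapted for V(mu), and by the
   tensor product rule ftilde_{i_1}^{a_1} ... ftilde_i^a acts on v_mu (x) v_nu as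
   (ftilde_{i_1}^{a_1} ... v_mu) (x) ftilde_i^a v_nu; hence the word is adapted
   for V(lam').  Adaptedness descends from V(lam') to V(lam) by comparison with
   V(lam) (x) V(N rho), where, since lam fits, the right factor stays at the
   highest weight vector.

   V(mu + nu) and V(mu) (x) V(nu) are compared through the graph of the
   surjection onto V(mu + nu) of the submodule generated by v_mu (x) v_nu.  It maps
   the part of the tensor product lattice in that submodule into the crystal
   lattice of V(mu + nu), because the latter is detected by the operators
   etilde_i, under which the former is stable.  The stability and the tensor
   product rule are statements on two strings of U_q(sl_2). *)

Require Import Defs.
From HB Require Import structures.
From mathcomp Require Import all_boot all_order all_algebra.
From mathcomp Require Import boolp classical_sets functions.
From mathcomp Require Import ring zify generic_quotient.
Set Implicit Arguments.
Unset Strict Implicit.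
Unset Printing Implicit Defensive.
Import Order.TTheory GRing.Theory Num.Theory.
Local Open Scope quotient_scope.
Local Open Scope classical_set_scope.
Local Open Scope ring_scope.

(** * Rational functions regular at q = 0 *)

(** The claim is proved for every fitting weight, not only for large ones, because the weight mu of
    the induction step cannot be enlarged at will: it must pair to 0 with h_i, so that f_i kills
    v_mu and the powers of ftilde_i coming from the last letter move the right factor only. Hence
    the return from lam' to lam. The shift by N rho makes up for the amount - a <h_j, alpha_i> that
    the last letter contributes at the letters j other than i, and that is lost when it is removed.

    The comultiplication is the one for which, modulo q, ftilde_i moves the left factor of f_i^(j) x
    (x) f_i^(k) y as long as j + k < m, with m the weight of x. Every fitting condition is an
    instance of this inequality.

    The transport to V(mu + nu) rests on one property of its crystal: modulo q, a lattice vector of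
    weight other than the highest one that all etilde_i kill is 0. The lattice property of the
    graph, scaled by q, stands in for a well defined map of crystals. *)

Lemma tofrac_neq0 (p : {poly rat}) : p.[0] != 0 -> tofrac p != 0.
Proof. by move=> h; rewrite tofrac_eq0; apply: contraNneq h => ->; rewrite horner0. Qed.

Lemma regular0_tofrac (p : {poly rat}) : regular0 (tofrac p).
Proof. by exists p, 1; rewrite hornerC oner_neq0 tofrac1 divr1. Qed.

Lemma regular0_0 : regular0 0.
Proof. by rewrite -tofrac0; apply: regular0_tofrac. Qed.

Lemma regular0_1 : regular0 1.
Proof. by rewrite -tofrac1; apply: regular0_tofrac. Qed.

Lemma regular0_q : regular0 qvar.
Proof. exact: regular0_tofrac. Qed.

Lemma regular0M x y : regular0 x -> regular0 y -> regular0 (x * y).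
Proof.
move=> [n [d [d0 ->]]] [n' [d' [d'0 ->]]]; exists (n * n'), (d * d').
by rewrite hornerM mulf_neq0 // !tofracM mulf_div.
Qed.

Lemma regular0D x y : regular0 x -> regular0 y -> regular0 (x + y).
Proof.
move=> [n [d [d0 ->]]] [n' [d' [d'0 ->]]]; exists (n * d' + n' * d), (d * d').
by rewrite hornerM mulf_neq0 // tofracD !tofracM addf_div // tofrac_neq0.
Qed.

Lemma regular0N x : regular0 x -> regular0 (- x).
Proof. by move=> [n [d [d0 ->]]]; exists (- n), d; rewrite tofracN mulNr. Qed.

Lemma regular0X x n : regular0 x -> regular0 (x ^+ n).
Proof.
by move=> hx; elim: n => [|n IH]; [exact: regular0_1 | rewrite exprS; apply: regular0M].
Qed.

Lemma regular0_const c : regular0 (Qq_const c).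
Proof. exact: regular0_tofrac. Qed.

Lemma qvar_neq0 : qvar != 0.
Proof. by rewrite tofrac_eq0 polyX_eq0. Qed.

Lemma qvarX_eq1 n : (qvar ^+ n == 1) = (n == 0)%N.
Proof.
rewrite -tofracXn -tofrac1 tofrac_eq; apply/eqP/eqP => [h|->]; last by rewrite expr0.
by have := size_polyXn rat n; rewrite h size_polyC oner_neq0 => -[].
Qed.

Lemma qvarZ_inj (m n : int) : qvar ^ m = qvar ^ n -> m = n.
Proof.
have key (k : int) : qvar ^ k = 1 -> k = 0.
  case: k => [k|k] /eqP; first by rewrite -exprnP qvarX_eq1 => /eqP ->.
  by rewrite NegzE -exprnN invr_eq1 qvarX_eq1.
move=> h; apply/eqP; rewrite -subr_eq0; apply/eqP/key.
by rewrite expfzDr ?qvar_neq0 // h -expfzDr ?qvar_neq0 // subrr.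
Qed.

Lemma regular0_1Dq x : regular0 x -> 1 + qvar * x != 0 /\ regular0 (1 + qvar * x)^-1.
Proof.
move=> [n [d [d0 ->]]].
have d'0 : (d + 'X * n).[0] != 0 by rewrite hornerD hornerM hornerX mul0r addr0.
have -> : 1 + qvar * (tofrac n / tofrac d) = tofrac (d + 'X * n) / tofrac d.
  by rewrite tofracD tofracM mulrDl divff ?tofrac_neq0 // mulrA.
split; first by rewrite mulf_neq0 ?invr_eq0 ?tofrac_neq0.
by exists d, (d + 'X * n); rewrite invf_div.
Qed.

Lemma regular0_qpow x : exists N, regular0 (qvar ^+ N * x).
Proof.
have [n [d [d0 ->]]] : exists n d : {poly rat}, d != 0 /\ x = tofrac n / tofrac d.
  elim/quotW: x => y; exists (\n_y), (\d_y); split; first exact: denom_ratioP.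
  apply: (canRL (mulfK _)); first by rewrite tofrac_eq0 denom_ratioP.
  change (FracField.mul (\pi_{fraction {poly rat}} y) (tofrac \d_y) = tofrac \n_y).
  rewrite !piE; apply/eqmodP; rewrite /= FracField.equivfE.
  by rewrite !numden_Ratio ?(mulf_neq0, denom_ratioP, oner_eq0) // !mulr1 mulrC.
(* N is the order of vanishing of the denominator at 0; the cofactor is nonzero there. *)
have [N [d' nd ->]] := multiplicity_XsubC d 0.
exists N; exists n, d'; split; first by move: nd; rewrite d0.
rewrite subr0 tofracM tofracXn invfM [X in _ * X]mulrA mulrC mulfVK //.
by rewrite expf_neq0 ?qvar_neq0.
Qed.

(** Evaluate at 0 after clearing the denominator of y: the constants embed into the residue field of
    [regular0]. *)
Lemma Qq_const_qmul c y : regular0 y -> Qq_const c = qvar * y -> c = 0.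
Proof.
move=> [n [d [d0 ->]]] /(congr1 ( *%R^~ (tofrac d))).
rewrite mulrA mulfVK ?tofrac_neq0 // -!tofracM => /eqP; rewrite tofrac_eq => /eqP.
move/(congr1 (fun p => p.[0])); rewrite !hornerM hornerC hornerX mul0r => /eqP.
by rewrite mulf_eq0 (negbTE d0) orbF => /eqP.
Qed.

(** * Quantum integers and their order at q = 0 *)

Definition qbr (F : fieldType) (v : F) (n : int) : F := (v ^ n - v ^ (- n)) / (v - v^-1).

(** The induction step of the formula for e f^(k+1) x, where x has weight m and is killed by e. *)
Lemma qbrS (F : fieldType) (v : F) (m k : int) : v != 0 -> v - v^-1 != 0 ->
  qbr v (m - k + 1) * qbr v k + qbr v (m - 2 * k) = qbr v (m - k) * qbr v (k + 1).
Proof.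
move=> v0 vB0; have -> : 2 * k = k + k by ring.
rewrite /qbr !(opprD, opprK) !expfzDr // -!invr_expz !expr1z.
have a0 : v ^ m != 0 by rewrite expfz_neq0.
have b0 : v ^ k != 0 by rewrite expfz_neq0.
have v1 : v * v - 1 != 0.
  by apply: contraNneq vB0 => /(canRL (subrK _)); rewrite add0r => vv;
     rewrite -{1}[v](mulfK v0) vv mul1r subrr.
by field; rewrite a0 b0 v0 v1.
Qed.

(** Horner recursion for the polynomial 1 + v^2 + ... + v^(2n), which is v^n [n + 1]. *)
Lemma qbrD1 (F : fieldType) (v : F) (n : nat) : v != 0 -> v - v^-1 != 0 ->
  v ^ n%:Z * qbr v n.+1%:Z = v ^+ 2 * (v ^ (n%:Z - 1) * qbr v n%:Z) + 1.
Proof.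
move=> v0 vB0; have -> : n.+1%:Z = n%:Z + 1 by rewrite -addn1 PoszD.
rewrite /qbr !(opprD, opprK) !expfzDr // -!invr_expz !expr1z.
have b0 : v ^ n%:Z != 0 by rewrite expfz_neq0.
have v1 : v * v - 1 != 0.
  by apply: contraNneq vB0 => /(canRL (subrK _)); rewrite add0r => vv;
     rewrite -{1}[v](mulfK v0) vv mul1r subrr.
by field; rewrite b0 v0 v1.
Qed.

(** A lower bound k for the order of x at q = 0, counted in powers of v; 0 satisfies every bound. *)
Definition ordq (v : Qq) (k : int) (x : Qq) : Prop := regular0 (v ^ (- k) * x).

Section QNumbers.
Variables (d : nat) (d_gt0 : (0 < d)%N).
Let v : Qq := qvar ^+ d.

Lemma qd_neq0 : v != 0.
Proof. by rewrite expf_neq0 ?qvar_neq0. Qed.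
Let v0 := qd_neq0.

Lemma qdZ_inj (m n : int) : v ^ m = v ^ n -> m = n.
Proof.
rewrite /v !exprnP !exprz_exp => /qvarZ_inj; apply: mulfI.
by rewrite eqz_nat -lt0n.
Qed.

Lemma qdBV_neq0 : v - v^-1 != 0.
Proof.
by rewrite subr_eq0; apply/eqP => /(@qdZ_inj 1 (-1)).
Qed.
Let vB0 := qdBV_neq0.

Lemma qint_qbr n : qint v n = qbr v n%:Z.
Proof. by rewrite /qint /qbr exprnN. Qed.

Lemma qbr0 : qbr v 0 = 0.
Proof. by rewrite /qbr oppr0 subrr mul0r. Qed.

Lemma qbr1 : qbr v 1 = 1.
Proof. by rewrite /qbr divff. Qed.

Lemma qbrN n : qbr v (- n) = - qbr v n.
Proof. by rewrite /qbr opprK -mulNr opprB. Qed.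

Lemma qbr_eq0 n : (qbr v n == 0) = (n == 0).
Proof.
apply/eqP/eqP => [/eqP|->]; last exact: qbr0.
rewrite mulf_eq0 invr_eq0 (negbTE vB0) orbF subr_eq0 => /eqP /qdZ_inj; lia.
Qed.

Lemma regular0_qd : regular0 v.
Proof. exact: regular0X regular0_q. Qed.

Lemma qd_qmul : exists2 x, regular0 x & v = qvar * x.
Proof.
exists (qvar ^+ d.-1); first exact: regular0X regular0_q.
by rewrite -exprS prednK.
Qed.

Lemma ordqM k l x y : ordq v k x -> ordq v l y -> ordq v (k + l) (x * y).
Proof.
by rewrite /ordq => hx hy; rewrite opprD expfzDr // mulrACA; apply: regular0M.
Qed.

Lemma ordqD k x y : ordq v k x -> ordq v k y -> ordq v k (x + y).
Proof. by rewrite /ordq mulrDr; apply: regular0D. Qed.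

Lemma ordqN k x : ordq v k x -> ordq v k (- x).
Proof. by rewrite /ordq mulrN; apply: regular0N. Qed.

Lemma ordq0 k : ordq v k 0.
Proof. by rewrite /ordq mulr0; apply: regular0_0. Qed.

Lemma ordq_v k : ordq v k (v ^ k).
Proof. by rewrite /ordq -expfzDr // addNr; apply: regular0_1. Qed.

Lemma ordqW k l x : k <= l -> ordq v l x -> ordq v k x.
Proof.
rewrite /ordq => kl h; have -> : - k = (l - k) + - l by ring.
rewrite expfzDr // -mulrA; apply: regular0M => //.
have -> : l - k = `|l - k|%N by lia.
exact: regular0X regular0_qd.
Qed.

Lemma ordq_qmul k x : 0 < k -> ordq v k x -> exists2 y, regular0 y & x = qvar * y.
Proof.
move=> k0; have k1 : 1 <= k by lia.
move=> /(ordqW k1) h; have [y ry vy] := qd_qmul.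
exists (y * (v ^ (-1) * x)); first exact: regular0M.
by rewrite mulrA -vy mulrA -[X in X * _ * _]expr1z -expfzDr // mul1r.
Qed.

(** So [n + 1] has order exactly -n and leading coefficient 1, which gives bounds for it and for its
    inverse. *)
Lemma qbr_lead n : exists2 y, regular0 y & v ^ n%:Z * qbr v n.+1%:Z = 1 + qvar * y.
Proof.
case: n => [|n].
  by exists 0; [exact: regular0_0|rewrite qbr1 expr0z mulr0 mulr1 addr0].
elim: n => [|n [y ry IH]]; have [z rz vz] := qd_qmul.
  exists (z * v); first exact: regular0M regular0_qd.
  by rewrite qbrD1 // subrr qbr1 expr0z !mulr1 expr2 {1}vz mulrA addrC.
exists (z * v * (1 + qvar * y)).
  apply: regular0M; first exact: regular0M regular0_qd.
  by apply: regular0D; [exact: regular0_1 | apply: regular0M => //; exact: regular0_q].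
have E : n.+2%:Z - 1 = n.+1%:Z by lia.
by rewrite qbrD1 // E IH expr2 {1}vz !mulrA addrC.
Qed.

Lemma ordq_qbr n : (0 < n)%N -> ordq v (1 - n%:Z) (qbr v n%:Z).
Proof.
case: n => // n _; have [y ry h] := qbr_lead n.
have -> : 1 - n.+1%:Z = - n%:Z by lia.
rewrite /ordq opprK h; apply: regular0D; first exact: regular0_1.
by apply: regular0M => //; exact: regular0_q.
Qed.

Lemma ordq_qbrV n : (0 < n)%N -> ordq v (n%:Z - 1) (qbr v n%:Z)^-1.
Proof.
case: n => // n _; have [y ry h] := qbr_lead n.
have -> : n.+1%:Z - 1 = n%:Z by lia.
by rewrite /ordq -invr_expz -invfM h; have [] := regular0_1Dq ry.
Qed.

Lemma qfactS n : qfact v n.+1 = qfact v n * qbr v n.+1%:Z.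
Proof. by rewrite /qfact big_nat_recr //= qint_qbr. Qed.

Lemma qfact0 : qfact v 0 = 1.
Proof. by rewrite /qfact big_geq. Qed.

Lemma qfact_neq0 n : qfact v n != 0.
Proof.
elim: n => [|n IH]; first by rewrite qfact0 oner_neq0.
rewrite qfactS; apply: mulf_neq0; first exact: IH.
by rewrite qbr_eq0.
Qed.

End QNumbers.

Opaque Qq qvar.

(** * Strings of U_q(sl_2) *)

(* Locked, since unification otherwise unfolds divided powers. *)
Fact dpow_key : unit. Proof. exact: tt. Qed.
Definition dpow (v : Qq) (V : lmodType Qq) (f : V -> V) (n : nat) (u : V) : V :=
  locked_with dpow_key (divpow v f n u).

Lemma dpowE v (V : lmodType Qq) (f : V -> V) n u : dpow v f n u = divpow v f n u.
Proof. by rewrite /dpow unlock. Qed.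

Section DividedPowers.
Variables (V : lmodType Qq) (d : nat) (d_gt0 : (0 < d)%N).
Let v : Qq := qvar ^+ d.
Variable f : {linear V -> V}.

Lemma iter_linear n a (x y : V) :
  iter n f (a *: x + y) = a *: iter n f x + iter n f y.
Proof. by elim: n => //= n ->; rewrite linearP. Qed.

Lemma divpow_linear n a (x y : V) :
  dpow v f n (a *: x + y) = a *: dpow v f n x + dpow v f n y.
Proof. by rewrite !dpowE /divpow iter_linear scalerDr !scalerA [_ * a]mulrC. Qed.

Lemma divpow_at0 n : dpow v f n (0 : V) = 0.
Proof. by have := divpow_linear n (-1) 0 0; rewrite scaler0 addr0 scaleN1r addNr. Qed.

Lemma divpowD n (x y : V) : dpow v f n (x + y) = dpow v f n x + dpow v f n y.
Proof. by rewrite -{1}[x]scale1r divpow_linear scale1r. Qed.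

Lemma divpowZ n a (x : V) : dpow v f n (a *: x) = a *: dpow v f n x.
Proof. by rewrite -[a *: x]addr0 divpow_linear divpow_at0 addr0. Qed.

Lemma iter_at0 n : iter n f (0 : V) = 0.
Proof. by elim: n => //= n ->; rewrite linear0. Qed.

Lemma iterZ n a (x : V) : iter n f (a *: x) = a *: iter n f x.
Proof. by rewrite -[a *: x]addr0 iter_linear iter_at0 addr0. Qed.

Lemma divpow0 (x : V) : dpow v f 0 x = x.
Proof. by rewrite !dpowE /divpow qfact0 invr1 scale1r. Qed.

Lemma divpowS n (x : V) : dpow v f n.+1 x = (qbr v n.+1%:Z)^-1 *: f (dpow v f n x).
Proof. by rewrite !dpowE /divpow qfactS linearZ scalerA invfM mulrC. Qed.

Lemma op_divpow n (x : V) : f (dpow v f n x) = qbr v n.+1%:Z *: dpow v f n.+1 x.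
Proof. by rewrite divpowS scalerA divff ?scale1r // qbr_eq0. Qed.

Lemma divpow_eq0 n (x : V) : (dpow v f n x == 0) = (iter n f x == 0).
Proof. by rewrite !dpowE /divpow scaler_eq0 invr_eq0 (negbTE (qfact_neq0 d_gt0 n)). Qed.

End DividedPowers.

(** The weight spaces on one alpha_i-line: W j lies j steps above a base weight, on which h_i has
    the value c. Modules, the two-string model, tensor products and the graph all give such strips,
    so the theory of strings is developed once for them. *)
Record sl2_strip (V : lmodType Qq) (d : nat) (e f : {linear V -> V}) (c : int)
    (W : int -> set V) : Prop := Sl2Strip {
  strip0 : forall j, W j 0;
  strip_lin : forall j a x y, W j x -> W j y -> W j (a *: x + y);
  strip_e : forall j x, W j x -> W (j + 1) (e x);
  strip_f : forall j x, W j x -> W (j - 1) (f x);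
  strip_ef : forall j x, W j x ->
    e (f x) - f (e x) = qbr (qvar ^+ d) (c + 2 * j) *: x;
  strip_enil : forall j x, W j x -> exists n, iter n e x = 0;
  strip_fnil : forall j x, W j x -> exists n, iter n f x = 0
}.

Lemma strip_swap V d e f c W : @sl2_strip V d e f c W ->
  sl2_strip d f e (- c) (fun j => W (- j)).
Proof.
case=> W0 WL We Wf Wef Wen Wfn; split=> //.
- by move=> j x y z; apply: WL.
- by move=> j x /Wf; rewrite opprD.
- by move=> j x /We; rewrite opprD opprK.
- move=> j x /Wef; have -> : - c + 2 * j = - (c + 2 * - j) by ring.
  by rewrite qbrN scaleNr => <-; rewrite opprB.
- by move=> j x; apply: Wfn.
- by move=> j x; apply: Wen.
Qed.

Section Strip.
Variables (V : lmodType Qq) (d : nat) (d_gt0 : (0 < d)%N).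
Let v : Qq := qvar ^+ d.
Variables (e f : {linear V -> V}) (c : int) (W : int -> set V).
Hypothesis S : sl2_strip d e f c W.

Lemma stripD j x y : W j x -> W j y -> W j (x + y).
Proof. by move=> hx hy; rewrite -[x]scale1r; apply: (strip_lin S). Qed.

Lemma stripZ j a x : W j x -> W j (a *: x).
Proof. by move=> hx; rewrite -[_ *: _]addr0; apply: (strip_lin S) => //; apply: (strip0 S). Qed.

Lemma strip_sum j N (F : 'I_N -> V) : (forall k, W j (F k)) -> W j (\sum_k F k).
Proof. by move=> h; apply: big_ind => //; [exact: (strip0 S) | exact: stripD]. Qed.

Lemma strip_divf j n x : W j x -> W (j - n%:Z) (dpow v f n x).
Proof.
move=> hx; elim: n => [|n IH]; first by rewrite divpow0 subr0.
rewrite divpowS //; have -> : j - n.+1%:Z = j - n%:Z - 1 by lia.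
by apply: stripZ; apply: (strip_f S).
Qed.

Lemma strip_iter_e j n x : W j x -> W (j + n%:Z) (iter n e x).
Proof.
move=> hx; elim: n => [|n IH]; first by rewrite addr0.
have -> : j + n.+1%:Z = j + n%:Z + 1 by lia.
exact: (strip_e S).
Qed.

Lemma e_divf j x k : W j x -> e x = 0 ->
  e (dpow v f k.+1 x) = qbr v (c + 2 * j - k%:Z) *: dpow v f k x.
Proof.
move=> hx ex; set m := c + 2 * j.
have key y i : W i y -> e (f y) = f (e y) + qbr v (c + 2 * i) *: y.
  by move=> /(strip_ef S) h; rewrite -h addrC subrK.
elim: k => [|k IH].
  by rewrite divpowS // divpow0 linearZ /= (key x j) // ex linear0 add0r qbr1 // invr1 scale1r subr0.
rewrite divpowS // linearZ /= (key _ _ (strip_divf k.+1 hx)) IH linearZ /= op_divpow //.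
have -> : c + 2 * (j - k.+1%:Z) = m - 2 * k.+1%:Z by rewrite /m; ring.
rewrite !scalerA -scalerDl.
have -> : m - k%:Z = m - k.+1%:Z + 1 by lia.
rewrite qbrS ?qd_neq0 ?qdBV_neq0 // scalerA mulrCA.
have -> : k.+1%:Z + 1 = k.+2%:Z by lia.
by rewrite mulVf ?mulr1 // qbr_eq0.
Qed.

Lemma iter_e_divf j x k : W j x -> e x = 0 ->
  iter k e (dpow v f k x) = (\prod_(t < k) qbr v (c + 2 * j - t%:Z)) *: x.
Proof.
move=> hx ex; elim: k => [|k IH]; first by rewrite big_ord0 divpow0 scale1r.
by rewrite iterSr (e_divf _ hx) // iterZ IH scalerA big_ord_recr /= mulrC.
Qed.

Lemma iter_e_divf_gt j x k n : W j x -> e x = 0 -> (k < n)%N ->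
  iter n e (dpow v f k x) = 0.
Proof.
move=> hx ex /subnK <-; rewrite addnS -addSn iterD iterSr.
by rewrite (iter_e_divf _ hx ex) linearZ /= ex scaler0 iter_at0.
Qed.

(** Apply e to the first f^(m+1) x that vanishes: f^(m) x is nonzero, so its coefficient
    [c + 2j - m] must be 0. *)
Lemma highest_weight_ge0 j x : W j x -> e x = 0 -> x != 0 ->
  exists2 m : nat, c + 2 * j = m%:Z & dpow v f m.+1 x = 0.
Proof.
move=> hx ex x0; have [n0 fn0] := strip_fnil S hx.
have exn : exists n, iter n f x == 0 by exists n0; apply/eqP.
case: (ex_minnP exn) => [[|n]] fn nmin; first by rewrite (negbTE x0) in fn.
have fn' : dpow v f n x != 0.
  by rewrite divpow_eq0 //; apply/negP => /nmin; rewrite ltnn.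
move: fn; rewrite -(divpow_eq0 d_gt0) => /eqP fn.
exists n => //; have := e_divf n hx ex; rewrite -/v fn linear0 => /esym/eqP.
by rewrite scaler_eq0 (negbTE fn') orbF qbr_eq0 // subr_eq0 => /eqP.
Qed.

(** X k has weight c + 2k, so 0 <= c + k says that f^(k) does not leave the string of X k. X is
    defined on all of nat and vanishes from N on, which matters where [estring] reads [X k.+1] at
    the last index. *)
Definition hstring (u : V) (N : nat) (X : nat -> V) : Prop :=
  (forall k, [/\ W k%:Z (X k), e (X k) = 0 & X k != 0 -> 0 <= c + k%:Z /\ (k < N)%N])
  /\ u = \sum_(k < N) dpow v f k (X k).

(** Kashiwara's operators as relations: [etilde] and [ftilde] are defined on modules over U_q(g),
    whereas tensor products and the graph are only known as strips. *)
Definition estring (u w : V) : Prop :=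
  exists N X, hstring u N X /\ w = \sum_(k < N) dpow v f k (X k.+1).

Definition fstring (u w : V) : Prop :=
  exists N X, hstring u N X /\ w = \sum_(k < N) dpow v f k.+1 (X k).

Lemma hstring_sum u N N' X (F : nat -> V -> V) : hstring u N X -> (N <= N')%N ->
  (forall k, F k 0 = 0) -> \sum_(k < N) F k (X k) = \sum_(k < N') F k (X k).
Proof.
move=> [hX _] NN' F0; rewrite (big_ord_widen _ (fun k => F k (X k)) NN').
rewrite big_mkcond /=; apply: eq_bigr => k _; case: ifP => // kN.
have [_ _ h] := hX k; case: (eqVneq (X k) 0) => [->|/h [_]]; first by rewrite F0.
by rewrite kN.
Qed.

Lemma hstring_pad u N N' X : hstring u N X -> (N <= N')%N -> hstring u N' X.
Proof.
move=> h NN'; have [hX uE] := h; split=> [k|]; last first.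
  by rewrite uE (hstring_sum h NN' (F := fun k => dpow v f k)) // => k; apply: divpow_at0.
have [h1 h2 h3] := hX k; split=> // /h3 [-> kN]; split=> //; exact: leq_trans NN'.
Qed.

Lemma hstring_lin a u u' N X X' : hstring u N X -> hstring u' N X' ->
  hstring (a *: u + u') N (fun k => a *: X k + X' k).
Proof.
move=> [hX ->] [hX' ->]; split=> [k|].
  have [h1 h2 h3] := hX k; have [h1' h2' h3'] := hX' k; split.
  - exact: (strip_lin S).
  - by rewrite linearP /= h2 h2' scaler0 addr0.
  - case: (eqVneq (X k) 0) => [->|/h3 //]; rewrite scaler0 add0r; exact: h3'.
by rewrite scaler_sumr -big_split /=; apply: eq_bigr => k _; rewrite divpow_linear.
Qed.

(** The operator e^N kills the terms below N and multiplies the last X by a product of quantum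
    integers, nonzero because 0 <= c + N; so the X vanish from the top down. *)
Lemma hstring0 N X : hstring 0 N X -> forall k, X k = 0.
Proof.
elim: N => [|N IH] [hX uE] k; have [_ _ kN] := hX k.
  by apply/eqP/negPn/negP => /kN [].
suff XN : X N = 0.
  apply: IH; split=> [t|]; last by move: uE; rewrite big_ord_recr /= XN divpow_at0 addr0.
  have [h1 h2 h3] := hX t; split=> // Xt0; have [-> tN] := h3 Xt0; split=> //.
  by rewrite ltn_neqAle -ltnS tN andbT; apply: contraNneq Xt0 => ->; rewrite XN.
have [WN eN cN] := hX N.
have /(congr1 (iter N e)) := uE; rewrite iter_at0 big_ord_recr /= -[X in _ = iter N e X]addrC.
rewrite -[dpow v f N (X N)]scale1r iter_linear (iter_e_divf _ WN) // scale1r.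
have -> : iter N e (\sum_(i < N) dpow v f i (X i)) = 0.
  apply: (big_ind (fun y => iter N e y = 0)); first exact: iter_at0.
    by move=> x y hx hy; rewrite -[x]scale1r iter_linear hx hy scaler0 addr0.
  by move=> i _; have [h1 h2 _] := hX i; apply: (iter_e_divf_gt h1).
rewrite addr0 => /esym/eqP; rewrite scaler_eq0 => /orP[|/eqP //] /eqP p0.
apply/eqP/negPn/negP => /cN [cN0 _]; move/eqP: p0; apply/negP.
apply/prodf_neq0 => t _; rewrite qbr_eq0 //.
by have := ltn_ord t; lia.
Qed.

Lemma estring_lin a u u' w w' : estring u w -> estring u' w' ->
  estring (a *: u + u') (a *: w + w').
Proof.
move=> [N [X [h ->]]] [N' [X' [h' ->]]].
have hp := hstring_pad h (leq_maxl N N'); have hp' := hstring_pad h' (leq_maxr N N').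
exists (maxn N N'), (fun k => a *: X k + X' k); split; first exact: hstring_lin.
have sh u1 N1 N2 X1 : hstring u1 N1 X1 -> (N1 <= N2)%N ->
    \sum_(k < N1) dpow v f k (X1 k.+1) = \sum_(k < N2) dpow v f k (X1 k.+1).
  move=> h1 N12; rewrite (big_ord_widen _ (fun k => dpow v f k (X1 k.+1)) N12).
  rewrite big_mkcond /=; apply: eq_bigr => k _; case: ifP => // /negbT kN.
  have [_ _ h2] := h1.1 k.+1; case: (eqVneq (X1 k.+1) 0) => [->|/h2 [_ lt]].
    by rewrite divpow_at0.
  by rewrite ltnW in kN.
rewrite (sh _ _ _ _ h (leq_maxl N N')) (sh _ _ _ _ h' (leq_maxr N N')).
by rewrite scaler_sumr -big_split /=; apply: eq_bigr => k _; rewrite divpow_linear.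
Qed.

Lemma fstring_lin a u u' w w' : fstring u w -> fstring u' w' ->
  fstring (a *: u + u') (a *: w + w').
Proof.
move=> [N [X [h ->]]] [N' [X' [h' ->]]].
have hp := hstring_pad h (leq_maxl N N'); have hp' := hstring_pad h' (leq_maxr N N').
exists (maxn N N'), (fun k => a *: X k + X' k); split; first exact: hstring_lin.
have F0 k : dpow v f k.+1 (0 : V) = 0 by exact: divpow_at0.
rewrite (hstring_sum h (leq_maxl N N') (F := fun k => dpow v f k.+1)) //.
rewrite (hstring_sum h' (leq_maxr N N') (F := fun k => dpow v f k.+1)) //.
by rewrite scaler_sumr -big_split /=; apply: eq_bigr => k _; rewrite divpow_linear.
Qed.

Lemma estring0 w : estring 0 w -> w = 0.
Proof.
move=> [N [X [h ->]]]; have X0 := hstring0 h.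
by apply: big1 => k _; rewrite X0 divpow_at0.
Qed.

Lemma fstring0 w : fstring 0 w -> w = 0.
Proof.
move=> [N [X [h ->]]]; have X0 := hstring0 h.
by apply: big1 => k _; rewrite X0 divpow_at0.
Qed.

Lemma estring_uniq u w w' : estring u w -> estring u w' -> w = w'.
Proof.
move=> h h'; have := estring_lin (-1) h h'; rewrite !scaleN1r addNr => /estring0 /eqP.
by rewrite addrC subr_eq0 => /eqP.
Qed.

Lemma fstring_uniq u w w' : fstring u w -> fstring u w' -> w = w'.
Proof.
move=> h h'; have := fstring_lin (-1) h h'; rewrite !scaleN1r addNr => /fstring0 /eqP.
by rewrite addrC subr_eq0 => /eqP.
Qed.

Lemma estring_mem u w : estring u w -> W 1 w.
Proof.
move=> [N [X [[hX _] ->]]]; apply: strip_sum => k; have [h _ _] := hX k.+1.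
have E : k.+1%:Z - k%:Z = 1 by lia.
by have := strip_divf k h; rewrite E.
Qed.

Lemma fstring_mem u w : fstring u w -> W (- 1) w.
Proof.
move=> [N [X [[hX _] ->]]]; apply: strip_sum => k; have [h _ _] := hX k.
have E : k%:Z - k.+1%:Z = - 1 by lia.
by have := strip_divf k.+1 h; rewrite E.
Qed.

Lemma hstring_divf k x : W k%:Z x -> e x = 0 -> (x != 0 -> 0 <= c + k%:Z) ->
  hstring (dpow v f k x) k.+1 (fun t => if t == k then x else 0).
Proof.
move=> hx ex ck; split=> [t|]; last first.
  rewrite big_ord_recr /= eqxx big1 ?add0r // => t _.
  by rewrite ltn_eqF ?divpow_at0.
case: eqP => [->|_]; first by split=> // /ck.
by split; [exact: (strip0 S) | exact: linear0 | rewrite eqxx].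
Qed.

Lemma estring_divf k x : W k%:Z x -> e x = 0 -> (x != 0 -> 0 <= c + k%:Z) ->
  estring (dpow v f k x) (if k is k'.+1 then dpow v f k' x else 0).
Proof.
move=> hx ex ck; exists k.+1, (fun t => if t == k then x else 0).
split; first exact: hstring_divf.
case: k {hx ck} => [|k]; first by rewrite big_ord_recl big_ord0 /= divpow_at0 addr0.
rewrite big_ord_recr big_ord_recr /= eqxx (gtn_eqF (ltnSn _)) divpow_at0 addr0 big1 ?add0r // => t _.
by rewrite eqSS ltn_eqF ?divpow_at0.
Qed.

Lemma fstring_divf k x : W k%:Z x -> e x = 0 -> (x != 0 -> 0 <= c + k%:Z) ->
  fstring (dpow v f k x) (dpow v f k.+1 x).
Proof.
move=> hx ex ck; exists k.+1, (fun t => if t == k then x else 0).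
split; first exact: hstring_divf.
rewrite big_ord_recr /= eqxx big1 ?add0r // => t _.
by rewrite ltn_eqF ?divpow_at0.
Qed.

(** With x = e^N u for the previous N, e^N f^(N) multiplies x by the scalar p, nonzero as c >= 0.
    Subtracting f^(N) x / p from u makes e^N vanish on it and lowers N. *)
Lemma hstring_ex_ge0 N u : 0 <= c -> W 0 u -> iter N e u = 0 -> exists X, hstring u N X.
Proof.
move=> c0; elim: N u => [|N IH] u hu /= eu.
  exists (fun=> 0); split; last by rewrite big_ord0.
  by move=> k; split; [exact: (strip0 S) | exact: linear0 | rewrite eqxx].
pose x := iter N e u; pose p := \prod_(t < N) qbr v (c + 2 * N%:Z - t%:Z).
have Wx : W N%:Z x by rewrite -[N%:Z]add0r; exact: strip_iter_e.
have p0 : p != 0.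
  by apply/prodf_neq0 => t _; rewrite qbr_eq0 //; have := ltn_ord t; lia.
have [||X hX] := IH (- p^-1 *: dpow v f N x + u).
- apply: (strip_lin S) => //.
  by have := strip_divf N Wx; rewrite subrr.
- by rewrite iter_linear (iter_e_divf _ Wx) // scalerA mulNr mulVf // scaleN1r addNr.
have h1 := hstring_divf Wx eu (fun _ => ltac:(lia) : 0 <= c + N%:Z).
have h := hstring_lin p^-1 h1 (hstring_pad hX (leqnSn N)).
by eexists; move: h; rewrite addrA -scalerDl subrr scale0r add0r; apply.
Qed.

End Strip.

Section StripExistence.
Variables (V : lmodType Qq) (d : nat) (d_gt0 : (0 < d)%N).
Let v : Qq := qvar ^+ d.
Variables (e f : {linear V -> V}) (c : int) (W : int -> set V).
Hypothesis S : sl2_strip d e f c W.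

(* e and f exchange roles: a vector killed by f of weight - M is the bottom of
   a string whose top is its image under e^(M). *)
Lemma lowest_to_highest j z M : W j z -> f z = 0 -> c + 2 * j = - M%:Z ->
  e (dpow v e M z) = 0 /\
  forall a, (a <= M)%N -> dpow v f a (dpow v e M z) = dpow v e (M - a) z.
Proof.
move=> hz fz cM; have S' := strip_swap S.
have hz' : W (- - j) z by rewrite opprK.
split; last first.
  elim=> [|a IH] aM; first by rewrite divpow0 subn0.
  rewrite divpowS // IH ?(ltnW aM) // -[in LHS](subnSK aM).
  rewrite (e_divf d_gt0 S' _ hz') //.
  have -> : - c + 2 * - j - (M - a.+1)%N%:Z = a.+1%:Z by lia.
  by rewrite scalerA mulVf ?scale1r // qbr_eq0.
case: (eqVneq z 0) => [->|z0]; first by rewrite divpow_at0 linear0.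
have [m mE h] := highest_weight_ge0 d_gt0 S' hz' fz z0.
have -> : M = m by lia.
by rewrite op_divpow // h scaler0.
Qed.

(** For c < 0, decompose u with e and f exchanged, where its weight is positive, and read each
    string from its other end. *)
Lemma hstring_ex u : W 0 u -> exists N X, hstring d e f c W u N X.
Proof.
move=> hu; case: (lerP 0 c) => c0.
  have [N eN] := strip_enil S hu.
  by have [X h] := hstring_ex_ge0 d_gt0 S c0 hu eN; exists N, X.
have S' := strip_swap S; have hu' : (fun j => W (- j)) 0 u by rewrite /= oppr0.
have [N fN] := strip_enil S' hu'.
have c0' : 0 <= - c by lia.
have [Z [hZ uE]] := hstring_ex_ge0 d_gt0 S' c0' hu' fN.
pose C := `|c|%N; have cE : c = - C%:Z by rewrite /C; lia.
(* Z k lies k steps below u and its string has length 2k + C, so the top lies k + C steps above u;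
   indices below C carry nothing. *)
pose X j := if (j < C)%N then 0 else dpow v e (j - C + (j - C) + C) (Z (j - C)%N).
have XC k : X (k + C)%N = dpow v e (k + k + C) (Z k).
  by rewrite /X ltnNge leq_addl /= addnK.
have low k : e (X (k + C)%N) = 0 /\ dpow v f (k + C) (X (k + C)%N) = dpow v e k (Z k).
  have [h1 h2 _] := hZ k; rewrite XC.
  have [|h3 h4] := lowest_to_highest (M := k + k + C) h1 h2; first by rewrite cE; lia.
  split=> //; rewrite h4; last by lia.
  by congr dpow; lia.
exists (N + C)%N, X; split=> [j|].
  case: (ltnP j C) => jC.
    by rewrite /X jC; split; [exact: (strip0 S) | exact: linear0 | rewrite eqxx].
  rewrite -(subnK jC); set k := (j - C)%N.
  have [h1 h2 h3] := hZ k; split; last 1 first.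
  - move=> X0; split; first by lia.
    have /h3 [_] : Z k != 0 by apply: contraNneq X0; rewrite XC => ->; rewrite divpow_at0.
    by rewrite ltn_add2r.
  - have E : - (k%:Z - (k + k + C)%N%:Z) = (k + C)%N%:Z by lia.
    by rewrite XC; have := strip_divf d_gt0 S' (k + k + C) h1; rewrite /= E.
  - by case: (low k).
rewrite uE addnC big_split_ord /= [X in _ = X + _]big1 ?add0r => [|i _].
  by apply: eq_bigr => k _; have [_ <-] := low k; rewrite addnC.
by rewrite /X ltn_ord divpow_at0.
Qed.

Lemma estring_ex u : W 0 u -> exists w, estring d e f c W u w.
Proof. by move=> /hstring_ex [N [X h]]; eexists; exists N, X; split. Qed.

Lemma fstring_ex u : W 0 u -> exists w, fstring d e f c W u w.
Proof. by move=> /hstring_ex [N [X h]]; eexists; exists N, X; split. Qed.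

End StripExistence.

Section StripMap.
Variables (V : lmodType Qq) (d : nat) (e f : {linear V -> V}) (c : int).
Variables (V' : lmodType Qq) (e' f' : {linear V' -> V'}) (g : {linear V -> V'}).
Variables (W : int -> set V) (W' : int -> set V').
Hypothesis ge : forall x, g (e x) = e' (g x).
Hypothesis gf : forall x, g (f x) = f' (g x).
Hypothesis gW : forall j x, W j x -> W' j (g x).

Lemma divpow_map n x : g (dpow (qvar ^+ d) f n x) = dpow (qvar ^+ d) f' n (g x).
Proof.
rewrite !dpowE /divpow linearZ; congr (_ *: _).
by elim: n => //= n IH; rewrite gf IH.
Qed.

Lemma hstring_map u N X : hstring d e f c W u N X ->
  hstring d e' f' c W' (g u) N (g \o X).
Proof.
move=> [hX ->]; split=> [k|].
  have [h1 h2 h3] := hX k; split; first exact: gW.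
    by rewrite /= -ge h2 linear0.
  by move=> X0; apply: h3; apply: contraNneq X0 => /= ->; rewrite linear0.
by rewrite linear_sum; apply: eq_bigr => k _; exact: divpow_map.
Qed.

Lemma estring_map u w : estring d e f c W u w -> estring d e' f' c W' (g u) (g w).
Proof.
move=> [N [X [h ->]]]; exists N, (g \o X); split; first exact: hstring_map.
by rewrite linear_sum; apply: eq_bigr => k _; exact: divpow_map.
Qed.

Lemma fstring_map u w : fstring d e f c W u w -> fstring d e' f' c W' (g u) (g w).
Proof.
move=> [N [X [h ->]]]; exists N, (g \o X); split; first exact: hstring_map.
by rewrite linear_sum; apply: eq_bigr => k _; exact: divpow_map.
Qed.

End StripMap.

(** * Lattices *)

Section LinearSpans.
Variable V : lmodType Qq.
Implicit Types (S : set Qq) (X : set V).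

Definition smodule S (P : set V) : Prop :=
  P 0 /\ forall a x y, S a -> P x -> P y -> P (a *: x + y).

Lemma lspan_ind S X (P : set V) : smodule S P -> X `<=` P -> lspan S X `<=` P.
Proof.
move=> [P0 PL] XP _ [s [hs ->]]; rewrite big_seq.
by apply: big_rec => // p x ps Px; have [Sp Xp] := hs _ ps; apply: PL => //; apply: XP.
Qed.

Lemma mem_lspan S X x : S 1 -> X x -> lspan S X x.
Proof.
move=> S1 Xx; exists [:: (1, x)]; split; last by rewrite big_seq1 scale1r.
by move=> p; rewrite inE => /eqP ->.
Qed.

Lemma lspan_smodule S X : (forall a b, S a -> S b -> S (a * b)) -> smodule S (lspan S X).
Proof.
move=> SM; split; first by exists [::]; split=> //; rewrite big_nil.
move=> a x y Sa [s [hs ->]] [s' [hs' ->]].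
exists ([seq (a * p.1, p.2) | p <- s] ++ s'); split=> [p|].
  rewrite mem_cat => /orP[/mapP[p' /hs [S1 X1] ->]|/hs' //].
  by split=> //=; exact: SM.
rewrite big_cat big_map /= scaler_sumr; congr (_ + _).
by apply: eq_bigr => p _; rewrite scalerA.
Qed.

Lemma smoduleD S P x y : S 1 -> smodule S P -> P x -> P y -> P (x + y).
Proof. by move=> S1 [_ h] hx hy; rewrite -[x]scale1r; apply: h. Qed.

Lemma smoduleZ S P a x : smodule S P -> S a -> P x -> P (a *: x).
Proof. by move=> [h0 h] Sa hx; rewrite -[_ *: _]addr0; apply: h. Qed.

Lemma smodule_sum S P I (r : seq I) (Q : pred I) (F : I -> V) : S 1 -> smodule S P ->
  (forall i, Q i -> P (F i)) -> P (\sum_(i <- r | Q i) F i).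
Proof. by move=> S1 hP hF; apply: big_ind => //; [case: hP | move=> x y; exact: smoduleD S1 hP]. Qed.

Lemma lspan_span X : smodule setT (lspan setT X).
Proof. exact: lspan_smodule. Qed.

Lemma lspan_lattice X : smodule regular0 (lspan regular0 X).
Proof. by apply: lspan_smodule => a b; exact: regular0M. Qed.

Lemma lspan_clear X x : lspan setT X x -> exists N, lspan regular0 X (qvar ^+ N *: x).
Proof.
apply: (@lspan_ind setT X (fun x => exists N, lspan regular0 X (qvar ^+ N *: x))).
  split; first by exists 0%N; rewrite scaler0; case: (lspan_lattice X).
  move=> a y z _ [N hy] [N' hz]; have [M hM] := regular0_qpow a.
  exists (M + N + N')%N; rewrite scalerDr; apply: (smoduleD regular0_1 (lspan_lattice X)).
    rewrite scalerA; have -> : qvar ^+ (M + N + N') * a = qvar ^+ N' * (qvar ^+ M * a) * qvar ^+ N.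
      by rewrite !exprD; ring.
    rewrite -scalerA; apply: (smoduleZ (lspan_lattice X) _ hy).
    by apply: regular0M => //; exact: regular0X regular0_q.
  rewrite exprD -scalerA; apply: (smoduleZ (lspan_lattice X) _ hz).
  exact: regular0X regular0_q.
move=> y Xy; exists 0%N; rewrite expr0 scale1r; apply: mem_lspan => //; exact: regular0_1.
Qed.

End LinearSpans.

(* R is a linear operator given by its graph.  If R maps a perturbation
   x + q y, with y in L, of each generator x of L into L', then it maps L into
   L': a denominator q^N common to all R x can be lowered to q^(N-1). *)
Lemma lattice_descent (V V' : lmodType Qq) (R : V -> V' -> Prop) (X : set V) (L' : set V') :
  R 0 0 -> (forall a x y x' y', R x x' -> R y y' -> R (a *: x + y) (a *: x' + y')) ->
  smodule regular0 L' ->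
  (exists N, forall x, X x -> exists w, R x w /\ L' (qvar ^+ N *: w)) ->
  (forall x, X x -> exists y z, [/\ lspan regular0 X y, R (x + qvar *: y) z & L' z]) ->
  forall x, lspan regular0 X x -> exists w, R x w /\ L' w.
Proof.
move=> R0 RL hL' [N hN] hX.
have ext M : (forall x, X x -> exists w, R x w /\ L' (qvar ^+ M *: w)) ->
    forall x, lspan regular0 X x -> exists w, R x w /\ L' (qvar ^+ M *: w).
  move=> h; apply: lspan_ind h; split.
    by exists 0; split=> //; rewrite scaler0; case: hL'.
  move=> a x y ra [w [Rw Lw]] [z [Rz Lz]]; exists (a *: w + z); split; first exact: RL.
  rewrite scalerDr scalerA mulrC -scalerA; apply: (proj2 hL') => //.
suff h : forall x, lspan regular0 X x -> exists w, R x w /\ L' (qvar ^+ 0 *: w).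
  by move=> x /h [w [Rw]]; rewrite expr0 scale1r => Lw; exists w.
move/ext: hN; elim: N => [//|N IH] hN; apply: IH; apply: ext => x Xx.
have [y [z [Ly Rz Lz]]] := hX x Xx; have [w [Rw Lw]] := hN y Ly.
exists (- qvar *: w + z); split.
  have E : - qvar *: y + (x + qvar *: y) = x by rewrite scaleNr addrC addrK.
  by have := RL (- qvar) _ _ _ _ Rw Rz; rewrite E.
rewrite scalerDr scalerA mulrN -exprSr scaleNr -scalerN; apply: (smoduleD regular0_1 hL').
  rewrite scalerN -scaleN1r; apply: (smoduleZ hL' _ Lw); apply: regular0N; exact: regular0_1.
by apply: (smoduleZ hL' _ Lz); exact: regular0X regular0_q.
Qed.

Lemma hw_coef_cancel (F : fieldType) (a b c g : F) : c != 0 -> a != 0 ->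
  - (a * b / c) * g * (a^-1 * c) + g * b = 0.
Proof. by move=> c0 a0; field; rewrite c0 a0. Qed.

(** * Tensor products of two strings *)

Section TensorStrings.
Variables (T : lmodType Qq) (d : nat) (d_gt0 : (0 < d)%N).
Let v : Qq := qvar ^+ d.

(* E j k plays the role of f^(j) x (x) f^(k) y for highest weight vectors x
   and y of weights m and n. *)
Record tensor_strings (e f : {linear T -> T}) (m n : nat) (E : nat -> nat -> T) : Prop :=
  TensorStrings {
  ts_out : forall j k, (m < j)%N || (n < k)%N -> E j k = 0;
  ts_e : forall j k, e (E j k) =
    (if j is j'.+1 then (v ^ (2 * k%:Z - n%:Z) * qbr v (m%:Z - j'%:Z)) *: E j' k else 0)
    + (if k is k'.+1 then qbr v (n%:Z - k'%:Z) *: E j k' else 0);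
  ts_f : forall j k, f (E j k) =
    qbr v (j%:Z + 1) *: E j.+1 k + (v ^ (m%:Z - 2 * j%:Z) * qbr v (k%:Z + 1)) *: E j k.+1;
  ts_ef : forall j k, e (f (E j k)) - f (e (E j k)) =
    qbr v (m%:Z + n%:Z - 2 * (j + k)%N%:Z) *: E j k
}.

Definition ts_set (E : nat -> nat -> T) (t : int) : set T :=
  [set x | exists j k : nat, (j + k)%N%:Z = t /\ x = E j k].

(** Counted from the lowest vectors x' and y' of the two strings, this entry is e^(k) x' (x) e^(j)
    y'. Exchanging e with f and also the two factors preserves the relations of the model, with m
    and n exchanged. The guard is there because truncated subtraction would return boundary entries
    of E. *)
Definition ts_flip (m n : nat) (E : nat -> nat -> T) (j k : nat) : T :=
  if (j <= n)%N && (k <= m)%N then E (m - k)%N (n - j)%N else 0.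

Lemma ts_flipP e f m n E : tensor_strings e f m n E ->
  tensor_strings f e n m (ts_flip m n E).
Proof.
move=> [hout he hf hef].
have out1 j k : (n < j)%N -> ts_flip m n E j k = 0 by move=> h; rewrite /ts_flip leqNgt h.
have out2 j k : (m < k)%N -> ts_flip m n E j k = 0.
  by move=> h; rewrite /ts_flip [(k <= m)%N]leqNgt h andbF.
split.
- by move=> j k /orP[]; [exact: out1 | exact: out2].
- move=> j k; case: (leqP j n) => jn; last first.
    rewrite out1 // linear0; case: j jn => // j jn.
    have -> : (if k is k'.+1 then qbr v (m%:Z - k'%:Z) *: ts_flip m n E j.+1 k' else 0) = 0.
      by case: k => // k; rewrite out1 // scaler0.
    rewrite addr0; case: (leqP j n) => jn'; last by rewrite out1 // scaler0.
    have -> : n%:Z - j%:Z = 0 by lia.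
    by rewrite qbr0 mulr0 scale0r.
  case: (leqP k m) => km; last first.
    rewrite out2 // linear0; case: k km => // k km.
    have -> : (if j is j'.+1 then (v ^ (2 * k.+1%:Z - m%:Z) * qbr v (n%:Z - j'%:Z)) *:
        ts_flip m n E j' k.+1 else 0) = 0.
      by case: j {jn} => // j; rewrite out2 // scaler0.
    rewrite add0r; case: (leqP k m) => km'; last by rewrite out2 // scaler0.
    have -> : m%:Z - k%:Z = 0 by lia.
    by rewrite qbr0 scale0r.
  rewrite {1}/ts_flip jn km /= hf addrC; congr (_ + _).
    case: j jn => [|j] jn; first by rewrite subn0 hout ?scaler0 // ltnSn orbT.
    rewrite /ts_flip (ltnW jn) km /=.
    have -> : m%:Z - 2 * (m - k)%N%:Z = 2 * k%:Z - m%:Z by lia.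
    have -> : (n - j.+1)%N%:Z + 1 = n%:Z - j%:Z by lia.
    by rewrite subnSK.
  case: k km => [|k] km; first by rewrite subn0 hout ?scaler0 // ltnSn.
  rewrite /ts_flip (ltnW km) jn /=.
  have -> : (m - k.+1)%N%:Z + 1 = m%:Z - k%:Z by lia.
  by rewrite subnSK.
- move=> j k; case: (leqP j n) => jn; last first.
    by rewrite !out1 ?linear0 ?scaler0 ?addr0 // ltnW.
  case: (leqP k m) => km; last first.
    by rewrite !out2 ?linear0 ?scaler0 ?addr0 // ltnW.
  rewrite {1}/ts_flip jn km /= he addrC; congr (_ + _).
    rewrite /ts_flip km andbT; case: (ltnP j n) => jn'; last first.
      by have -> : (n - j = 0)%N by [lia]; rewrite scaler0.
    rewrite -[in LHS](subnSK jn').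
    by have -> : n%:Z - (n - j.+1)%N%:Z = j%:Z + 1 by lia.
  rewrite /ts_flip jn /=; case: (ltnP k m) => km'; last first.
    by have -> : (m - k = 0)%N by [lia]; rewrite scaler0.
  rewrite -[in LHS](subnSK km').
  have -> : m%:Z - (m - k.+1)%N%:Z = k%:Z + 1 by lia.
  by have -> : 2 * (n - j)%N%:Z - n%:Z = n%:Z - 2 * j%:Z by lia.
- move=> j k; rewrite /ts_flip; case: ifP => [/andP[jn km]|_]; last first.
    by rewrite !linear0 ?subr0 ?addr0 ?scaler0.
  rewrite -opprB hef -scaleNr -qbrN; congr (qbr v _ *: _); lia.
Qed.

Section Model.
Variables (e f : {linear T -> T}) (m n : nat) (E : nat -> nat -> T).
Hypothesis hE : tensor_strings e f m n E.

Lemma smodule0 S : smodule S [set (0 : T)].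
Proof. by split=> // a x y _ -> ->; rewrite scaler0 addr0. Qed.

Lemma ts_span_e s x : lspan setT (ts_set E s) x -> lspan setT (ts_set E (s - 1)) (e x).
Proof.
have hM := lspan_span (ts_set E (s - 1)).
apply: (@lspan_ind _ setT _ (fun x => lspan setT (ts_set E (s - 1)) (e x))).
  split=> [|a y z _ hy hz]; first by rewrite linear0; case: hM.
  by rewrite linearP; apply: (proj2 hM).
move=> _ [j [k [jk ->]]]; rewrite (ts_e hE); apply: (smoduleD _ hM) => //.
  case: j jk => [|j] jk; first by case: hM.
  by apply: (smoduleZ hM) => //; apply: mem_lspan => //; exists j, k; split=> //; lia.
case: k jk => [|k] jk; first by case: hM.
by apply: (smoduleZ hM) => //; apply: mem_lspan => //; exists j, k; split=> //; lia.
Qed.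

Lemma ts_span_f s x : lspan setT (ts_set E s) x -> lspan setT (ts_set E (s + 1)) (f x).
Proof.
have hM := lspan_span (ts_set E (s + 1)).
apply: (@lspan_ind _ setT _ (fun x => lspan setT (ts_set E (s + 1)) (f x))).
  split=> [|a y z _ hy hz]; first by rewrite linear0; case: hM.
  by rewrite linearP; apply: (proj2 hM).
move=> _ [j [k [jk ->]]]; rewrite (ts_f hE); apply: (smoduleD _ hM) => //.
  by apply: (smoduleZ hM) => //; apply: mem_lspan => //; exists j.+1, k; split=> //; lia.
by apply: (smoduleZ hM) => //; apply: mem_lspan => //; exists j, k.+1; split=> //; lia.
Qed.

Lemma ts_span_neg s x : (s < 0) || (m%:Z + n%:Z < s) -> lspan setT (ts_set E s) x -> x = 0.
Proof.
move=> s0; apply: (@lspan_ind _ setT _ [set 0]); first exact: smodule0.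
move=> _ [j [k [jk ->]]]; apply: (ts_out hE); lia.
Qed.

(** The degree j + k of [E j k] counts steps down, the index of a strip counts steps up; hence t -
    j. *)
Lemma ts_strip (t : int) :
  sl2_strip d e f (m%:Z + n%:Z - 2 * t) (fun j => lspan setT (ts_set E (t - j))).
Proof.
split.
- by move=> j; case: (lspan_span (ts_set E (t - j))).
- by move=> j a x y; apply: (proj2 (lspan_span _)).
- by move=> j x /ts_span_e; have -> : t - j - 1 = t - (j + 1) by lia.
- by move=> j x /ts_span_f; have -> : t - j + 1 = t - (j - 1) by lia.
- move=> j x; apply: (@lspan_ind _ setT _ [set x | _ = _ *: x]).
    split=> [|a y z _ hy hz] /=; first by rewrite !linear0 ?subr0 ?addr0 ?scaler0.
    have -> : e (f (a *: y + z)) = a *: e (f y) + e (f z) by rewrite !linearP.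
    have -> : f (e (a *: y + z)) = a *: f (e y) + f (e z) by rewrite !linearP.
    by rewrite scalerDr scalerA mulrC -scalerA -hy -hz opprD addrACA scalerBr.
  move=> _ [a [b [ab ->]]] /=; rewrite (ts_ef hE) ab.
  by congr (qbr _ _ *: _); lia.
- move=> j x hx; exists (`|t - j|%N.+1).
  suff h N s y : lspan setT (ts_set E s) y -> s < N%:Z -> iter N e y = 0 by apply: h hx _; lia.
  elim: N s y => [|N IH] s y hy sN; first by apply: ts_span_neg hy; rewrite sN.
  by rewrite iterSr; apply: (IH (s - 1)); [exact: ts_span_e | lia].
- move=> j x hx; exists ((m + n + `|t - j|)%N.+1).
  suff h N s y : lspan setT (ts_set E s) y -> m%:Z + n%:Z < s + N%:Z -> iter N f y = 0.
    by apply: h hx _; lia.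
  elim: N s y => [|N IH] s y hy sN; first by apply: ts_span_neg hy; apply/orP; right; lia.
  by rewrite iterSr; apply: (IH (s + 1)); [exact: ts_span_f | lia].
Qed.

Section HighestWeight.
Variables (l : nat) (lm : (l <= m)%N) (ln : (l <= n)%N).

(** Coefficients of the Clebsch-Gordan highest weight vector of weight m + n - 2l, normalised at
    [E 0 l]: the vanishing of the coefficient of [E t (l - t - 1)] in its image under e gives the
    ratio of consecutive ones. *)
Fixpoint hw_coef (t : nat) : Qq :=
  if t is t'.+1 then
    - (v ^ (n%:Z - 2 * (l%:Z - t'%:Z - 1)) * qbr v (n%:Z - l%:Z + t'%:Z + 1)
       / qbr v (m%:Z - t'%:Z)) * hw_coef t'
  else 1.

Arguments hw_coef _ : simpl never.

Lemma hw_coefS t : hw_coef t.+1 =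
  - (v ^ (n%:Z - 2 * (l%:Z - t%:Z - 1)) * qbr v (n%:Z - l%:Z + t%:Z + 1)
     / qbr v (m%:Z - t%:Z)) * hw_coef t.
Proof. by []. Qed.

Definition hw_vect : T := \sum_(t < l.+1) hw_coef t *: E t (l - t)%N.

Lemma hw_vect_e : e hw_vect = 0.
Proof.
rewrite /hw_vect linear_sum /=.
under eq_bigr => t _ do rewrite linearZ /= (ts_e hE) scalerDr.
rewrite big_split /= big_ord_recl /= scaler0 add0r.
rewrite [X in _ + X]big_ord_recr /= subnn scaler0 addr0 -big_split /=.
apply: big1 => t _; have tl := ltn_ord t; rewrite /bump /= add1n.
rewrite -(subnSK tl) !scalerA -scalerDl [X in X *: _](_ : _ = 0) ?scale0r //.
have -> : 2 * (l - t.+1)%N%:Z - n%:Z = - (n%:Z - 2 * (l%:Z - t%:Z - 1)) by lia.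
have -> : n%:Z - (l - t.+1)%N%:Z = n%:Z - l%:Z + t%:Z + 1 by lia.
have b0 : qbr v (m%:Z - t%:Z) != 0 by rewrite qbr_eq0 //; lia.
have a0 : v ^ (n%:Z - 2 * (l%:Z - t%:Z - 1)) != 0 by rewrite expfz_neq0 ?qd_neq0.
rewrite hw_coefS -invr_expz; exact: (hw_coef_cancel _ _ b0 a0).
Qed.

(** The orders of the power of v, of [n - l + t + 1] and of 1 / [m - t] add up to m - l + 1 in each
    ratio. This is positive, so [E 0 l] leads [hw_vect] modulo q. *)
Lemma hw_coef_ord t : (t <= l)%N -> ordq v (t%:Z * (m%:Z - l%:Z + 1)) (hw_coef t).
Proof.
elim: t => [|t IH] tl; first by rewrite mul0r /ordq oppr0 mulr1; apply: regular0_1.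
have -> : t.+1%:Z * (m%:Z - l%:Z + 1)
    = (n%:Z - 2 * (l%:Z - t%:Z - 1) + (1 - (n - l + t + 1)%N%:Z) + ((m - t)%N%:Z - 1))
      + t%:Z * (m%:Z - l%:Z + 1) by lia.
apply: ordqM; last by apply: IH; exact: ltnW.
apply: ordqN; apply: ordqM.
  apply: ordqM; first exact: ordq_v.
  have -> : n%:Z - l%:Z + t%:Z + 1 = (n - l + t + 1)%N%:Z by lia.
  by apply: ordq_qbr; lia.
have -> : m%:Z - t%:Z = (m - t)%N%:Z by lia.
by apply: ordq_qbrV; lia.
Qed.

(* The order at q = 0 of the coefficient of E (l + k - s) s in f^(k) hw_vect,
   where M = m - l - k. *)
Definition hw_ord (M : int) (s : nat) : int :=
  if (s < l)%N then (l%:Z - s%:Z) * (1 + M)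
  else (s%:Z - l%:Z) * (s%:Z - l%:Z) + M * (s%:Z - l%:Z).

(** Induction on k, applying f and dividing by [k + 1]. As k <= m - l, the number M in [hw_ord] is
    nonnegative, so every bound except the one at s = l is positive: [E k l] leads f^(k) [hw_vect]
    modulo q. *)
Lemma divf_hw_vect k : (k <= m - l)%N -> exists g : nat -> Qq,
  [/\ dpow v f k hw_vect = \sum_(s < (l + k).+1) g s *: E (l + k - s)%N s,
      forall s, ordq v (hw_ord (m%:Z - l%:Z - k%:Z) s) (g s)
    & exists2 y, regular0 y & g l = 1 + qvar * y].
Proof.
elim: k => [|k IH] km.
  exists (fun s => if (s <= l)%N then hw_coef (l - s) else 0); split.
  - rewrite divpow0 addn0 /hw_vect (reindex_inj rev_ord_inj) /=.
    apply: eq_bigr => s _; have sl := ltn_ord s; rewrite -ltnS sl subSS.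
    by rewrite subKn.
  - move=> s; rewrite subr0 /hw_ord; case: (leqP s l) => sl; last exact: ordq0.
    have h := hw_coef_ord (leq_subr s l).
    case: ltnP => sl'; apply: (ordqW d_gt0 _ h); last first.
      have -> : s = l by lia.
      by rewrite subnn subrr !mulr0 mul0r.
    have -> : (l - s)%N%:Z = l%:Z - s%:Z by lia.
    by rewrite [1 + _]addrC.
  - by exists 0; [exact: regular0_0 | rewrite leqnn subnn mulr0 addr0].
have [g [gE gO [y ry gl]]] := IH (ltnW km).
pose M := m%:Z - l%:Z - k%:Z.
(* [E (l + k + 1 - s) s] arises from [E (l + k - s) s] by f on the left factor and from
   [E (l + k + 1 - s) (s - 1)] by f on the right one. *)
pose g' s := (qbr v k.+1%:Z)^-1 *
  ((if (s <= l + k)%N then qbr v ((l + k - s)%N%:Z + 1) * g s else 0)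
   + (if s is s'.+1 then v ^ (m%:Z - 2 * (l%:Z + k%:Z - s'%:Z)) * qbr v (s'%:Z + 1) * g s' else 0)).
exists g'; split.
- rewrite divpowS // gE linear_sum /=.
  under eq_bigr => s _ do rewrite linearZ /= (ts_f hE) scalerDr.
  rewrite big_split /= [RHS](_ : _ = (qbr v k.+1%:Z)^-1 *:
    (\sum_(s < (l + k.+1).+1) (if (s <= l + k)%N then qbr v ((l + k - s)%N%:Z + 1) * g s else 0)
        *: E (l + k.+1 - s)%N s
     + \sum_(s < (l + k.+1).+1) (if nat_of_ord s is s'.+1 then
          v ^ (m%:Z - 2 * (l%:Z + k%:Z - s'%:Z)) * qbr v (s'%:Z + 1) * g s' else 0)
        *: E (l + k.+1 - s)%N s)); last first.
    rewrite -big_split /= scaler_sumr; apply: eq_bigr => s _.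
    by rewrite -scalerDl scalerA.
  congr (_ *: (_ + _)).
    rewrite addnS [RHS]big_ord_recr /= ltnn scale0r addr0; apply: eq_bigr => s _.
    by rewrite -ltnS ltn_ord scalerA mulrC subSn // -ltnS.
  rewrite addnS [RHS]big_ord_recl /= scale0r add0r; apply: eq_bigr => s _.
  rewrite /bump /= add1n subSS scalerA mulrC.
  by have -> : (l + k - s)%N%:Z = l%:Z + k%:Z - s%:Z by have := ltn_ord s; lia.
- have kO : ordq v (k.+1%:Z - 1) (qbr v k.+1%:Z)^-1 by exact: ordq_qbrV.
  have -> : m%:Z - l%:Z - k.+1%:Z = M - 1 by rewrite /M; lia.
  move=> s.
  have O1 : ordq v (hw_ord (M - 1) s - (k.+1%:Z - 1))
      (if (s <= l + k)%N then qbr v ((l + k - s)%N%:Z + 1) * g s else 0).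
    case: leqP => slk; last exact: ordq0.
    have -> : (l + k - s)%N%:Z + 1 = (l + k - s).+1%:Z by lia.
    apply: (ordqW d_gt0 _ (ordqM (ordq_qbr d_gt0 (ltn0Sn _)) (gO s))).
    rewrite -/M /hw_ord; case: ltnP => sl; nia.
  have O2 : ordq v (hw_ord (M - 1) s - (k.+1%:Z - 1))
     (if s is s'.+1 then v ^ (m%:Z - 2 * (l%:Z + k%:Z - s'%:Z)) * qbr v (s'%:Z + 1) * g s' else 0).
    case: s {O1} => [|s]; first exact: ordq0.
    have -> : s%:Z + 1 = s.+1%:Z by lia.
    apply: (ordqW d_gt0 _ (ordqM (ordqM (ordq_v _ _) (ordq_qbr d_gt0 (ltn0Sn _))) (gO s))).
    rewrite -/M /hw_ord; case: (ltnP s.+1 l) => sl; case: (ltnP s l) => sl'; nia.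
  have -> : hw_ord (M - 1) s = (k.+1%:Z - 1) + (hw_ord (M - 1) s - (k.+1%:Z - 1)) by lia.
  by apply: ordqM => //; apply: ordqD.
(* At s = l the first term gives back g l exactly, since its factor [k + 1] cancels; the second
   term, treated here, has positive order. *)
- have X1 : ordq v 1 ((qbr v k.+1%:Z)^-1 *
      (if l is s'.+1 then v ^ (m%:Z - 2 * (l%:Z + k%:Z - s'%:Z)) * qbr v (s'%:Z + 1) * g s' else 0)).
    rewrite {1}[l]lock; case lE : (locked l) => [|s]; first by rewrite mulr0; exact: ordq0.
    have ls : l = s.+1 by rewrite -lE -lock.
    have -> : s%:Z + 1 = s.+1%:Z by lia.
    apply: (ordqW d_gt0 _ (ordqM (ordq_qbrV d_gt0 (ltn0Sn k))
      (ordqM (ordqM (ordq_v _ _) (ordq_qbr d_gt0 (ltn0Sn _))) (gO s)))).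
    rewrite /hw_ord ls ltnSn; lia.
  have [z rz zE] := ordq_qmul d_gt0 (isT : 0 < 1 :> int) X1.
  exists (y + z); first exact: regular0D.
  rewrite /g' leq_addr mulrDr zE.
  have -> : (l + k - l)%N%:Z + 1 = k.+1%:Z by lia.
  rewrite mulrA mulVf ?qbr_eq0 // mul1r gl mulrDr.
  by rewrite addrA.
Qed.

Lemma hw_vect_span : lspan setT (ts_set E l%:Z) hw_vect.
Proof.
apply: (smodule_sum (S := setT)) => //; first exact: lspan_span.
move=> t _; apply: (smoduleZ (lspan_span _)) => //; apply: mem_lspan => //.
by exists t, (l - t)%N; split=> //; have := ltn_ord t; lia.
Qed.

Lemma divf_hw_lead k : (k <= m - l)%N ->
  exists2 y, lspan regular0 (ts_set E (l + k)%N%:Z) y & dpow v f k hw_vect = E k l + qvar *: y.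
Proof.
move=> km; have [g [-> gO gl]] := divf_hw_vect km.
have /choice[y hy] : forall s, exists z, regular0 z /\ g s = (s == l)%:R + qvar * z.
  move=> s; case: (eqVneq s l) => [->|sl].
    by have [z rz zE] := gl; exists z.
  have := gO s; rewrite /hw_ord; case: ltnP => sl' /(ordq_qmul d_gt0).
    by case; [nia | move=> z rz ->; exists z; rewrite add0r].
  by case; [nia | move=> z rz ->; exists z; rewrite add0r].
exists (\sum_(s < (l + k).+1) y s *: E (l + k - s)%N s).
  apply: (smodule_sum _ regular0_1 (lspan_lattice _)) => s _.
  apply: (smoduleZ (lspan_lattice _)); first by case: (hy s).
  apply: (mem_lspan regular0_1); exists (l + k - s)%N, s; split=> //.
  by have := ltn_ord s; lia.
have lk : (l < (l + k).+1)%N by rewrite ltnS leq_addr.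
rewrite scaler_sumr (bigD1 (Ordinal lk)) //= [in RHS](bigD1 (Ordinal lk)) //= addrA.
have [_ ->] := hy l; rewrite eqxx scalerDl scale1r scalerA addKn; congr (_ + _).
apply: eq_bigr => s; rewrite -val_eqE /= => /negbTE sl; have [_ ->] := hy s.
by rewrite sl add0r scalerA.
Qed.

End HighestWeight.

Local Notation cw t := (m%:Z + n%:Z - 2 * t).
Local Notation Wt t := (fun j : int => lspan setT (ts_set E (t - j))).
Local Notation Lt t := (lspan regular0 (ts_set E t)).

(** For j + k <= m, modulo q, [E j k] is the j-th member of the string whose highest weight vector
    is led by [E 0 k]. *)
Lemma ts_estring_lower j k : (j + k <= m)%N -> (k <= n)%N -> let t := (j + k)%N%:Z in
  exists y z y', [/\ Lt t y, estring d e f (cw t) (Wt t) (E j k + qvar *: y) z, Lt (t - 1) y'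
    & z = (if j is j'.+1 then E j' k else 0) + qvar *: y'].
Proof.
move=> jkm kn t; have km : (k <= m)%N by lia.
have [|y Ly yE] := @divf_hw_lead k km kn j; first by lia.
have Wh : lspan setT (ts_set E (t - j%:Z)) (hw_vect k).
  by have := hw_vect_span km kn; rewrite (_ : t - j%:Z = k%:Z) // /t; lia.
have := estring_divf (ts_strip t) (k := j) Wh (hw_vect_e km kn) (fun _ => ltac:(lia)).
rewrite yE => h; move: Ly; rewrite addnC => Ly; case: j @t jkm yE Wh Ly h => [|j] t jkm yE Wh Ly h.
  by exists y, 0, 0; split=> //; [case: (lspan_lattice (ts_set E (t - 1)))|rewrite scaler0 addr0].
have [|y' Ly' y'E] := @divf_hw_lead k km kn j; first by lia.
exists y, (dpow v f j (hw_vect k)), y'; split=> //.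
by move: Ly'; rewrite (_ : (k + j)%N%:Z = t - 1) // /t; lia.
Qed.

Lemma ts_fstring_lower j k : (j + k < m)%N -> (k <= n)%N -> let t := (j + k)%N%:Z in
  exists y z y', [/\ Lt t y, fstring d e f (cw t) (Wt t) (E j k + qvar *: y) z, Lt (t + 1) y'
    & z = E j.+1 k + qvar *: y'].
Proof.
move=> jkm kn t; have km : (k <= m)%N by lia.
have [|y Ly yE] := @divf_hw_lead k km kn j; first by lia.
have Wh : lspan setT (ts_set E (t - j%:Z)) (hw_vect k).
  by have := hw_vect_span km kn; rewrite (_ : t - j%:Z = k%:Z) // /t; lia.
have := fstring_divf (ts_strip t) (k := j) Wh (hw_vect_e km kn) (fun _ => ltac:(lia)).
rewrite yE => h; move: Ly; rewrite addnC => Ly.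
have [|y' Ly' y'E] := @divf_hw_lead k km kn j.+1; first by lia.
exists y, (dpow v f j.+1 (hw_vect k)), y'; split=> //.
by move: Ly'; rewrite (_ : (k + j.+1)%N%:Z = t + 1) // /t; lia.
Qed.

End Model.

Section Flip.
Variables (e f : {linear T -> T}) (m n : nat) (E : nat -> nat -> T).
Hypothesis hE : tensor_strings e f m n E.
Local Notation cw t := (m%:Z + n%:Z - 2 * t).
Local Notation Wt t := (fun j : int => lspan setT (ts_set E (t - j))).
Local Notation Lt t := (lspan regular0 (ts_set E t)).

Lemma lspan_flip (S : set Qq) s x : S 1 -> (forall a b, S a -> S b -> S (a * b)) ->
  lspan S (ts_set (ts_flip m n E) s) x -> lspan S (ts_set E (m%:Z + n%:Z - s)) x.
Proof.
move=> S1 SM; have hM := lspan_smodule (ts_set E (m%:Z + n%:Z - s)) SM.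
apply: (lspan_ind hM) => _ [j [k [jk ->]]]; rewrite /ts_flip.
case: ifP => [/andP[jn km]|_]; last by case: hM.
by apply: mem_lspan => //; exists (m - k)%N, (n - j)%N; split=> //; lia.
Qed.

(* The upper half of a string of the tensor product is computed from its lowest
   weight vector, that is, in the flipped model. *)
Lemma ts_upper j k : (m <= j + k)%N -> (j <= m)%N -> (k <= n)%N -> let t := (j + k)%N%:Z in
  exists y X M, [/\ Lt t y, lspan setT (ts_set E (t - M%:Z)) X /\ e X = 0,
    E j k + qvar *: y = dpow v f M X, 0 <= cw t + M%:Z
    & [/\ ((m < j + k)%N -> (0 < M)%N /\ Lt (t - 1) (dpow v f M.-1 X))
      & Lt (t + 1) (dpow v f M.+1 X)]].
Proof.
move=> mjk jm kn t; have hE' := ts_flipP hE.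
(* In the flipped array [E j k] has indices n - k and m - j, so it leads e^(n-k) of the lowest
   weight vector w of degree l. The hypothesis m <= j + k is the bound on the exponent that
   [divf_hw_lead] asks for there. *)
pose l := (m - j)%N; have ln : (l <= n)%N by rewrite /l; lia.
have lm : (l <= m)%N by rewrite /l; lia.
pose w := hw_vect n m (ts_flip m n E) l.
have [y Ly yE] : exists2 y, Lt t y & dpow v e (n - k) w = E j k + qvar *: y.
  have [|y Ly ->] := @divf_hw_lead _ _ _ _ _ hE' l ln lm (n - k); first by rewrite /l; lia.
  exists y.
    have := lspan_flip regular0_1 (fun a b => @regular0M a b) Ly.
    by rewrite (_ : _ - _ = t) // /l /t; lia.
  rewrite /ts_flip (leq_subr k n) lm /= /l; congr (E _ _ + _); lia.
have fw : f w = 0 by exact: (hw_vect_e hE' ln lm).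
have Ww : lspan setT (ts_set E (t - - (n - k)%N%:Z)) w.
  have := lspan_flip (S := setT) I (fun _ _ _ _ => I) (@hw_vect_span n m (ts_flip m n E) l ln lm).
  by rewrite (_ : _ - _ = t - - (n - k)%N%:Z) // /l /t; lia.
(* M is the length of the string of w, whose weight is 2l - m - n; X is the top of this string. *)
pose M := (2 * j + n - m)%N; pose X := dpow v e M w.
have [|eX fX] := lowest_to_highest d_gt0 (ts_strip hE t) (M := M) Ww fw.
  by rewrite /M /t; lia.
have WX : lspan setT (ts_set E (t - (M - (n - k))%N%:Z)) X.
  have := strip_divf d_gt0 (strip_swap (ts_strip hE t)) (j := (n - k)%N%:Z) M Ww.
  by rewrite (_ : t - - _ = t - (M - (n - k))%N%:Z) //; rewrite /M; lia.
have fE a : (a <= M)%N -> dpow v e a w = dpow v f (M - a) X.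
  by move=> aM; rewrite fX ?leq_subr // subKn.
have nkM : (n - k <= M)%N by rewrite /M; lia.
exists y, X, (M - (n - k))%N; split=> //.
- by rewrite -yE fE.
- by rewrite /M /t; lia.
- split=> [mjk'|].
    split; first by rewrite /M; lia.
    have [|y' Ly' y'E] := @divf_hw_lead _ _ _ _ _ hE' l ln lm (n - k).+1; first by rewrite /l; lia.
    have -> : (M - (n - k)).-1 = (M - (n - k).+1)%N by lia.
    rewrite -fE; last by rewrite /M; lia.
    rewrite y'E; have E' : m%:Z + n%:Z - (l + (n - k).+1)%N%:Z = t - 1 by rewrite /l /t; lia.
    rewrite -E'; apply: (lspan_flip regular0_1 (fun a b => @regular0M a b)).
    apply: (smoduleD regular0_1 (lspan_lattice _)).
      by apply: (mem_lspan regular0_1); eexists; eexists; split; last reflexivity; rewrite addnC.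
    by apply: (smoduleZ (lspan_lattice _) regular0_q).
  case: (posnP (n - k)) => nk0.
    rewrite nk0 subn0 divpowS // fX // subnn divpow0 fw scaler0.
    by case: (lspan_lattice (ts_set E (t + 1))).
  have [|y' Ly' y'E] := @divf_hw_lead _ _ _ _ _ hE' l ln lm (n - k).-1; first by rewrite /l; lia.
  have -> : (M - (n - k)).+1 = (M - (n - k).-1)%N by lia.
  rewrite -fE; last by lia.
  rewrite y'E; have E' : m%:Z + n%:Z - (l + (n - k).-1)%N%:Z = t + 1 by rewrite /l /t; lia.
  rewrite -E'; apply: (lspan_flip regular0_1 (fun a b => @regular0M a b)).
  apply: (smoduleD regular0_1 (lspan_lattice _)).
    by apply: (mem_lspan regular0_1); eexists; eexists; split; last reflexivity; rewrite addnC.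
  by apply: (smoduleZ (lspan_lattice _) regular0_q).
Qed.

(** At most (m + 1)(n + 1) generators are nonzero, so the sum of their exponents serves all of them.
    This is the starting point of [lattice_descent]. *)
Lemma ts_common_denominator t (R : T -> T -> Prop) (P : set T) :
  R 0 0 -> (forall j k, (j + k)%N%:Z = t -> exists w N, R (E j k) w /\ P (qvar ^+ N *: w)) ->
  smodule regular0 P ->
  exists N, forall x, ts_set E t x -> exists w, R x w /\ P (qvar ^+ N *: w).
Proof.
move=> R0 hR hP.
have /choice[N hN] : forall p : 'I_m.+1 * 'I_n.+1, exists N, (p.1 + p.2)%N%:Z = t ->
    exists w, R (E p.1 p.2) w /\ P (qvar ^+ N *: w).
  move=> p; case: (eqVneq (p.1 + p.2)%N%:Z t) => [pt|/eqP pt]; last by exists 0%N.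
  by have [w [N h]] := hR _ _ pt; exists N => _; exists w.
exists (\sum_p N p)%N => _ [j [k [jk ->]]].
case: (leqP j m) => jm; last first.
  by exists 0; rewrite (ts_out hE) ?jm // scaler0; split=> //; case: hP.
case: (leqP k n) => kn; last first.
  by exists 0; rewrite (ts_out hE) ?kn ?orbT // scaler0; split=> //; case: hP.
pose p : 'I_m.+1 * 'I_n.+1 := (Ordinal (jm : (j < m.+1)%N), Ordinal (kn : (k < n.+1)%N)).
have [w [Rw Pw]] := hN p jk; exists w; split=> //.
rewrite (bigD1 p) //= addnC exprD -scalerA; apply: (smoduleZ hP) Pw.
exact: regular0X regular0_q.
Qed.

Lemma estring00 c W : (forall j, W j 0) -> estring d e f c W 0 0.
Proof.
move=> W0; exists 0%N, (fun=> 0); split; last by rewrite big_ord0.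
split; last by rewrite big_ord0.
by move=> k; split=> //; [exact: linear0 | rewrite eqxx].
Qed.

Lemma fstring00 c W : (forall j, W j 0) -> fstring d e f c W 0 0.
Proof.
move=> W0; exists 0%N, (fun=> 0); split; last by rewrite big_ord0.
split; last by rewrite big_ord0.
by move=> k; split=> //; [exact: linear0 | rewrite eqxx].
Qed.

(** A multiple of q turns each [E j k] into a member of one string, read from the top if j + k <= m
    and from the bottom otherwise. On such a member the operator only changes the exponent, and
    [lattice_descent] passes to the whole lattice. *)
Lemma ts_estring t x : Lt t x ->
  exists w, estring d e f (cw t) (Wt t) x w /\ Lt (t - 1) w.
Proof.
have S := ts_strip hE t; have hL := lspan_lattice (ts_set E (t - 1)).
apply: lattice_descent => //.
- by apply: estring00; exact: (strip0 S).
- by move=> a y z y' z'; exact: (estring_lin S).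
- apply: ts_common_denominator => //; first by apply: estring00; exact: (strip0 S).
  move=> j k jk.
  have W0 : Wt t 0 (E j k) by apply: mem_lspan => //; exists j, k; rewrite subr0.
  have [w hw] := estring_ex d_gt0 S W0; exists w.
  by have [N hN] := lspan_clear (estring_mem d_gt0 S hw); exists N.
- move=> _ [j [k [jk ->]]].
  case: (leqP j m) => jm; last first.
    exists 0, 0; rewrite (ts_out hE) ?jm // scaler0 addr0; split; last by case: hL.
      by case: (lspan_lattice (ts_set E t)).
    by apply: estring00; exact: (strip0 S).
  case: (leqP k n) => kn; last first.
    exists 0, 0; rewrite (ts_out hE) ?kn ?orbT // scaler0 addr0; split; last by case: hL.
      by case: (lspan_lattice (ts_set E t)).
    by apply: estring00; exact: (strip0 S).
  move: S hL; rewrite -jk => S hL; case: (leqP (j + k) m) => jkm.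
    have [y [z [y' [Ly hz Ly' zE]]]] := ts_estring_lower hE jkm kn.
    exists y, z; split=> //; rewrite zE; apply: (smoduleD regular0_1 hL).
      case: j {jm jk jkm zE hz Ly Ly' S} hL => [|j] hL; first by case: hL.
      by apply: (mem_lspan regular0_1); exists j, k; split=> //; lia.
    exact: (smoduleZ hL regular0_q).
  have [y [X [M [Ly [WX eX] yE cM [/(_ jkm) [M0 h] _]]]]] := ts_upper (ltnW jkm) jm kn.
  exists y, (dpow v f M.-1 X); split=> //; rewrite yE.
  have := estring_divf S (k := M) WX eX (fun _ => cM).
  by case: M M0 {h WX yE cM}.
Qed.

Lemma ts_fstring t x : Lt t x ->
  exists w, fstring d e f (cw t) (Wt t) x w /\ Lt (t + 1) w.
Proof.
have S := ts_strip hE t; have hL := lspan_lattice (ts_set E (t + 1)).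
apply: lattice_descent => //.
- by apply: fstring00; exact: (strip0 S).
- by move=> a y z y' z'; exact: (fstring_lin S).
- apply: ts_common_denominator => //; first by apply: fstring00; exact: (strip0 S).
  move=> j k jk.
  have W0 : Wt t 0 (E j k) by apply: mem_lspan => //; exists j, k; rewrite subr0.
  have [w hw] := fstring_ex d_gt0 S W0; exists w.
  have := fstring_mem d_gt0 S hw; rewrite /= opprK => /lspan_clear [N hN].
  by exists N.
- move=> _ [j [k [jk ->]]].
  case: (leqP j m) => jm; last first.
    exists 0, 0; rewrite (ts_out hE) ?jm // scaler0 addr0; split; last by case: hL.
      by case: (lspan_lattice (ts_set E t)).
    by apply: fstring00; exact: (strip0 S).
  case: (leqP k n) => kn; last first.
    exists 0, 0; rewrite (ts_out hE) ?kn ?orbT // scaler0 addr0; split; last by case: hL.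
      by case: (lspan_lattice (ts_set E t)).
    by apply: fstring00; exact: (strip0 S).
  move: S hL; rewrite -jk => S hL; case: (ltnP (j + k) m) => jkm.
    have [y [z [y' [Ly hz Ly' zE]]]] := ts_fstring_lower hE jkm kn.
    exists y, z; split=> //; rewrite zE; apply: (smoduleD regular0_1 hL).
      by apply: (mem_lspan regular0_1); exists j.+1, k; split=> //; lia.
    exact: (smoduleZ hL regular0_q).
  have [y [X [M [Ly [WX eX] yE cM [_ h]]]]] := ts_upper jkm jm kn.
  exists y, (dpow v f M.+1 X); split=> //; rewrite yE.
  exact: (fstring_divf S (k := M) WX eX (fun _ => cM)).
Qed.

(** The perturbation q y in [ts_estring_lower] contributes q times the image of y, and that image
    lies in the lattice by [ts_estring]. *)
Lemma ts_estring_lead j k : (j + k <= m)%N -> (k <= n)%N -> let t := (j + k)%N%:Z in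
  exists2 y, Lt (t - 1) y &
    estring d e f (cw t) (Wt t) (E j k) ((if j is j'.+1 then E j' k else 0) + qvar *: y).
Proof.
move=> jkm kn t; have S := ts_strip hE t.
have [y [z [y' [Ly hz Ly' zE]]]] := ts_estring_lower hE jkm kn.
have [w [hw Lw]] := ts_estring Ly.
exists (y' - w).
  by rewrite -scaleN1r; apply: (smoduleD regular0_1 (lspan_lattice _)) => //;
    apply: (smoduleZ (lspan_lattice _)) => //; apply: regular0N; exact: regular0_1.
have := estring_lin S (- qvar) hw hz; rewrite zE !scaleNr [X in estring _ _ _ _ _ X]addrC addrK.
have -> // : (if j is j'.+1 then E j' k else 0) + qvar *: (y' - w) = - (qvar *: w) + ((if j is j'.+1 then E j' k else 0) + qvar *: y').
by rewrite scalerBr [RHS]addrC -addrA.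
Qed.

Lemma ts_fstring_lead j k : (j + k < m)%N -> (k <= n)%N -> let t := (j + k)%N%:Z in
  exists2 y, Lt (t + 1) y &
    fstring d e f (cw t) (Wt t) (E j k) (E j.+1 k + qvar *: y).
Proof.
move=> jkm kn t; have S := ts_strip hE t.
have [y [z [y' [Ly hz Ly' zE]]]] := ts_fstring_lower hE jkm kn.
have [w [hw Lw]] := ts_fstring Ly.
exists (y' - w).
  by rewrite -scaleN1r; apply: (smoduleD regular0_1 (lspan_lattice _)) => //;
    apply: (smoduleZ (lspan_lattice _)) => //; apply: regular0N; exact: regular0_1.
have := fstring_lin S (- qvar) hw hz; rewrite zE !scaleNr [X in fstring _ _ _ _ _ X]addrC addrK.
have -> // : E j.+1 k + qvar *: (y' - w) = - (qvar *: w) + (E j.+1 k + qvar *: y').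
by rewrite scalerBr [RHS]addrC -addrA.
Qed.

End Flip.

End TensorStrings.

(** * Kashiwara operators on integrable modules *)

Lemma qdZE d a : (qvar ^+ d) ^ a = qvar ^ (d%:Z * a).
Proof. by rewrite exprnP exprz_exp. Qed.

Lemma fiber_sum0 (A : eqType) (B : Type) (V : zmodType) (s : seq B) (c : B -> A) (F : B -> V) :
  (forall a, \sum_(p <- s | c p == a) F p = 0) -> \sum_(p <- s) F p = 0.
Proof.
have [n] := ubnP (size s); elim: n s => // n IH [|p s] sn h; first by rewrite big_nil.
rewrite (bigID (fun p' => c p' == c p)) /= h add0r -big_filter /= eqxx; apply: IH => [|a].
  by rewrite size_filter; rewrite ltnS in sn; exact: (leq_ltn_trans (count_size _ _) sn).
case: (eqVneq a (c p)) => [->|ap].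
  rewrite big_filter_cond big_pred0 // => p'; by case: eqP.
have ha : \sum_(p' <- s | c p' == a) F p' = 0.
  by have := h a; rewrite big_cons eq_sym (negbTE ap).
rewrite big_filter_cond -[RHS]ha; apply: eq_bigl => p'.
by case: (c p' =P a) => [->|]; rewrite ?ap ?andbF.
Qed.

(** If g separates a from the index b of the first summand, then g - r b removes that summand and
    multiplies u by the nonzero scalar r a - r b. The operator depends on the pair, as a single q^h
    need not separate all weights. *)
Lemma eigen_sum0 (V : lmodType Qq) (A : eqType) (wt : A -> set V) :
  (forall a x c, wt a x -> wt a (c *: x)) ->
  (forall a b, a <> b -> exists (g : {linear V -> V}) (r : A -> Qq),
     (forall c x, wt c x -> g x = r c *: x) /\ r a != r b) ->
  forall (s : seq (A * V)) a u, wt a u -> (forall p, (p \in s) -> wt p.1 p.2 /\ a <> p.1) ->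
    u = \sum_(p <- s) p.2 -> u = 0.
Proof.
move=> wtZ sep s; have [n] := ubnP (size s).
elim: n s => // n IH [|[b x] s] sn a u au hs; first by rewrite big_nil.
have sn' : (size s < n)%N by [].
rewrite big_cons /= => uE; have [bx ab] := hs _ (mem_head _ _).
have [g [r [gE rab]]] := sep _ _ ab.
have hs' p : (p \in s) -> wt p.1 p.2 /\ a <> p.1 by move=> ps; apply: hs; rewrite inE ps orbT.
have E2 : (r a - r b) *: u = \sum_(p <- [seq (p.1, (r p.1 - r b) *: p.2) | p <- s]) p.2.
  rewrite big_map /= scalerBl -(gE _ _ au) {1}uE linearD (gE _ _ bx) /=.
  rewrite linear_sum uE scalerDr opprD addrACA subrr add0r scaler_sumr -sumrB.
  have key (F G : A * V -> V) : (forall p, (p \in s) -> F p = G p) ->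
      \sum_(p <- s) F p = \sum_(p <- s) G p.
    elim: (s) => [|p s' IHs] FG; first by rewrite !big_nil.
    by rewrite !big_cons FG ?mem_head // IHs // => p' h; apply: FG; rewrite inE h orbT.
  by apply: key => p ps; have [wp _] := hs' p ps; rewrite (gE _ _ wp) scalerBl.
have /eqP : (r a - r b) *: u = 0.
  apply: (IH _ _ a _ _ _ E2); first by rewrite size_map.
    exact: wtZ.
  move=> p' /mapP [p ps ->]; have [wp ap] := hs' p ps.
  by split=> //; exact: wtZ.
by rewrite scaler_eq0 subr_eq0 (negbTE rab) => /eqP.
Qed.

Section Pairing.
Variable n : nat.

Lemma pairingD (h : 'cV[int]_n) x y : pairing h (x + y) = pairing h x + pairing h y.
Proof. by rewrite /pairing mulmxDl mxE. Qed.

Lemma pairingZ (h : 'cV[int]_n) j x : pairing h (j *: x) = j * pairing h x.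
Proof. by rewrite /pairing -scalemxAl mxE. Qed.

Lemma pairing_mulrn (h : 'cV[int]_n) k x : pairing (h *+ k) x = k%:Z * pairing h x.
Proof. by rewrite /pairing -scaler_nat -scalemxAr mxE natz. Qed.

Lemma pairingN (h : 'cV[int]_n) x : pairing (- h) x = - pairing h x.
Proof. by rewrite /pairing mulmxN mxE. Qed.

Lemma pairing_separates (x y : 'rV[int]_n) : x <> y -> exists h, pairing h x <> pairing h y.
Proof.
move=> xy; apply/not_existsP => h; apply: xy; apply/rowP => i.
have E (z : 'rV[int]_n) : pairing (delta_mx i 0) z = z 0 i by rewrite /pairing -colE mxE.
by have /contrapT := h (delta_mx i 0); rewrite !E.
Qed.

End Pairing.

Section IntegrableModule.
Variables (I : finType) (D : root_datum I) (M : Uq_module D).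

Local Notation h i := (rd_coroot D i).
Local Notation al i := (rd_root D i).

Lemma wtspace_smodule xi : smodule setT (@wtspace I D M xi).
Proof.
split=> [k|a x y _ hx hy k]; first by rewrite linear0 scaler0.
by rewrite linearP hx hy scalerDr !scalerA mulrC.
Qed.

Lemma wtspace_e i xi x : @wtspace I D M xi x -> wtspace (xi + al i) (um_e M i x).
Proof.
by move=> hx k; rewrite um_ke hx linearZ scalerA pairingD expfzDr ?qvar_neq0 // mulrC.
Qed.

Lemma wtspace_f i xi x : @wtspace I D M xi x -> wtspace (xi - al i) (um_f M i x).
Proof.
move=> hx k; rewrite um_kf hx linearZ scalerA -[- al i]scaleN1r pairingD pairingZ mulN1r.
by rewrite expfzDr ?qvar_neq0 // mulrC.
Qed.

Lemma wtspace_ef i j xi x : @wtspace I D M xi x ->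
  um_e M i (um_f M j x) - um_f M j (um_e M i x)
  = if i == j then qbr (qvar ^+ rd_d D i) (pairing (h i) xi) *: x else 0.
Proof.
move=> hx; rewrite um_ef; case: eqP => // _; rewrite !hx -scalerBl scalerA mulrC.
by rewrite pairingN pairing_mulrn /qbr /qi exprnP !exprz_exp mulrN.
Qed.

Lemma wtspace_sum0 xi u (s : seq (weight D * M)) : @wtspace I D M xi u ->
  (forall p, p \in s -> wtspace p.1 p.2 /\ xi <> p.1) -> u = \sum_(p <- s) p.2 -> u = 0.
Proof.
apply: eigen_sum0 => [a x c hx|a b /pairing_separates [k ab]].
  by apply: (smoduleZ (wtspace_smodule a)).
exists (um_k M k), (fun c => qvar ^ pairing k c); split; first by move=> c x; apply.
by apply/eqP => /qvarZ_inj.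
Qed.

Hypothesis hM : integrable M.

Lemma module_strip i xi : sl2_strip (rd_d D i) (um_e M i) (um_f M i) (pairing (h i) xi)
  (fun j => wtspace (xi + j *: al i)).
Proof.
have [_ [he hf]] := hM; split=> [j|j a x y|j x|j x|j x|j x _|j x _] //.
- by case: (wtspace_smodule (xi + j *: al i)).
- exact: (proj2 (wtspace_smodule _)).
- by move=> /wtspace_e; rewrite scalerDl scale1r addrA; apply.
- by move=> /wtspace_f; rewrite scalerBl scale1r addrA; apply.
- by move=> /wtspace_ef ->; rewrite eqxx pairingD pairingZ rd_diag mulrC.
Qed.

(** Eigenspaces of t_i alone: the terms of a string decomposition may differ in weight, and their
    strings see only the pairing with h_i. *)
Definition coroot_wt i (c : int) : set M :=
  [set x | um_k M (h i *+ rd_d D i) x = (qvar ^+ rd_d D i) ^ c *: x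
    /\ um_k M (- (h i *+ rd_d D i)) x = (qvar ^+ rd_d D i) ^ (- c) *: x].

Lemma wtspace_coroot_wt i xi x : @wtspace I D M xi x -> coroot_wt i (pairing (h i) xi) x.
Proof.
by move=> hx; split; rewrite hx ?pairingN pairing_mulrn exprnP exprz_exp ?mulrN.
Qed.

Lemma coroot_strip i c : sl2_strip (rd_d D i) (um_e M i) (um_f M i) c
  (fun j => coroot_wt i (c + 2 * j)).
Proof.
have [_ [he hf]] := hM; split=> [j|j a x y [x1 x2] [y1 y2]|j x [x1 x2]|j x [x1 x2]|j x [x1 x2]|j x _|j x _] //.
- by split; rewrite linear0 scaler0.
- by split; rewrite linearP ?x1 ?x2 ?y1 ?y2 scalerDr !scalerA mulrC.
- split; rewrite um_ke ?x1 ?x2 linearZ scalerA ?pairingN pairing_mulrn rd_diag.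
    by rewrite !qdZE -expfzDr ?qvar_neq0 //; congr (qvar ^ _ *: _); ring.
  by rewrite !qdZE -expfzDr ?qvar_neq0 //; congr (qvar ^ _ *: _); ring.
- split; rewrite um_kf ?x1 ?x2 linearZ scalerA ?pairingN pairing_mulrn rd_diag.
    by rewrite !qdZE -expfzDr ?qvar_neq0 //; congr (qvar ^ _ *: _); ring.
  by rewrite !qdZE -expfzDr ?qvar_neq0 //; congr (qvar ^ _ *: _); ring.
- by rewrite um_ef eqxx x1 x2 -scalerBl scalerA mulrC.
Qed.

Lemma hstring_decomposition i xi u N X :
  hstring (rd_d D i) (um_e M i) (um_f M i) (pairing (h i) xi)
    (fun j => wtspace (xi + j *: al i)) u N X ->
  exists s, [/\ string_decomposition i u s,
     \sum_(p <- s | (0 < p.1)%N) fdiv i p.1.-1 p.2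
       = \sum_(k < N) dpow (qvar ^+ rd_d D i) (um_f M i) k (X k.+1)
   & \sum_(p <- s) fdiv i p.1.+1 p.2
       = \sum_(k < N) dpow (qvar ^+ rd_d D i) (um_f M i) k.+1 (X k)].
Proof.
(* Zero terms are dropped: the bound k <= <h_i, wt> required by [string_decomposition] is known only
   for nonzero X k. *)
move=> [hX uE]; exists [seq (k, X k) | k <- iota 0 N & X k != 0].
have key (P : pred nat) (F : nat -> M -> M) : (forall k, F k 0 = 0) ->
    \sum_(p <- [seq (k, X k) | k <- iota 0 N & X k != 0] | P p.1) F p.1 p.2
    = \sum_(k < N | P k) F k (X k).
  move=> F0; rewrite big_map big_filter_cond -(big_mkord P (fun k => F k (X k))) /index_iota subn0 /=.
  rewrite big_mkcond [RHS]big_mkcond /=; apply: eq_bigr => k _.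
  by case: (eqVneq (X k) 0) => //= ->; rewrite F0 if_same.
have uE' : u = \sum_(p <- [seq (k, X k) | k <- iota 0 N & X k != 0]) fdiv i p.1 p.2.
  rewrite uE (key predT (fun k => fdiv i k)) => [|k]; first by apply: eq_bigr => k _; rewrite dpowE.
  by rewrite /fdiv -dpowE divpow_at0.
split.
- split=> // p /mapP [k]; rewrite mem_filter => /andP[Xk _ ->] /=.
  have [h1 h2 /(_ Xk) [h3 _]] := hX k; split=> //; exists (xi + k%:Z *: al i); split=> //.
  by rewrite pairingD pairingZ rd_diag; lia.
- rewrite (key (fun k => (0 < k)%N) (fun k => fdiv i k.-1)) => [|k]; last first.
    by rewrite /fdiv -dpowE divpow_at0.
  case: N hX {key uE uE'} => [|N] hX; first by rewrite !big_ord0.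
  rewrite big_mkcond big_ord_recl /= add0r [RHS]big_ord_recr /=.
  have -> : X N.+1 = 0.
    by have [_ _ h] := hX N.+1; apply/eqP/negPn/negP => /h [_]; rewrite ltnn.
  by rewrite divpow_at0 addr0; apply: eq_bigr => k _; rewrite dpowE.
- rewrite (key predT (fun k => fdiv i k.+1)) => [|k]; first by apply: eq_bigr => k _; rewrite dpowE.
  by rewrite /fdiv -dpowE divpow_at0.
Qed.

(** Sort the terms f_i^(n) x by their h_i-weight c and by n. Vectors of different c are independent,
    and within one c the sums over each n form an [hstring] of 0, to which [hstring0] applies. *)
Lemma string_decomposition_fibers i (s : seq (nat * M)) : string_decomposition i 0 s ->
  exists c : nat * M -> int, forall a k,
    \sum_(p <- s | (c p, p.1) == (a, k)) p.2 = 0.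
Proof.
move=> [hs s0].
have /choice[c hc] : forall p : nat * M, exists c : int, p \in s ->
    coroot_wt i (c + 2 * p.1%:Z) p.2 /\ 0 <= c + p.1%:Z.
  move=> p; case: (boolP (p \in s)) => [ps|]; last by exists 0.
  have [_ [xi [hxi le]]] := hs p ps.
  (* This is the h_i-weight of f_i^(n) x; with it, n <= <h_i, xi> reads 0 <= c + n. *)
  exists (pairing (h i) xi - 2 * p.1%:Z) => _; rewrite subrK; split; last first.
    by rewrite (_ : _ - _ + _ = pairing (h i) xi - p.1%:Z) ?subr_ge0 //; ring.
  exact: wtspace_coroot_wt.
exists c => a k.
have Ia : \sum_(p <- s | c p == a) fdiv i p.1 p.2 = 0 :> M.
  have cw p : p \in s -> coroot_wt i (c p) (fdiv i p.1 p.2).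
    move=> ps; have [w _] := hc p ps; have [ep _] := hs p ps.
    have := strip_divf (rd_d_gt0 D i) (coroot_strip i (c p)) (j := p.1%:Z) p.1 w.
    by rewrite subrr mulr0 addr0 dpowE.
  pose s2 := [seq (c p, - fdiv i p.1 p.2) | p <- s & c p != a].
  have wZ b x r : coroot_wt i b x -> coroot_wt i b (r *: x).
    by move=> hx; have := stripZ (coroot_strip i b) (j := 0) r; rewrite mulr0 addr0; apply.
  have wD b x y : coroot_wt i b x -> coroot_wt i b y -> coroot_wt i b (x + y).
    move=> hx hy; have := stripD (coroot_strip i b) (j := 0) (x := x) (y := y).
    by rewrite mulr0 addr0; apply.
  apply: (@eigen_sum0 M int (coroot_wt i) _ _ s2 a).
  - by move=> b x r; exact: wZ.
  - move=> b b' bb'; exists (um_k M (h i *+ rd_d D i)), (fun c => (qvar ^+ rd_d D i) ^ c).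
    by split=> [b1 x [] //|]; apply/eqP => /(qdZ_inj (rd_d_gt0 D i)).
  - rewrite big_seq_cond; apply: big_ind.
    + by have := strip0 (coroot_strip i a) 0; rewrite mulr0 addr0.
    + by move=> x y; exact: wD.
    + by move=> p /andP[ps /eqP <-]; exact: cw.
  - move=> p' /mapP [p]; rewrite mem_filter => /andP[cp ps] ->.
    split; last by apply/eqP; rewrite eq_sym.
    by rewrite /= -scaleN1r; apply: wZ; exact: cw.
  - rewrite big_map big_filter /= sumrN; apply/eqP; rewrite -addr_eq0.
    by rewrite [X in _ == X]s0 [X in _ == X](bigID (fun p => c p == a)).
pose X k := \sum_(p <- s | (c p == a) && (p.1 == k)) p.2.
suff hX : hstring (rd_d D i) (um_e M i) (um_f M i) a (fun j => coroot_wt i (a + 2 * j)) 0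
    (\max_(p <- s) p.1).+1 X.
  exact: (hstring0 (rd_d_gt0 D i) (coroot_strip i a) hX k).
split=> [t|].
  have in_fiber (P : set M) : P 0 -> (forall x y, P x -> P y -> P (x + y)) ->
      (forall p, p \in s -> c p = a -> p.1 = t -> P p.2) -> P (X t).
    move=> P0 PD Pp; rewrite /X big_seq_cond; apply: big_ind => // p.
    by move=> /andP[ps /andP[/eqP cp /eqP pt]]; exact: Pp.
  split.
  - apply: in_fiber; first exact: (strip0 (coroot_strip i a)).
      by move=> x y; exact: (stripD (coroot_strip i a)).
    by move=> p ps cp pt; have [w _] := hc p ps; rewrite -cp -pt.
  - apply: (in_fiber (fun x => um_e M i x = 0)); first exact: linear0.
      by move=> x y hx hy; rewrite linearD hx hy addr0.
    by move=> p ps _ _; have [] := hs p ps.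
  - case: (boolP (has (fun p => (c p == a) && (p.1 == t)) s)) => [/hasP[p ps /andP[/eqP cp /eqP pt]] _|h].
      have [_] := hc p ps; rewrite cp pt => ->; split=> //.
      by rewrite ltnS -pt (leq_bigmax_seq p).
    have -> : X t = 0 by rewrite /X big_hasC.
    by rewrite eqxx.
rewrite -[LHS]Ia; under [RHS]eq_bigr => t _ do rewrite /X (big_morph _ (divpowD (rd_d D i) (um_f M i) t) (divpow_at0 (rd_d D i) (um_f M i) t)).
rewrite (exchange_big_dep (fun p => c p == a)) /= => [|t p _ /andP[] //].
rewrite big_seq_cond [RHS]big_seq_cond; apply: eq_bigr => p /andP[ps cp].
have lt : (p.1 < (\max_(p <- s) p.1).+1)%N by rewrite ltnS (leq_bigmax_seq p).
by rewrite (big_pred1 (Ordinal lt)) ?dpowE // => t; rewrite cp /= eq_sym.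
Qed.

Lemma string_decomposition_sub i (u : M) s s' : string_decomposition i u s ->
  string_decomposition i u s' -> exists t, string_decomposition i 0 t /\
  forall (P : pred nat) (F : nat -> M -> M), (forall k x y, F k (x + y) = F k x + F k y) ->
    \sum_(p <- t | P p.1) F p.1 p.2
    = \sum_(p <- s | P p.1) F p.1 p.2 - \sum_(p <- s' | P p.1) F p.1 p.2.
Proof.
move=> [hs uE] [hs' uE'].
have key (P : pred nat) (F : nat -> M -> M) : (forall k x y, F k (x + y) = F k x + F k y) ->
    \sum_(p <- s ++ [seq (p.1, - p.2) | p <- s'] | P p.1) F p.1 p.2
    = \sum_(p <- s | P p.1) F p.1 p.2 - \sum_(p <- s' | P p.1) F p.1 p.2.
  move=> FD; rewrite big_cat big_map /= -sumrN; congr (_ + _); apply: eq_bigr => p _.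
  have F0 : F p.1 0 = 0 by apply: (addrI (F p.1 0)); rewrite -FD !addr0.
  by apply: (addrI (F p.1 p.2)); rewrite -FD !subrr.
exists (s ++ [seq (p.1, - p.2) | p <- s']); split=> //; split.
  move=> p; rewrite mem_cat => /orP[/hs //|/mapP[p' /hs' [h1 [xi [h2 h3]]] ->]] /=.
  split; first by rewrite linearN h1 oppr0.
  exists xi; split=> //; rewrite -scaleN1r; exact: (smoduleZ (wtspace_smodule xi)).
rewrite (key predT (fun k => fdiv i k)) -?uE -?uE' ?subrr // => k x y.
by rewrite /fdiv -!dpowE divpowD.
Qed.

(** The difference of two decompositions decomposes 0, and its fibres sum to 0 before F is applied.
    Suitable P and F give both etilde_i and ftilde_i. *)
Lemma string_decomposition_uniq i (u : M) s s' (P : pred nat) (F : nat -> M -> M) :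
  (forall k x y, F k (x + y) = F k x + F k y) ->
  string_decomposition i u s -> string_decomposition i u s' ->
  \sum_(p <- s | P p.1) F p.1 p.2 = \sum_(p <- s' | P p.1) F p.1 p.2.
Proof.
move=> FD hs hs'; have [t [ht tE]] := string_decomposition_sub hs hs'.
apply/eqP; rewrite -subr_eq0 -tE //; apply/eqP.
have [c hc] := string_decomposition_fibers ht.
rewrite big_mkcond /=; apply: (fiber_sum0 (c := fun p => (c p, p.1))) => -[a k].
have F0 : F k 0 = 0 by apply: (addrI (F k 0)); rewrite -FD !addr0.
rewrite -big_mkcondr /= (eq_bigl (fun p => ((c p, p.1) == (a, k)) && P k)); last first.
  by move=> p /=; rewrite xpair_eqE; case: (p.1 =P k) => [->|]; rewrite ?andbF.
case: (P k); last by rewrite big_pred0 // => p; rewrite andbF.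
rewrite (eq_bigl (fun p => (c p, p.1) == (a, k))) => [|p]; last by rewrite andbT.
rewrite (eq_bigr (fun p => F k p.2)) => [|p]; last by rewrite xpair_eqE => /andP[_ /eqP ->].
by rewrite -(big_morph _ (FD k) F0) hc.
Qed.

Lemma fdivD i k x y : @fdiv I D M i k (x + y) = fdiv i k x + fdiv i k y.
Proof. by rewrite /fdiv -!dpowE divpowD. Qed.

Lemma etilde_decomposition i (u : M) s : string_decomposition i u s ->
  etilde i u = \sum_(p <- s | (0 < p.1)%N) fdiv i p.1.-1 p.2 :> M.
Proof.
move=> hs; rewrite /etilde; apply: xget_subset1; first by exists s.
move=> w w' [t [ht ->]] [t' [ht' ->]].
by apply: (string_decomposition_uniq (i := i) (u := u) (fun k => (0 < k)%N) (F := fun k => fdiv i k.-1)) => // k; exact: fdivD.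
Qed.

Lemma ftilde_decomposition i (u : M) s : string_decomposition i u s ->
  ftilde i u = \sum_(p <- s) fdiv i p.1.+1 p.2 :> M.
Proof.
move=> hs; rewrite /ftilde; apply: xget_subset1; first by exists s.
move=> w w' [t [ht ->]] [t' [ht' ->]].
by apply: (string_decomposition_uniq (i := i) (u := u) predT (F := fun k => fdiv i k.+1)) => // k; exact: fdivD.
Qed.

Lemma string_decomposition_cat i (u u' : M) s s' : string_decomposition i u s ->
  string_decomposition i u' s' -> @string_decomposition I D M i (u + u') (s ++ s').
Proof.
move=> [hs ->] [hs' ->]; split; last by rewrite big_cat.
by move=> p; rewrite mem_cat => /orP[/hs|/hs'].
Qed.

Lemma string_decompositionZ i a (u : M) s : string_decomposition i u s ->
  @string_decomposition I D M i (a *: u) [seq (p.1, a *: p.2) | p <- s].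
Proof.
move=> [hs ->]; split=> [_ /mapP[p ps ->]|] /=.
  have [h1 [xi [h2 h3]]] := hs p ps; split; first by rewrite linearZ /= h1 scaler0.
  by exists xi; split=> //; exact: (smoduleZ (wtspace_smodule xi)).
by rewrite big_map scaler_sumr; apply: eq_bigr => p _; rewrite /fdiv -!dpowE divpowZ.
Qed.

Lemma string_decomposition_ex i (u : M) : exists s, string_decomposition i u s.
Proof.
have [hw _] := hM; have [s [hs ->]] := hw u; elim: s hs => [|x s IH] hs.
  by exists [::]; split=> //; rewrite !big_nil.
have [|t ht] := IH; first by move=> y ys; apply: hs; rewrite inE ys orbT.
have [xi hx] := hs x (mem_head _ _).
have hx0 : wtspace (xi + 0 *: al i) x by rewrite scale0r addr0.
have [N [X hX]] := hstring_ex (rd_d_gt0 D i) (module_strip i xi) hx0.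
have [t' [ht' _ _]] := hstring_decomposition hX.
by exists (t' ++ t); rewrite big_cons; exact: string_decomposition_cat.
Qed.

Lemma etilde_linear i a (u u' : M) : etilde i (a *: u + u') = a *: etilde i u + etilde i u'.
Proof.
have [s hs] := string_decomposition_ex i u; have [s' hs'] := string_decomposition_ex i u'.
rewrite (etilde_decomposition hs) (etilde_decomposition hs').
rewrite (etilde_decomposition (string_decomposition_cat (string_decompositionZ a hs) hs')).
rewrite big_cat big_map scaler_sumr /=; congr (_ + _).
by apply: eq_bigr => p _; rewrite /fdiv -!dpowE divpowZ.
Qed.

Lemma ftilde_linear i a (u u' : M) : ftilde i (a *: u + u') = a *: ftilde i u + ftilde i u'.
Proof.
have [s hs] := string_decomposition_ex i u; have [s' hs'] := string_decomposition_ex i u'.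
rewrite (ftilde_decomposition hs) (ftilde_decomposition hs').
rewrite (ftilde_decomposition (string_decomposition_cat (string_decompositionZ a hs) hs')).
rewrite big_cat big_map scaler_sumr /=; congr (_ + _).
by apply: eq_bigr => p _; rewrite /fdiv -!dpowE divpowZ.
Qed.

Lemma ftilde_range i (u : M) : exists y, ftilde i u = um_f M i y.
Proof.
have [s hs] := string_decomposition_ex i u.
exists (\sum_(p <- s) (qbr (qvar ^+ rd_d D i) p.1.+1%:Z)^-1 *: fdiv i p.1 p.2).
rewrite (ftilde_decomposition hs) linear_sum; apply: eq_bigr => p _.
by rewrite linearZ /= /fdiv -!dpowE divpowS ?rd_d_gt0.
Qed.

Local Notation Ws i xi := (fun j : int => @wtspace I D M (xi + j *: al i)).

Lemma estring_etilde i xi u w :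
  estring (rd_d D i) (um_e M i) (um_f M i) (pairing (h i) xi) (Ws i xi) u w -> etilde i u = w.
Proof.
move=> [N [X [hX ->]]]; have [s [hs hE _]] := hstring_decomposition hX.
by rewrite (etilde_decomposition hs).
Qed.

Lemma fstring_ftilde i xi u w :
  fstring (rd_d D i) (um_e M i) (um_f M i) (pairing (h i) xi) (Ws i xi) u w -> ftilde i u = w.
Proof.
move=> [N [X [hX ->]]]; have [s [hs _ hE]] := hstring_decomposition hX.
by rewrite (ftilde_decomposition hs).
Qed.

Lemma etilde_estring i xi u : @wtspace I D M xi u ->
  estring (rd_d D i) (um_e M i) (um_f M i) (pairing (h i) xi) (Ws i xi) u (etilde i u).
Proof.
move=> hu; have hu0 : Ws i xi 0 u by rewrite scale0r addr0.
have [w hw] := estring_ex (rd_d_gt0 D i) (module_strip i xi) hu0.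
by rewrite (estring_etilde hw).
Qed.

Lemma ftilde_fstring i xi u : @wtspace I D M xi u ->
  fstring (rd_d D i) (um_e M i) (um_f M i) (pairing (h i) xi) (Ws i xi) u (ftilde i u).
Proof.
move=> hu; have hu0 : Ws i xi 0 u by rewrite scale0r addr0.
have [w hw] := fstring_ex (rd_d_gt0 D i) (module_strip i xi) hu0.
by rewrite (fstring_ftilde hw).
Qed.

Lemma wtspace_etilde i xi u : @wtspace I D M xi u -> wtspace (xi + al i) (etilde i u).
Proof.
move=> /(etilde_estring i) /(estring_mem (rd_d_gt0 D i) (module_strip i xi)).
by rewrite scale1r.
Qed.

Lemma wtspace_ftilde i xi u : @wtspace I D M xi u -> wtspace (xi - al i) (ftilde i u).
Proof.
move=> /(ftilde_fstring i) /(fstring_mem (rd_d_gt0 D i) (module_strip i xi)).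
by rewrite scaleN1r.
Qed.

End IntegrableModule.

(** * The crystal lattice of V(lam) *)

Lemma big_fibers (A : eqType) (B : Type) (V : nmodType) (s : seq B) (c : B -> A) (F : B -> V) :
  \sum_(p <- s) F p = \sum_(a <- undup (map c s)) \sum_(p <- s | c p == a) F p.
Proof.
rewrite (exchange_big_dep xpredT) //=.
have [t ts] : exists t, t = undup (map c s) by eexists.
rewrite -ts; have sub p : List.In p s -> c p \in t.
  rewrite ts mem_undup; elim: (s) => //= p' s' IH [->|/IH h]; first exact: mem_head.
  by rewrite inE h orbT.
have ut : uniq t by rewrite ts undup_uniq.
elim: (s) sub => [|p s' IH] sub; first by rewrite !big_nil.
rewrite !big_cons -IH => [|p' h]; last by apply: sub; right.
congr (_ + _); have := sub p (or_introl erefl); move: ut; clear.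
elim: t => //= a t IH /andP[at' ut]; rewrite inE big_cons; case: (c p =P a) => [-> _|_ /= pt].
  by rewrite big1_seq ?addr0 // => b /andP[/eqP <-]; rewrite (negbTE at').
exact: IH.
Qed.

Section RootSums.
Variables (I : finType) (D : root_datum I).

Definition rootsum (w : seq I) : weight D := \sum_(j <- w) rd_root D j.

Lemma rootsum_cons j w : rootsum (j :: w) = rd_root D j + rootsum w.
Proof. by rewrite /rootsum big_cons. Qed.

Lemma rootsum_count w : rootsum w = \sum_i (count_mem i w)%:Z *: rd_root D i.
Proof.
elim: w => [|j w IH].
  by rewrite /rootsum big_nil big1 // => i _; rewrite scale0r.
rewrite rootsum_cons IH (bigD1 j) //= [RHS](bigD1 j) //= eqxx PoszD scalerDl scale1r addrA.
by congr (_ + _); apply: eq_bigr => i; rewrite eq_sym => /negbTE ->.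
Qed.

Lemma rootsum_eq0 w : rootsum w = 0 -> w = [::].
Proof.
rewrite rootsum_count => /rd_root_free; case: w => // j w /(_ j) /=.
by rewrite eqxx.
Qed.

End RootSums.

Section HighestWeightCrystal.
Variables (I : finType) (D : root_datum I) (lam : weight D) (V : hw_crystal lam).

Local Notation v := (hw_vector V).
Local Notation L := (@hwL I D lam V).
Local Notation B := (@hwB I D lam V).

Let cb : is_crystal_base L B := hw_crystal_base V.
Let hM : integrable V := cb_integrable cb.

Lemma hwL_lattice : smodule regular0 L.
Proof. exact: lspan_lattice. Qed.

Lemma qlat_smodule (M : lmodType Qq) (P : set M) : smodule regular0 P ->
  smodule regular0 (qlat P).
Proof.
move=> [P0 PL]; split; first by exists 0; rewrite ?scaler0.
move=> a _ _ ra [x Px ->] [y Py ->]; exists (a *: x + y); first exact: PL.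
by rewrite scalerDr !scalerA mulrC.
Qed.

Lemma qlat_sub (M : lmodType Qq) (P : set M) : smodule regular0 P -> qlat P `<=` P.
Proof. by move=> hP _ [x Px ->]; exact: (smoduleZ hP regular0_q). Qed.

Lemma hwqL : smodule regular0 (qlat L).
Proof. exact: qlat_smodule hwL_lattice. Qed.

Lemma qlat_map (M M' : lmodType Qq) (P : set M) (P' : set M') (g : M -> M') :
  (forall a x y, g (a *: x + y) = a *: g x + g y) ->
  (forall x, P x -> P' (g x)) -> forall x, qlat P x -> qlat P' (g x).
Proof.
move=> gL gP _ [x Px ->]; exists (g x); first exact: gP.
have g0 : g 0 = 0 by have := gL (-1) 0 0; rewrite scaler0 addr0 scaleN1r addNr.
by rewrite -[qvar *: x]addr0 gL g0 addr0.
Qed.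

Lemma etilde_hwL i u : L u -> L (etilde i u). Proof. exact: cb_lattice_e cb i u. Qed.
Lemma ftilde_hwL i u : L u -> L (ftilde i u). Proof. exact: cb_lattice_f cb i u. Qed.

Lemma etilde_hwqL i u : qlat L u -> qlat L (etilde i u).
Proof. by apply: qlat_map => [a x y|x]; [exact: etilde_linear | exact: etilde_hwL]. Qed.

Lemma ftilde_hwqL i u : qlat L u -> qlat L (ftilde i u).
Proof. by apply: qlat_map => [a x y|x]; [exact: ftilde_linear | exact: ftilde_hwL]. Qed.

Lemma etildeB i (x y : V) : etilde i (x - y) = etilde i x - etilde i y.
Proof. by rewrite addrC -scaleN1r etilde_linear // scaleN1r addrC. Qed.

Lemma etilde0 i : etilde i (0 : V) = 0.
Proof. by have := etildeB i 0 0; rewrite !subrr. Qed.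

Lemma ftildeB i (x y : V) : ftilde i (x - y) = ftilde i x - ftilde i y.
Proof. by rewrite addrC -scaleN1r ftilde_linear // scaleN1r addrC. Qed.

Lemma qlatD x y : qlat L x -> qlat L y -> qlat L (x + y).
Proof. exact: (smoduleD regular0_1 hwqL). Qed.

Lemma qlatN x : qlat L x -> qlat L (- x).
Proof.
move=> hx; rewrite -scaleN1r; apply: (smoduleZ hwqL) => //; apply: regular0N.
exact: regular0_1.
Qed.

Lemma lat_coset_eq x y : (lat_coset L x = lat_coset L y) <-> qlat L (x - y).
Proof.
split=> [h|h].
  have : lat_coset L x x by rewrite /lat_coset /= subrr; case: hwqL.
  by rewrite h.
apply/seteqP; split=> z; rewrite /lat_coset /= => hz.
  have -> : z - y = (z - x) + (x - y) by rewrite addrA subrK.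
  exact: qlatD.
have -> : z - x = (z - y) + - (x - y) by rewrite opprB addrA subrK.
by apply: qlatD => //; exact: qlatN.
Qed.

Lemma lat_coset_eq0 x : (lat_coset L x = qlat L) <-> qlat L x.
Proof.
have E : qlat L = lat_coset L 0 by apply/seteqP; split=> z; rewrite /lat_coset /= subr0.
split=> h; last by rewrite E; apply/lat_coset_eq; rewrite subr0.
by have := (lat_coset_eq x 0).1; rewrite subr0; apply; rewrite h.
Qed.

Lemma lat_map_coset (g : V -> V) x : (forall x y, g (x - y) = g x - g y) ->
  (forall u, qlat L u -> qlat L (g u)) -> lat_map L g (lat_coset L x) = lat_coset L (g x).
Proof.
move=> gB gq; apply/seteqP; split=> y; rewrite /lat_map /lat_coset /=.
  move=> [z hz hy]; have -> : y - g x = (y - g z) + g (z - x) by rewrite gB addrA subrK.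
  by apply: qlatD => //; exact: gq.
by move=> hy; exists x => //; rewrite subrr; case: hwqL.
Qed.

Lemma cr_e_coset i x : cr_e i (lat_coset L x) = lat_coset L (etilde i x).
Proof. by apply: lat_map_coset; [exact: etildeB | exact: etilde_hwqL]. Qed.

Lemma cr_f_coset i x : cr_f i (lat_coset L x) = lat_coset L (ftilde i x).
Proof. by apply: lat_map_coset; [exact: ftildeB | exact: ftilde_hwqL]. Qed.

Definition fword (w : seq I) : V := foldr (um_f V) v w.

Lemma fword_wt w : wtspace (lam - rootsum D w) (fword w).
Proof.
elim: w => [|j w IH]; first by rewrite /rootsum big_nil subr0; exact: hw_vector_wt.
by rewrite rootsum_cons opprD addrCA addrC; exact: wtspace_f.
Qed.

Lemma fword_e i w : exists s : seq (Qq * seq I),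
  (forall p, p \in s -> rootsum D p.2 + rd_root D i = rootsum D w) /\
  um_e V i (fword w) = \sum_(p <- s) p.1 *: fword p.2.
Proof.
elim: w => [|j w [s [hs sE]]]; first by exists [::]; split=> //; rewrite big_nil; exact: hw_vector_e.
have := wtspace_ef i j (fword_wt w); rewrite -/(fword _) => /eqP.
rewrite subr_eq => /eqP; rewrite /= => ->.
case: eqP => [ij|_].
  exists ((qbr (qvar ^+ rd_d D i) (pairing (rd_coroot D i) (lam - rootsum D w)), w)
    :: [seq (p.1, j :: p.2) | p <- s]); split.
    move=> p; rewrite inE => /orP[/eqP ->|/mapP[p' /hs h ->]] /=.
      by rewrite rootsum_cons ij addrC.
    by rewrite !rootsum_cons -addrA h.
  rewrite big_cons big_map /= sE; congr (_ + _); rewrite (linear_sum (um_f V j)).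
  by apply: eq_bigr => p _; rewrite linearZ.
exists [seq (p.1, j :: p.2) | p <- s]; split=> [p /mapP[p' /hs h ->]|] /=.
  by rewrite !rootsum_cons -addrA h.
rewrite add0r big_map /= sE (linear_sum (um_f V j)).
by apply: eq_bigr => p _; rewrite linearZ.
Qed.

Lemma fword_span u : lspan setT (range fword) u.
Proof.
have [_ irr] := hw_irreducible V.
have hS := lspan_span (range fword).
have mem w : lspan setT (range fword) (fword w) by apply: mem_lspan => //; exists w.
have ind (g : {linear V -> V}) : (forall w, lspan setT (range fword) (g (fword w))) ->
    forall u, lspan setT (range fword) u -> lspan setT (range fword) (g u).
  move=> hg; apply: (@lspan_ind _ _ _ (fun u => lspan setT (range fword) (g u))).
    split=> [|a x y _ hx hy]; first by rewrite linear0; case: hS.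
    by rewrite linearP; apply: (proj2 hS).
  by move=> _ [w _ <-].
have [| | | | |E|E] := irr (lspan setT (range fword)).
- by case: hS.
- by move=> a x y; apply: (proj2 hS).
- move=> i; apply: ind => w; have [s [_ ->]] := fword_e i w.
  apply: (smodule_sum _ _ hS) => // p _; exact: (smoduleZ hS).
- by move=> i; apply: ind => w; exact: (mem (i :: w)).
- by move=> k; apply: ind => w; rewrite fword_wt; exact: (smoduleZ hS).
- have := mem [::]; rewrite E /= => v0.
  by have := hw_vector_neq0 V; rewrite v0 eqxx.
- by rewrite E.
Qed.

Definition lower_span : set V := lspan setT [set x | exists i y, x = um_f V i y].

Lemma lower_fword x : lower_span x ->
  lspan setT [set x | exists2 w, w != [::] & x = fword w] x.
Proof.
have hS := lspan_span [set x | exists2 w, w != [::] & x = fword w].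
apply: (@lspan_ind _ _ _ (lspan setT [set x | exists2 w, w != [::] & x = fword w])) => //.
move=> _ [i [y ->]]; move: (fword_span y).
apply: (@lspan_ind _ _ _ (fun y => lspan setT [set x | exists2 w, w != [::] & x = fword w] (um_f V i y))).
  split=> [|a z z' _ hz hz']; first by rewrite linear0; case: hS.
  by rewrite linearP; apply: (proj2 hS).
by move=> _ [w _ <-]; apply: mem_lspan => //; exists (i :: w).
Qed.

(** A nonempty word lowers the weight by a sum of simple roots, nonzero since these are independent;
    so weights separate v from the image of the f_i. *)
Lemma hw_vector_lower a : lower_span (a *: v) -> a = 0.
Proof.
move=> /lower_fword [s [hs aE]].
have /choice[g hg] : forall p : Qq * V, exists w, p \in s -> w != [::] /\ p.2 = fword w.
  move=> p; case: (boolP (p \in s)) => [ps|]; last by exists [::].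
  by have [_ [w w0 ->]] := hs p ps; exists w.
have : a *: v = 0; last first.
  by move/eqP; rewrite scaler_eq0 (negbTE (hw_vector_neq0 V)) orbF => /eqP.
apply: (@wtspace_sum0 _ _ _ lam _ [seq (lam - rootsum D (g p), p.1 *: p.2) | p <- s]).
- apply: (smoduleZ (wtspace_smodule V lam)) => //; exact: hw_vector_wt.
- move=> _ /mapP[p ps ->] /=; have [w0 ->] := hg p ps; split.
    by apply: (smoduleZ (wtspace_smodule V _)) => //; exact: fword_wt.
  move/eqP; rewrite -subr_eq0 opprB addrCA subrr addr0 => /eqP /rootsum_eq0 w0'.
  by rewrite w0' in w0.
- by rewrite big_map.
Qed.

(** The linear form that is 1 on v and 0 on the image of every f_i. It is regular at q = 0 on the
    lattice, so its value there reads off the coefficient of b_lambda. *)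
Definition hw_coord (u : V) : Qq^o := xget 0 [set c | lower_span (u - c *: v)].

Lemma hw_coordP u : lower_span (u - hw_coord u *: v).
Proof.
apply: (xgetPex 0 (P := [set c | lower_span (u - c *: v)])).
have hS := lspan_span [set x | exists i y, x = um_f V i y].
move: (fword_span u); apply: (@lspan_ind _ _ _ (fun u => exists c, lower_span (u - c *: v))).
  split; first by exists 0; rewrite scale0r subr0; case: hS.
  move=> a x y _ [c hc] [c' hc']; exists (a * c + c').
  have -> : a *: x + y - (a * c + c') *: v = a *: (x - c *: v) + (y - c' *: v).
    by rewrite scalerBr scalerDl scalerA opprD addrACA.
  by apply: (proj2 hS).
move=> _ [[|j w] _ <-]; first by exists 1; rewrite scale1r subrr; case: hS.
by exists 0; rewrite scale0r subr0; apply: mem_lspan => //; exists j, (fword w).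
Qed.

Lemma hw_coord_eq u c : lower_span (u - c *: v) -> hw_coord u = c.
Proof.
move=> hc; have := hw_coordP u; set c' := hw_coord u => hc'.
have hS := lspan_span [set x | exists i y, x = um_f V i y].
have := proj2 hS (-1) _ _ Logic.I hc' hc; rewrite scaleN1r opprB addrA subrK -scalerBl.
by move=> /hw_vector_lower /eqP; rewrite subr_eq0 => /eqP.
Qed.

Lemma hw_coord_is_linear : linear hw_coord.
Proof.
move=> a x y; apply: hw_coord_eq.
have hS := lspan_span [set x | exists i y, x = um_f V i y].
have -> : a *: x + y - (a *: hw_coord x + hw_coord y : Qq^o) *: v
    = a *: (x - hw_coord x *: v) + (y - hw_coord y *: v).
  by rewrite scalerBr scalerDl scalerA opprD addrACA.
by apply: (proj2 hS) => //; exact: hw_coordP.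
Qed.

HB.instance Definition _ := GRing.isLinear.Build Qq V Qq^o _ hw_coord hw_coord_is_linear.

Lemma hw_coord_vector : hw_coord v = 1.
Proof.
by apply: hw_coord_eq; rewrite scale1r subrr; case: (lspan_span [set x | exists i y, x = um_f V i y]).
Qed.

Lemma hw_coord_f i y : hw_coord (um_f V i y) = 0.
Proof.
by apply: hw_coord_eq; rewrite scale0r subr0; apply: mem_lspan => //; exists i, y.
Qed.

Lemma hw_coord_ftilde i y : hw_coord (ftilde i y) = 0.
Proof. by have [z ->] := ftilde_range hM i y; exact: hw_coord_f. Qed.

Lemma hw_coord_regular u : L u -> regular0 (hw_coord u).
Proof.
apply: (@lspan_ind _ _ _ (fun u => regular0 (hw_coord u))).
  split=> [|a x y ra rx ry]; first by rewrite linear0; exact: regular0_0.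
  by rewrite linearP; apply: regular0D => //; exact: regular0M.
move=> _ [[|j w] ->] /=; first by rewrite hw_coord_vector; exact: regular0_1.
by rewrite hw_coord_ftilde; exact: regular0_0.
Qed.

Lemma hw_coord_wt xi u : wtspace xi u -> xi <> lam -> hw_coord u = 0.
Proof.
move=> hu xil; have := lower_fword (hw_coordP u) => -[s [hs uE]].
have /choice[g hg] : forall p : Qq * V, exists w, p \in s -> w != [::] /\ p.2 = fword w.
  move=> p; case: (boolP (p \in s)) => [ps|]; last by exists [::].
  by have [_ [w w0 ->]] := hs p ps; exists w.
have : hw_coord u *: v = 0; last first.
  by move/eqP; rewrite scaler_eq0 (negbTE (hw_vector_neq0 V)) orbF => /eqP.
apply: (@wtspace_sum0 _ _ _ lam _
   ((xi, u) :: [seq (lam - rootsum D (g p), - (p.1 *: p.2)) | p <- s])).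
- apply: (smoduleZ (wtspace_smodule V lam)) => //; exact: hw_vector_wt.
- move=> p'; rewrite inE => /orP[/eqP -> //=|/mapP[p ps ->] /=]; first by split=> // /esym.
  have [w0 ->] := hg p ps; split.
    rewrite -scaleNr; apply: (smoduleZ (wtspace_smodule V _)) => //; exact: fword_wt.
  move/eqP; rewrite -subr_eq0 opprB addrCA subrr addr0 => /eqP /rootsum_eq0 w0'.
  by rewrite w0' in w0.
- by rewrite big_cons big_map /= sumrN -uE opprB addrC subrK.
Qed.

Definition fword_tilde (w : seq I) : V := foldr (@ftilde I D V) v w.

Lemma fword_tildeL w : L (fword_tilde w).
Proof. by apply: (mem_lspan regular0_1); exists w. Qed.

Lemma hwB_coset C : B C <-> exists w, C = lat_coset L (fword_tilde w) /\ ~ qlat L (fword_tilde w).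
Proof.
by split=> -[w [E h]]; exists w; split=> //; [rewrite -lat_coset_eq0 -E | rewrite E lat_coset_eq0].
Qed.

Lemma hwB_ef i x y : L x -> L y -> B (lat_coset L x) -> B (lat_coset L y) ->
  qlat L (y - ftilde i x) <-> qlat L (x - etilde i y).
Proof.
move=> Lx Ly Bx By; have := cb_base_ef cb i Bx By.
by rewrite -[lat_map _ _ _]/(cr_f i _) -[X in _ <-> _ = X -> _]/(cr_e i _) cr_f_coset cr_e_coset !lat_coset_eq.
Qed.

Lemma hwB_etilde i x : L x -> B (lat_coset L x) -> ~ qlat L (etilde i x) ->
  B (lat_coset L (etilde i x)).
Proof.
move=> Lx Bx nz; have := cb_base_e cb i Bx; rewrite -[lat_map _ _ _]/(cr_e i _) cr_e_coset.
by case=> // /lat_coset_eq0.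
Qed.

Lemma fword_tilde_etilde i w : ~ qlat L (fword_tilde (i :: w)) ->
  qlat L (etilde i (fword_tilde (i :: w)) - fword_tilde w).
Proof.
move=> nz; have nz' : ~ qlat L (fword_tilde w) by move=> h; apply: nz; exact: ftilde_hwqL.
have B1 : B (lat_coset L (fword_tilde w)) by apply/hwB_coset; exists w.
have B2 : B (lat_coset L (fword_tilde (i :: w))) by apply/hwB_coset; exists (i :: w).
rewrite -opprB; apply: qlatN; apply/(hwB_ef i (fword_tildeL w) (fword_tildeL (i :: w)) B1 B2).
by rewrite /= subrr; case: hwqL.
Qed.

(** Otherwise x is, modulo q, some ftilde_i y with y in the crystal, and etilde_i gives back y,
    which is nonzero. *)
Lemma hwB_highest x : L x -> B (lat_coset L x) -> (forall i, qlat L (etilde i x)) ->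
  qlat L (x - v).
Proof.
move=> Lx /hwB_coset [[|i w] [/lat_coset_eq h nz]] he //.
case: (nz); apply: ftilde_hwqL; rewrite -/(fword_tilde w).
have := qlatD (etilde_hwqL i h) (fword_tilde_etilde nz).
rewrite etildeB addrA subrK => h2; have := qlatD (he i) (qlatN h2).
by rewrite opprB addrCA subrr addr0.
Qed.

Lemma Qq_const_additive : zmod_morphism Qq_const.
Proof. by move=> a b; rewrite /Qq_const polyCB tofracB. Qed.

HB.instance Definition _ := GRing.isZmodMorphism.Build rat Qq Qq_const Qq_const_additive.

(** Expand z in the crystal modulo q. Since etilde_i is injective on the elements it does not kill,
    these have coefficient 0 for each i. Only b_lambda remains, and its coefficient is 0 because z
    has another weight. *)
Lemma crystal_highest z xi : L z -> wtspace xi z -> xi <> lam ->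
  (forall i, qlat L (etilde i z)) -> qlat L z.
Proof.
move=> Lz wz xil hz; have [s [hs zs]] := cb_base_span cb Lz.
(* The spanning list may repeat a class: k C collects the coefficients of the class C, and r C
   represents it. *)
pose cls (p : rat * V) := lat_coset L p.2; pose cs := undup (map cls s).
pose k C := \sum_(p <- s | cls p == C) p.1; pose r (C : set V) : V := xget 0 C.
have csP C : C \in cs -> exists2 p, p \in s & C = cls p.
  by rewrite mem_undup => /mapP.
have rP C : C \in cs -> [/\ L (r C), B C & C = lat_coset L (r C)].
  move=> /csP [p ps CE]; have [Lp Bp] := hs p ps.
  have : C (r C).
    apply: xgetPex; exists p.2; rewrite CE /cls /lat_coset /= subrr; by case: hwqL.
  rewrite {1}CE /cls {1}/lat_coset /= => h; split.
  - rewrite -[r C](subrK p.2); apply: (smoduleD regular0_1 hwL_lattice) => //.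
    exact: (qlat_sub hwL_lattice).
  - by rewrite CE.
  - by rewrite [LHS]CE; apply/lat_coset_eq; rewrite -opprB; exact: qlatN.
have zk : qlat L (z - \sum_(C <- cs) Qq_const (k C) *: r C).
  have -> : z - \sum_(C <- cs) Qq_const (k C) *: r C = (z - \sum_(p <- s) Qq_const p.1 *: p.2)
      + (\sum_(p <- s) Qq_const p.1 *: p.2 - \sum_(C <- cs) Qq_const (k C) *: r C).
    by rewrite addrA subrK.
  apply: qlatD => //; rewrite (big_fibers _ cls) -sumrB big_seq.
  apply: (smodule_sum _ regular0_1 hwqL) => C hC; have [_ _ CE] := rP C hC.
  rewrite /k raddf_sum scaler_suml -sumrB; apply: (smodule_sum _ regular0_1 hwqL) => p /eqP pC.
  rewrite -scalerBr; apply: (smoduleZ hwqL); first exact: regular0_const.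
  by apply/lat_coset_eq; rewrite -CE.
have kC0 C : C \in cs -> k C != 0 -> qlat L (r C - v).
  move=> hC kC; have [LC BC CE] := rP C hC; apply: hwB_highest => // [|i]; first by rewrite -CE.
  apply: contrapT => nz; move/eqP: kC; apply.
  (* On these classes etilde_i takes values in the crystal and ftilde_i inverts it, so their images
     are distinct crystal elements and independence applies to etilde_i z, which is 0 modulo q. *)
  pose cs' := [seq C' <- cs | `[< ~ qlat L (etilde i (r C')) >]].
  have cs'P C' : C' \in cs' -> C' \in cs /\ ~ qlat L (etilde i (r C')).
    by rewrite mem_filter => /andP[/asboolP].
  have Be C' : C' \in cs' -> B (lat_coset L (etilde i (r C'))).
    move=> /cs'P [h h2]; have [L' B' CE'] := rP C' h.
    by apply: hwB_etilde => //; rewrite -CE'.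
  have inv C' : C' \in cs' -> lat_map L (ftilde i) (lat_coset L (etilde i (r C'))) = C'.
    move=> hC'; have Be' := Be C' hC'; have [h h2] := cs'P C' hC'; have [L' B' CE'] := rP C' h.
    rewrite -[lat_map _ _ _]/(cr_f i _) cr_f_coset [RHS]CE'; apply/lat_coset_eq.
    rewrite -opprB; apply: qlatN; apply/(hwB_ef i (etilde_hwL i L') L'); rewrite -?CE' //.
    by rewrite subrr; case: hwqL.
  have := cb_base_indep cb (s := [seq etilde i (r C') | C' <- cs'])
    (c := fun x => k (lat_map L (ftilde i) (lat_coset L x))).
  have hCi : C \in cs' by rewrite mem_filter hC andbT; apply/asboolP.
  move=> /(_ _ _ _ _ (etilde i (r C))); rewrite inv //; apply.
  - rewrite map_inj_in_uniq ?filter_uniq ?undup_uniq // => C1 C2 h1 h2 E.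
    by rewrite -[LHS](inv C1 h1) -[RHS](inv C2 h2) E.
  - move=> x /mapP[C' hC' ->]; split; last exact: Be.
    by apply: etilde_hwL; have [h _] := cs'P C' hC'; have [] := rP C' h.
  - move=> x y /mapP[C1 h1 ->] /mapP[C2 h2 ->] E.
    by have -> : C1 = C2 by rewrite -[LHS](inv C1 h1) -[RHS](inv C2 h2) E.
  - rewrite big_map big_filter.
    have -> : \sum_(C' <- cs | `[< ~ qlat L (etilde i (r C')) >])
        Qq_const (k (lat_map L (ftilde i) (lat_coset L (etilde i (r C'))))) *: etilde i (r C')
      = \sum_(C' <- cs | `[< ~ qlat L (etilde i (r C')) >]) Qq_const (k C') *: etilde i (r C').
      rewrite big_seq_cond [RHS]big_seq_cond; apply: eq_bigr => C' /andP[h1 h2].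
      by rewrite inv // mem_filter h2.
    have eL a x y : etilde i (a *: x + y : V) = a *: etilde i x + etilde i y.
      exact: etilde_linear.
    have : qlat L (etilde i (\sum_(C' <- cs) Qq_const (k C') *: r C')).
      have := qlatD (hz i) (qlatN (etilde_hwqL i zk)).
      by rewrite etildeB opprB addrCA subrr addr0.
    have -> : etilde i (\sum_(C' <- cs) Qq_const (k C') *: r C')
        = \sum_(C' <- cs) Qq_const (k C') *: etilde i (r C').
      elim: (cs) => [|C' t IH]; first by rewrite !big_nil etilde0.
      by rewrite !big_cons eL IH.
    rewrite (bigID (fun C' => `[< ~ qlat L (etilde i (r C')) >])) /= => h.
    have h2 : qlat L (\sum_(C' <- cs | ~~ `[< ~ qlat L (etilde i (r C')) >])
        Qq_const (k C') *: etilde i (r C')).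
      apply: (smodule_sum _ regular0_1 hwqL) => C' /asboolPn /contrapT h'.
      by apply: (smoduleZ hwqL) h'; exact: regular0_const.
    by have := qlatD h (qlatN h2); rewrite addrK.
  - by apply: map_f.
have zc : qlat L (z - Qq_const (\sum_(C <- cs) k C) *: v).
  have -> : z - Qq_const (\sum_(C <- cs) k C) *: v = (z - \sum_(C <- cs) Qq_const (k C) *: r C)
      + \sum_(C <- cs) Qq_const (k C) *: (r C - v).
    have -> : \sum_(C <- cs) Qq_const (k C) *: (r C - v)
        = \sum_(C <- cs) (Qq_const (k C) *: r C - Qq_const (k C) *: v).
      by apply: eq_bigr => C _; rewrite scalerBr.
    by rewrite sumrB -scaler_suml -raddf_sum addrA subrK.
  apply: qlatD => //; rewrite big_seq; apply: (smodule_sum _ regular0_1 hwqL) => C hC.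
  case: (eqVneq (k C) 0) => [->|/(kC0 C hC) h].
    by rewrite raddf0 scale0r; case: hwqL.
  by apply: (smoduleZ hwqL) h; exact: regular0_const.
(* The coordinate of z on the highest weight vector is 0, so the rational coefficient of v lies in q
   [regular0] and vanishes. *)
have [y Ly zy] := zc; have := congr1 hw_coord zy.
rewrite linearB !linearZ /= (hw_coord_wt wz xil) hw_coord_vector add0r.
rewrite -[_ *: - 1]/(_ * - 1) mulrN1 => /(congr1 -%R); rewrite opprK -mulrN => /Qq_const_qmul k0.
rewrite -[z](subr0) -(scale0r v) -(raddf0 Qq_const) -k0 //; apply: regular0N.
exact: hw_coord_regular.
Qed.

(* q^N a lies in the lattice for some N, which crystal_highest lowers to 0. *)
Lemma crystal_lattice_detect a xi : wtspace xi a -> xi <> lam ->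
  (forall i, L (etilde i a)) -> L a.
Proof.
move=> wa xil ha.
have [N] : exists N, L (qvar ^+ N *: a).
  have [X [_ XT LX]] := cb_lattice cb.
  have : lspan setT X a by rewrite XT.
  by move=> /lspan_clear [N hN]; exists N; rewrite LX.
elim: N => [|N IH]; first by rewrite expr0 scale1r.
move=> h; apply: IH; have [y Ly yE] : qlat L (qvar ^+ N.+1 *: a).
  apply: (@crystal_highest _ xi) => // [|i]; first exact: (smoduleZ (wtspace_smodule V xi)).
  exists (qvar ^+ N *: etilde i a).
    by apply: (smoduleZ hwL_lattice) => //; exact: regular0X regular0_q.
  rewrite scalerA -exprS -[qvar ^+ N.+1 *: a]addr0 etilde_linear //.
  by rewrite etilde0 addr0.
rewrite exprS -scalerA in yE; have := scalerI qvar_neq0 yE.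
by move=> ->.
Qed.

Lemma hw_vector_nqL : ~ qlat L v.
Proof.
move=> [y Ly vE]; have := congr1 hw_coord vE; rewrite hw_coord_vector linearZ /= => h.
have E : Qq_const 1 = qvar * hw_coord y by rewrite -[qvar * _]h /Qq_const tofrac1.
by have := Qq_const_qmul (hw_coord_regular Ly) E => /eqP; rewrite oner_eq0.
Qed.

End HighestWeightCrystal.

Lemma tensor_ef_cancel (V : lmodType Qq) (a b g e c1 c2 : Qq) (P Q R S X : V) :
  b * g = a * e ->
  (a *: (c1 *: X + P) + Q) + b *: (g *: R + (c2 *: X + S))
    - (a *: (P + e *: R) + (Q + b *: S)) = (a * c1 + b * c2) *: X.
Proof.
move=> bg; apply/eqP; rewrite subr_eq !scalerDr !scalerA bg scalerDl !addrA; apply/eqP.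
by rewrite [LHS](ACl (1*5*2*4*3*6)).
Qed.

Lemma qbrD (F : fieldType) (v : F) (a b : int) : v != 0 -> v - v^-1 != 0 ->
  v ^ (- b) * qbr v a + v ^ a * qbr v b = qbr v (a + b).
Proof.
move=> v0 vB0; rewrite /qbr !opprD !expfzDr // -!invr_expz.
have a0 : v ^ a != 0 by rewrite expfz_neq0.
have b0 : v ^ b != 0 by rewrite expfz_neq0.
have v1 : v * v - 1 != 0.
  by apply: contraNneq vB0 => /(canRL (subrK _)); rewrite add0r => vv;
     rewrite -{1}[v](mulfK v0) vv mul1r subrr.
by field; rewrite a0 b0 v0 v1.
Qed.

Lemma smodule_preim (V V' : lmodType Qq) S (g : {linear V -> V'}) (P : set V') :
  smodule S P -> smodule S [set x | P (g x)].
Proof.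
move=> [P0 PL]; split=> [|a x y Sa hx hy] /=; first by rewrite linear0.
by rewrite linearP; apply: PL.
Qed.

(** * Tensor products of modules *)

(* The part of the structure of M (x) N that is needed; the Serre relations on
   the tensor product are not. *)
Record tensor_product (I : finType) (D : root_datum I) (M N : Uq_module D) := TensorProduct {
  tp_space :> lmodType Qq;
  tens : M -> N -> tp_space;
  tensDl : forall x x' y, tens (x + x') y = tens x y + tens x' y;
  tensDr : forall x y y', tens x (y + y') = tens x y + tens x y';
  tensZl : forall a x y, tens (a *: x) y = a *: tens x y;
  tensZr : forall a x y, tens x (a *: y) = a *: tens x y;
  tensor_e : I -> {linear tp_space -> tp_space};
  tensor_f : I -> {linear tp_space -> tp_space};
  tens_e : forall i x y eta, wtspace eta y -> tensor_e i (tens x y)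
    = (qvar ^+ rd_d D i) ^ (- pairing (rd_coroot D i) eta) *: tens (um_e M i x) y
      + tens x (um_e N i y);
  tens_f : forall i x y xi, wtspace xi x -> tensor_f i (tens x y)
    = tens (um_f M i x) y
      + (qvar ^+ rd_d D i) ^ pairing (rd_coroot D i) xi *: tens x (um_f N i y);
  tensor_coord : {linear M -> Qq^o} -> {linear N -> Qq^o} -> {linear tp_space -> Qq^o};
  tensor_coordE : forall phi psi x y, tensor_coord phi psi (tens x y) = phi x * psi y
}.

Arguments tens {I D M N T} : rename.
Arguments tensor_e {I D M N} T : rename.
Arguments tensor_f {I D M N} T : rename.
Arguments tensor_coord {I D M N} T : rename.
Arguments tens_e {I D M N T} i x {y eta} : rename.
Arguments tens_f {I D M N T} i {x} y {xi} : rename.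

Section FunctionTensor.
Variables (I : finType) (D : root_datum I) (M N : Uq_module D).

Local Notation h i := (rd_coroot D i).
Local Notation d i := (rd_d D i).

(* A model of a space containing M (x) N: the tensor x (x) y is the function
   phi |-> phi y *: x on the dual of N. *)
Definition tensor_space : lmodType Qq := ({linear N -> Qq^o} -> M).

Definition fun_tens (x : M) (y : N) : tensor_space := fun phi => phi y *: x.

(** With tensors as functions of a form phi on N, an operator on the right factor acts by
    precomposing phi. The terms e_i (x) t_i^-1, 1 (x) e_i and t_i (x) f_i of the comultiplication
    are written in this way below. *)
Definition pull (g : {linear N -> N}) (phi : {linear N -> Qq^o}) : {linear N -> Qq^o} :=
  phi \o g.

Definition fun_tensor_e (i : I) (F : tensor_space) : tensor_space :=
  fun phi => um_e M i (F (pull (um_k N (- (h i *+ d i))) phi)) + F (pull (um_e N i) phi).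

Definition fun_tensor_f (i : I) (F : tensor_space) : tensor_space :=
  fun phi => um_f M i (F phi) + um_k M (h i *+ d i) (F (pull (um_f N i) phi)).

Lemma fun_tensor_e_linear i : linear (fun_tensor_e i).
Proof.
move=> a F G; apply/funext => phi.
by rewrite /fun_tensor_e !fctE linearP scalerDr addrACA.
Qed.

Lemma fun_tensor_f_linear i : linear (fun_tensor_f i).
Proof.
move=> a F G; apply/funext => phi.
by rewrite /fun_tensor_f !fctE !linearP scalerDr addrACA.
Qed.

HB.instance Definition _ i := GRing.isLinear.Build Qq tensor_space tensor_space _
  (fun_tensor_e i) (fun_tensor_e_linear i).
HB.instance Definition _ i := GRing.isLinear.Build Qq tensor_space tensor_space _
  (fun_tensor_f i) (fun_tensor_f_linear i).

Lemma fun_tensZl a x y : fun_tens (a *: x) y = a *: fun_tens x y.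
Proof. by apply/funext => phi; rewrite /fun_tens !fctE !scalerA mulrC. Qed.

Lemma fun_tensZr a x y : fun_tens x (a *: y) = a *: fun_tens x y.
Proof. by apply/funext => phi; rewrite /fun_tens !fctE linearZ scalerA. Qed.

Lemma fun_tensDl x x' y : fun_tens (x + x') y = fun_tens x y + fun_tens x' y.
Proof. by apply/funext => phi; rewrite /fun_tens !fctE scalerDr. Qed.

Lemma fun_tensDr x y y' : fun_tens x (y + y') = fun_tens x y + fun_tens x y'.
Proof. by apply/funext => phi; rewrite /fun_tens !fctE linearD scalerDl. Qed.

Lemma fun_tens_e i x y eta : wtspace eta y -> fun_tensor_e i (fun_tens x y)
  = (qvar ^+ d i) ^ (- pairing (h i) eta) *: fun_tens (um_e M i x) y + fun_tens x (um_e N i y).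
Proof.
move=> hy; apply/funext => phi; rewrite /fun_tensor_e /fun_tens /pull !fctE /= linearZ.
by rewrite hy linearZ /= pairingN pairing_mulrn qdZE mulrN scalerA.
Qed.

Lemma fun_tens_f i x y xi : wtspace xi x -> fun_tensor_f i (fun_tens x y)
  = fun_tens (um_f M i x) y + (qvar ^+ d i) ^ pairing (h i) xi *: fun_tens x (um_f N i y).
Proof.
move=> hx; apply/funext => phi; rewrite /fun_tensor_f /fun_tens /pull !fctE /= !linearZ /=.
by rewrite hx pairing_mulrn qdZE !scalerA mulrC.
Qed.

Definition fun_tensor_coord (phi : {linear M -> Qq^o}) (psi : {linear N -> Qq^o})
  (F : tensor_space) : Qq^o := phi (F psi).

Lemma fun_tensor_coord_linear phi psi : linear (fun_tensor_coord phi psi).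
Proof. by move=> a F G; rewrite /fun_tensor_coord !fctE linearP. Qed.

HB.instance Definition _ phi psi := GRing.isLinear.Build Qq tensor_space Qq^o _
  (fun_tensor_coord phi psi) (fun_tensor_coord_linear phi psi).

Lemma fun_tensor_coordE phi psi x y : fun_tensor_coord phi psi (fun_tens x y) = phi x * psi y.
Proof. by rewrite /fun_tensor_coord /fun_tens linearZ mulrC. Qed.

Definition fun_tensor_product : tensor_product M N :=
  @TensorProduct I D M N tensor_space fun_tens fun_tensDl fun_tensDr fun_tensZl fun_tensZr
    fun_tensor_e fun_tensor_f fun_tens_e fun_tens_f
    fun_tensor_coord fun_tensor_coordE.

End FunctionTensor.

Section Tensor.
Variables (I : finType) (D : root_datum I) (M N : Uq_module D) (T : tensor_product M N).

Local Notation h i := (rd_coroot D i).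
Local Notation al i := (rd_root D i).
Local Notation d i := (rd_d D i).
Local Notation tens := (@tens I D M N T).
Local Notation tensor_e := (@tensor_e I D M N T).
Local Notation tensor_f := (@tensor_f I D M N T).

Lemma tens0l y : tens 0 y = 0.
Proof. by rewrite -(scale0r 0) tensZl scale0r. Qed.

Lemma tens0r x : tens x 0 = 0.
Proof. by rewrite -(scale0r 0) tensZr scale0r. Qed.

(** T may be larger than the tensor product. Weight spaces are therefore spans of pure tensors of
    weight vectors, on which [tens_e] and [tens_f] determine the operators. *)
Definition tensor_wt (xi : weight D) : set T :=
  lspan setT [set u | exists x y a b,
    [/\ wtspace a x, wtspace b y, a + b = xi & u = tens x y]].

Lemma tensor_wt_smodule xi : smodule setT (tensor_wt xi).
Proof. exact: lspan_span. Qed.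

Lemma tens_wt x y a b : wtspace a x -> wtspace b y -> tensor_wt (a + b) (tens x y).
Proof. by move=> hx hy; apply: mem_lspan => //; exists x, y, a, b. Qed.

Lemma tensor_wt_ind xi (P : set T) : smodule setT P ->
  (forall x y a b, wtspace a x -> wtspace b y -> a + b = xi -> P (tens x y)) ->
  tensor_wt xi `<=` P.
Proof.
move=> hP h'; apply: lspan_ind => // _ [x [y [a [b [hx hy ab ->]]]]].
exact: (h' x y a b).
Qed.

Lemma tensor_wt_e i xi u : tensor_wt xi u -> tensor_wt (xi + al i) (tensor_e i u).
Proof.
apply: (tensor_wt_ind (smodule_preim (tensor_e i) (tensor_wt_smodule _))) => x y a b hx hy <- /=.
rewrite (tens_e i x hy); apply: (smoduleD _ (tensor_wt_smodule _)) => //.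
  apply: (smoduleZ (tensor_wt_smodule _)) => //; rewrite addrAC.
  by apply: tens_wt => //; exact: wtspace_e.
by rewrite -addrA; apply: tens_wt => //; exact: wtspace_e.
Qed.

Lemma tensor_wt_f i xi u : tensor_wt xi u -> tensor_wt (xi - al i) (tensor_f i u).
Proof.
apply: (tensor_wt_ind (smodule_preim (tensor_f i) (tensor_wt_smodule _))) => x y a b hx hy <- /=.
rewrite (tens_f i y hx); apply: (smoduleD _ (tensor_wt_smodule _)) => //.
  by rewrite addrAC; apply: tens_wt => //; exact: wtspace_f.
apply: (smoduleZ (tensor_wt_smodule _)) => //; rewrite -addrA.
by apply: tens_wt => //; exact: wtspace_f.
Qed.

Lemma tensor_wt_ef i j xi u : tensor_wt xi u ->
  tensor_e i (tensor_f j u) - tensor_f j (tensor_e i u)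
  = if i == j then qbr (qvar ^+ d i) (pairing (h i) xi) *: u else 0.
Proof.
pose c := if i == j then qbr (qvar ^+ d i) (pairing (h i) xi) else 0.
have cE u' : (if i == j then qbr (qvar ^+ d i) (pairing (h i) xi) *: u' else 0) = c *: u'.
  by rewrite /c; case: eqP => // _; rewrite scale0r.
rewrite cE; apply: (@tensor_wt_ind xi [set u | _ = c *: u]).
  split=> [|a x y _ hx hy] /=; first by rewrite !linear0 ?subr0 ?addr0 ?scaler0.
  have -> : tensor_e i (tensor_f j (a *: x + y))
      = a *: tensor_e i (tensor_f j x) + tensor_e i (tensor_f j y) by rewrite !linearP.
  have -> : tensor_f j (tensor_e i (a *: x + y))
      = a *: tensor_f j (tensor_e i x) + tensor_f j (tensor_e i y) by rewrite !linearP.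
  by rewrite scalerDr scalerA mulrC -scalerA -hx -hy opprD addrACA scalerBr.
move=> x y a b hx hy ab /=; rewrite (tens_f j y hx) (tens_e i x hy).
rewrite [tensor_e i (_ + _)]linearD [tensor_f j (_ + _)]linearD /=.
rewrite [tensor_e i (_ *: _)]linearZ [tensor_f j (_ *: _)]linearZ /=.
rewrite (tens_e i _ hy) (tens_e i _ (wtspace_f j hy)).
rewrite (tens_f j _ hx) (tens_f j _ (wtspace_e i hx)).
have := wtspace_ef i j hx; have := wtspace_ef i j hy.
have if0 (V : lmodType Qq) r (z : V) : (if i == j then r *: z else 0) = (if i == j then r else 0) *: z.
  by case: eqP => // _; rewrite scale0r.
rewrite !if0 => /(canRL (subrK _)) ->; move=> /(canRL (subrK _)) ->.
(* The mixed terms e_i x (x) f_j y cancel: their powers of q agree because d_i <h_i, alpha_j> is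
   symmetric in i and j. *)
rewrite tensDl tensDr tensZl tensZr tensor_ef_cancel; last first.
  rewrite !qdZE -!expfzDr ?qvar_neq0 //; congr (qvar ^ _).
  by rewrite pairingD -scaleN1r pairingD pairingZ !mulrDr !opprD rd_symmetrizable; ring.
rewrite /c -ab; case: eqP => [<-|_]; last by rewrite !mulr0 addr0.
by rewrite pairingD qbrD ?qd_neq0 ?qdBV_neq0 // rd_d_gt0.
Qed.

End Tensor.

Lemma estring_sub (V : lmodType Qq) d (e f : {linear V -> V}) c c' (W W' : int -> set V) u w :
  c = c' -> (forall j x, W j x -> W' j x) -> estring d e f c W u w -> estring d e f c' W' u w.
Proof.
move=> <- WW' [N [X [[hX uE] wE]]]; exists N, X; split=> //; split=> // k.
by have [h1 h2 h3] := hX k; split=> //; exact: WW'.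
Qed.

Lemma fstring_sub (V : lmodType Qq) d (e f : {linear V -> V}) c c' (W W' : int -> set V) u w :
  c = c' -> (forall j x, W j x -> W' j x) -> fstring d e f c W u w -> fstring d e f c' W' u w.
Proof.
move=> <- WW' [N [X [[hX uE] wE]]]; exists N, X; split=> //; split=> // k.
by have [h1 h2 h3] := hX k; split=> //; exact: WW'.
Qed.

Section ModuleStrings.
Variables (I : finType) (D : root_datum I) (M : Uq_module D) (hM : integrable M).

Local Notation h i := (rd_coroot D i).
Local Notation al i := (rd_root D i).
Local Notation d i := (rd_d D i).
Local Notation dp i := (dpow (qvar ^+ d i) (um_f M i)).

Lemma wtspace_dpow i k xi x : @wtspace I D M xi x -> wtspace (xi - k%:Z *: al i) (dp i k x).
Proof.
move=> hx; have := strip_divf (rd_d_gt0 D i) (module_strip hM i xi) (j := 0) k.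
by rewrite scale0r addr0 sub0r scaleNr; apply.
Qed.

Lemma module_highest i xi x : @wtspace I D M xi x -> um_e M i x = 0 -> x != 0 ->
  exists2 m : nat, pairing (h i) xi = m%:Z & dp i m.+1 x = 0.
Proof.
move=> hx ex x0; have := highest_weight_ge0 (rd_d_gt0 D i) (module_strip hM i xi) (j := 0) (x := x).
by rewrite scale0r mulr0 !addr0; apply.
Qed.

Lemma dpow_out i xi x m k : @wtspace I D M xi x -> um_e M i x = 0 ->
  pairing (h i) xi = m%:Z -> (m < k)%N -> dp i k x = 0.
Proof.
move=> hx ex xm; case: (eqVneq x 0) => [->|x0 mk]; first by rewrite divpow_at0.
have [m' m'E h0] := module_highest hx ex x0; have {m'E} mm : m' = m by lia.
rewrite mm in h0; rewrite -(subnK mk); elim: (k - m.+1)%N => [|t IH] //.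
by rewrite addSn divpowS ?rd_d_gt0 // IH linear0 scaler0.
Qed.

Lemma ftilde_dpow i xi x k : @wtspace I D M xi x -> um_e M i x = 0 ->
  ftilde i (dp i k x) = dp i k.+1 x.
Proof.
move=> hx ex; have ft0 : ftilde i (0 : M) = 0.
  by have := ftilde_linear hM i (-1) 0 0; rewrite scaler0 addr0 scaleN1r addNr.
case: (eqVneq x 0) => [->|x0]; first by rewrite !divpow_at0.
have [m mE h0] := module_highest hx ex x0; case: (leqP k m) => km; last first.
  by rewrite !(dpow_out hx ex mE) // ltnW.
apply: (fstring_ftilde hM (xi := xi - k%:Z *: al i)).
apply: (fstring_divf (module_strip hM i _)) => //; first by rewrite subrK.
by move=> _; rewrite -scaleNr pairingD pairingZ rd_diag mE; lia.
Qed.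

Lemma etilde_dpow i xi x k : @wtspace I D M xi x -> um_e M i x = 0 ->
  (k%:Z <= pairing (h i) xi) ->
  etilde i (dp i k x) = if k is k'.+1 then dp i k' x else 0.
Proof.
move=> hx ex km; apply: (estring_etilde hM (xi := xi - k%:Z *: al i)).
apply: (estring_divf (module_strip hM i _)) => //; first by rewrite subrK.
by move=> _; rewrite -scaleNr pairingD pairingZ rd_diag; lia.
Qed.

End ModuleStrings.

Section CrystalStrings.
Variables (I : finType) (D : root_datum I) (lam : weight D) (V : hw_crystal lam).

Local Notation h i := (rd_coroot D i).
Local Notation al i := (rd_root D i).
Local Notation d i := (rd_d D i).
Local Notation L := (@hwL I D lam V).
Local Notation dp i := (dpow (qvar ^+ d i) (um_f V i)).

Definition hw_integrable : integrable V := cb_integrable (hw_crystal_base V).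
Let hM := hw_integrable.

Lemma dpow_hwL i xi x k : wtspace xi x -> um_e V i x = 0 -> L x -> L (dp i k x).
Proof.
move=> hx ex Lx; elim: k => [|k IH]; first by rewrite divpow0.
by rewrite -(ftilde_dpow hM k hx ex); exact: ftilde_hwL.
Qed.

(** The [X k.+1] are the components of etilde_i u, and [X 0] is u - ftilde_i (etilde_i u). Both
    operators preserve the lattice, so induction on the length applies. *)
Lemma hstring_hwL i xi u N X : L u ->
  hstring (d i) (um_e V i) (um_f V i) (pairing (h i) xi) (fun j => wtspace (xi + j *: al i)) u N X ->
  forall k, L (X k).
Proof.
elim: N xi u X => [|N IH] xi u X Lu hX k.
  have [_ _ h0] := hX.1 k; have -> : X k = 0 by apply/eqP/negPn/negP => /h0 [].
  by case: (hwL_lattice V).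
have hu : etilde i u = \sum_(k < N.+1) dp i k (X k.+1).
  by apply: (estring_etilde hM (xi := xi)); exists N.+1, X.
have hX' : hstring (d i) (um_e V i) (um_f V i) (pairing (h i) (xi + al i))
    (fun j => wtspace (xi + al i + j *: al i)) (etilde i u) N (fun k => X k.+1).
  split=> [t|].
    have [h1 h2 h3] := hX.1 t.+1; split=> //.
      have -> // : xi + al i + t%:Z *: al i = xi + t.+1%:Z *: al i.
      by rewrite (_ : t.+1%:Z = 1 + t%:Z) ?scalerDl ?scale1r ?addrA //; lia.
    by move=> /h3 []; rewrite pairingD rd_diag ltnS; split=> //; lia.
  rewrite hu big_ord_recr /=; have [_ _ h3] := hX.1 N.+1.
  have -> : X N.+1 = 0 by apply/eqP/negPn/negP => /h3 [_]; rewrite ltnn.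
  by rewrite divpow_at0 addr0.
have hf : ftilde i (etilde i u) = \sum_(k < N) dp i k.+1 (X k.+1).
  by apply: (fstring_ftilde hM (xi := xi + al i)); exists N, (fun k => X k.+1).
case: k => [|k]; last exact: (IH _ _ _ (etilde_hwL i Lu) hX' k).
have -> : X 0%N = u - ftilde i (etilde i u).
  by rewrite hf hX.2 big_ord_recl divpow0 addrK.
rewrite -scaleN1r; apply: (smoduleD regular0_1 (hwL_lattice V)) => //.
apply: (smoduleZ (hwL_lattice V)); first by apply: regular0N; exact: regular0_1.
by apply: ftilde_hwL; exact: etilde_hwL.
Qed.

End CrystalStrings.

Section TensorStrips.
Variables (I : finType) (D : root_datum I) (M N : Uq_module D) (T : tensor_product M N).
Hypotheses (hM : integrable M) (hN : integrable N).

Local Notation h i := (rd_coroot D i).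
Local Notation al i := (rd_root D i).
Local Notation d i := (rd_d D i).
Local Notation tens := (@tens I D M N T).
Local Notation tensor_e := (@tensor_e I D M N T).
Local Notation tensor_f := (@tensor_f I D M N T).
Local Notation tensor_wt := (@tensor_wt I D M N T).

Lemma tens_e_nilp i a b x y xi eta : wtspace xi x -> wtspace eta y ->
  iter a (um_e M i) x = 0 -> iter b (um_e N i) y = 0 ->
  iter (a + b) (tensor_e i) (tens x y) = 0.
Proof.
have [n] := ubnP (a + b); elim: n a b x y xi eta => // n IH a b x y xi eta abn hx hy ax b_y.
case: a ax abn => [/= ->|a ax] abn; first by rewrite tens0l iter_at0.
case: b b_y abn => [/= ->|b b_y] abn; first by rewrite tens0r iter_at0 ?linear0.
have E1 : iter (a + b.+1) (tensor_e i) (tens (um_e M i x) y) = 0.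
  apply: (IH _ _ _ _ _ _ _ (wtspace_e i hx) hy) => //.
  by rewrite -iterSr.
have E2 : iter (a.+1 + b) (tensor_e i) (tens x (um_e N i y)) = 0.
  apply: (IH _ _ _ _ _ _ _ hx (wtspace_e i hy)) => //; last by rewrite -iterSr.
  by move: abn; rewrite addnS ltnS.
by rewrite addSnnS in E2; rewrite addSn iterSr (tens_e i x hy) iter_linear E1 E2 scaler0 addr0.
Qed.

Lemma tens_f_nilp i a b x y xi eta : wtspace xi x -> wtspace eta y ->
  iter a (um_f M i) x = 0 -> iter b (um_f N i) y = 0 ->
  iter (a + b) (tensor_f i) (tens x y) = 0.
Proof.
have [n] := ubnP (a + b); elim: n a b x y xi eta => // n IH a b x y xi eta abn hx hy ax b_y.
case: a ax abn => [/= ->|a ax] abn; first by rewrite tens0l iter_at0.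
case: b b_y abn => [/= ->|b b_y] abn; first by rewrite tens0r iter_at0 ?linear0.
have E1 : iter (a + b.+1) (tensor_f i) (tens (um_f M i x) y) = 0.
  apply: (IH _ _ _ _ _ _ _ (wtspace_f i hx) hy) => //.
  by rewrite -iterSr.
have E2 : iter (a.+1 + b) (tensor_f i) (tens x (um_f N i y)) = 0.
  apply: (IH _ _ _ _ _ _ _ hx (wtspace_f i hy)) => //; last by rewrite -iterSr.
  by move: abn; rewrite addnS ltnS.
by rewrite addSnnS in E2; rewrite addSn iterSr (tens_f i y hx) addrC iter_linear E1 E2 scaler0 addr0.
Qed.

Lemma smodule_nilp (V : lmodType Qq) (g : {linear V -> V}) :
  smodule setT [set x | exists n, iter n g x = 0].
Proof.
split=> [|a x y _ [n hn] [m hm]]; first by exists 0%N.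
by exists (n + m)%N; rewrite iter_linear {1}addnC !iterD hn hm !iter_at0 scaler0 addr0.
Qed.

Lemma tensor_strip i xi : sl2_strip (d i) (tensor_e i) (tensor_f i) (pairing (h i) xi)
  (fun j => tensor_wt (xi + j *: al i)).
Proof.
have [_ [heM hfM]] := hM; have [_ [heN hfN]] := hN.
split=> [j|j a x y|j x|j x|j x|j x|j x].
- by case: (tensor_wt_smodule T (xi + j *: al i)).
- exact: (proj2 (tensor_wt_smodule T _)).
- by move=> /(tensor_wt_e i); rewrite scalerDl scale1r addrA; apply.
- by move=> /(tensor_wt_f i); rewrite scalerBl scale1r addrA; apply.
- by move=> /(tensor_wt_ef i i) ->; rewrite eqxx pairingD pairingZ rd_diag mulrC.
- apply: (tensor_wt_ind (smodule_nilp _)) => {}x y a b hx hy _ /=.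
  by have [p hp] := heM i x; have [q hq] := heN i y; exists (p + q)%N; exact: (tens_e_nilp hx hy).
- apply: (tensor_wt_ind (smodule_nilp _)) => {}x y a b hx hy _ /=.
  by have [p hp] := hfM i x; have [q hq] := hfN i y; exists (p + q)%N; exact: (tens_f_nilp hx hy).
Qed.

Lemma tens_strings i x y a b (m n : nat) : wtspace a x -> wtspace b y ->
  um_e M i x = 0 -> um_e N i y = 0 -> pairing (h i) a = m%:Z -> pairing (h i) b = n%:Z ->
  tensor_strings (d i) (tensor_e i) (tensor_f i) m n
    (fun j k => tens (dpow (qvar ^+ d i) (um_f M i) j x) (dpow (qvar ^+ d i) (um_f N i) k y)).
Proof.
move=> hx hy ex ey am bn.
have wx j := wtspace_dpow hM i j hx; have wy k := wtspace_dpow hN i k hy.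
have px j : pairing (h i) (a - j%:Z *: al i) = m%:Z - 2 * j%:Z.
  by rewrite -scaleNr pairingD pairingZ rd_diag am; lia.
have py k : pairing (h i) (b - k%:Z *: al i) = n%:Z - 2 * k%:Z.
  by rewrite -scaleNr pairingD pairingZ rd_diag bn; lia.
have ex' j : um_e M i (dpow (qvar ^+ d i) (um_f M i) j.+1 x)
    = qbr (qvar ^+ d i) (m%:Z - j%:Z) *: dpow (qvar ^+ d i) (um_f M i) j x.
  have := e_divf (rd_d_gt0 D i) (module_strip hM i a) (j := 0) j.
  by rewrite scale0r mulr0 !addr0 am; apply.
have ey' k : um_e N i (dpow (qvar ^+ d i) (um_f N i) k.+1 y)
    = qbr (qvar ^+ d i) (n%:Z - k%:Z) *: dpow (qvar ^+ d i) (um_f N i) k y.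
  have := e_divf (rd_d_gt0 D i) (module_strip hN i b) (j := 0) k.
  by rewrite scale0r mulr0 !addr0 bn; apply.
split=> [j k|j k|j k|j k].
- move=> /orP[mj|nk]; first by rewrite (dpow_out hM hx ex am mj) tens0l.
  by rewrite (dpow_out hN hy ey bn nk) tens0r.
- rewrite (tens_e i _ (wy k)) py opprB; congr (_ + _).
    case: j => [|j]; first by rewrite divpow0 ex tens0l scaler0.
    by rewrite ex' tensZl scalerA.
  case: k => [|k]; first by rewrite divpow0 ey tens0r.
  by rewrite ey' tensZr.
- rewrite (tens_f i _ (wx j)) px !op_divpow ?rd_d_gt0 // tensZl tensZr scalerA.
  have -> : j%:Z + 1 = j.+1%:Z by lia.
  by have -> : k%:Z + 1 = k.+1%:Z by lia.
- rewrite (tensor_wt_ef i i (tens_wt T (wx j) (wy k))) eqxx pairingD px py.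
  by congr (qbr _ _ *: _); lia.
Qed.

End TensorStrips.

Section TensorLattice.
Variables (I : finType) (D : root_datum I) (mu nu : weight D).
Variables (Vm : hw_crystal mu) (Vn : hw_crystal nu) (T : tensor_product Vm Vn).

Local Notation h i := (rd_coroot D i).
Local Notation al i := (rd_root D i).
Local Notation d i := (rd_d D i).
Local Notation Lm := (@hwL I D mu Vm).
Local Notation Ln := (@hwL I D nu Vn).
Local Notation tens := (@tens I D Vm Vn T).
Local Notation tensor_wt := (@tensor_wt I D Vm Vn T).
Local Notation dpm i := (dpow (qvar ^+ d i) (um_f Vm i)).
Local Notation dpn i := (dpow (qvar ^+ d i) (um_f Vn i)).
Let hM := hw_integrable Vm.
Let hN := hw_integrable Vn.

Definition tensor_lattice (xi : weight D) : set T :=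
  lspan regular0 [set u | exists x y a b,
    [/\ wtspace a x /\ Lm x, wtspace b y /\ Ln y, a + b = xi & u = tens x y]].
Local Notation TL := tensor_lattice.

Lemma TL_smodule xi : smodule regular0 (TL xi).
Proof. exact: lspan_lattice. Qed.

Lemma qTL_smodule xi : smodule regular0 (qlat (TL xi)).
Proof. exact: qlat_smodule (TL_smodule xi). Qed.

Lemma tens_TL x y a b : wtspace a x -> Lm x -> wtspace b y -> Ln y -> TL (a + b) (tens x y).
Proof. by move=> hx Lx hy Ly; apply: (mem_lspan regular0_1); exists x, y, a, b. Qed.

Definition tensor_estring i xi (u w : T) : Prop :=
  estring (d i) (tensor_e T i) (tensor_f T i) (pairing (h i) xi)
    (fun j => tensor_wt (xi + j *: al i)) u w.

Definition tensor_fstring i xi (u w : T) : Prop :=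
  fstring (d i) (tensor_e T i) (tensor_f T i) (pairing (h i) xi)
    (fun j => tensor_wt (xi + j *: al i)) u w.

Lemma tensor_estring_lin i xi a u u' w w' : tensor_estring i xi u w ->
  tensor_estring i xi u' w' -> tensor_estring i xi (a *: u + u') (a *: w + w').
Proof. exact: (estring_lin (tensor_strip T hM hN i xi)). Qed.

Lemma tensor_fstring_lin i xi a u u' w w' : tensor_fstring i xi u w ->
  tensor_fstring i xi u' w' -> tensor_fstring i xi (a *: u + u') (a *: w + w').
Proof. exact: (fstring_lin (tensor_strip T hM hN i xi)). Qed.

Lemma tensor_estring_uniq i xi u w w' :
  tensor_estring i xi u w -> tensor_estring i xi u w' -> w = w'.
Proof. exact: (estring_uniq (rd_d_gt0 D i) (tensor_strip T hM hN i xi)). Qed.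

Lemma tensor_fstring_uniq i xi u w w' :
  tensor_fstring i xi u w -> tensor_fstring i xi u w' -> w = w'.
Proof. exact: (fstring_uniq (rd_d_gt0 D i) (tensor_strip T hM hN i xi)). Qed.

Lemma tensor_estring0 i xi : tensor_estring i xi 0 0.
Proof. by apply: estring00; exact: (strip0 (tensor_strip T hM hN i xi)). Qed.

Lemma tensor_fstring0 i xi : tensor_fstring i xi 0 0.
Proof. by apply: fstring00; exact: (strip0 (tensor_strip T hM hN i xi)). Qed.

Section HighestPair.
Variables (i : I) (x : Vm) (y : Vn) (a b : weight D) (m n : nat).
Hypotheses (hx : wtspace a x) (hy : wtspace b y) (Lx : Lm x) (Ly : Ln y).
Hypotheses (ex : um_e Vm i x = 0) (ey : um_e Vn i y = 0).
Hypotheses (am : pairing (h i) a = m%:Z) (bn : pairing (h i) b = n%:Z).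

Let E j k := tens (dpm i j x) (dpn i k y).
Let hE : tensor_strings (d i) (tensor_e T i) (tensor_f T i) m n E :=
  tens_strings T hM hN hx hy ex ey am bn.
Let xi t := a + b - t *: al i.

Let E_wt j k (t : int) : (j + k)%N%:Z = t ->
  xi t = (a - j%:Z *: al i) + (b - k%:Z *: al i).
Proof. by move=> <-; rewrite /xi PoszD scalerDl opprD addrACA. Qed.

Let E_TL t u : lspan regular0 (ts_set E t) u -> TL (xi t) u.
Proof.
apply: lspan_ind; first exact: TL_smodule.
move=> _ [j [k [jk ->]]]; rewrite (E_wt jk); apply: tens_TL.
- exact: wtspace_dpow.
- exact: (dpow_hwL j hx ex Lx).
- exact: wtspace_dpow.
- exact: (dpow_hwL k hy ey Ly).
Qed.

Let E_span t u : lspan setT (ts_set E t) u -> tensor_wt (xi t) u.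
Proof.
apply: lspan_ind; first exact: tensor_wt_smodule.
move=> _ [j [k [jk ->]]]; rewrite (E_wt jk).
by apply: tens_wt; exact: wtspace_dpow.
Qed.

Let xi_shift t s : xi (t - s) = xi t + s *: al i.
Proof. by rewrite /xi scalerBl opprB addrCA addrC. Qed.

Let xi_pairing t : m%:Z + n%:Z - 2 * t = pairing (h i) (xi t).
Proof. by rewrite /xi -scaleNr !pairingD pairingZ rd_diag am bn; ring. Qed.

Let E_estring t u w : estring (d i) (tensor_e T i) (tensor_f T i) (m%:Z + n%:Z - 2 * t)
    (fun j => lspan setT (ts_set E (t - j))) u w -> tensor_estring i (xi t) u w.
Proof. by apply: estring_sub => // j z /E_span; rewrite xi_shift. Qed.

Let E_fstring t u w : fstring (d i) (tensor_e T i) (tensor_f T i) (m%:Z + n%:Z - 2 * t)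
    (fun j => lspan setT (ts_set E (t - j))) u w -> tensor_fstring i (xi t) u w.
Proof. by apply: fstring_sub => // j z /E_span; rewrite xi_shift. Qed.

Let E_mem j k : lspan regular0 (ts_set E (j + k)%N%:Z) (E j k).
Proof. by apply: (mem_lspan regular0_1); exists j, k. Qed.

Lemma highest_pair_estring j k : let eta := (a - j%:Z *: al i) + (b - k%:Z *: al i) in
  exists w, tensor_estring i eta (tens (dpm i j x) (dpn i k y)) w /\ TL (eta + al i) w.
Proof.
rewrite /= -(E_wt (erefl (j + k)%N%:Z)).
have [w [hw Lw]] := ts_estring (rd_d_gt0 D i) hE (E_mem j k).
by exists w; split; [exact: E_estring | rewrite -[al i]scale1r -xi_shift; exact: E_TL].
Qed.

Lemma highest_pair_fstring j k : let eta := (a - j%:Z *: al i) + (b - k%:Z *: al i) in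
  exists w, tensor_fstring i eta (tens (dpm i j x) (dpn i k y)) w /\ TL (eta - al i) w.
Proof.
rewrite /= -(E_wt (erefl (j + k)%N%:Z)).
have [w [hw Lw]] := ts_fstring (rd_d_gt0 D i) hE (E_mem j k).
exists w; split; first exact: E_fstring.
by rewrite -scaleN1r -xi_shift opprK; exact: E_TL.
Qed.

Lemma highest_pair_estring_lead j k : (j + k <= m)%N -> (k <= n)%N ->
  let eta := (a - j%:Z *: al i) + (b - k%:Z *: al i) in
  exists2 z, TL (eta + al i) z & tensor_estring i eta (tens (dpm i j x) (dpn i k y))
    ((if j is j'.+1 then tens (dpm i j' x) (dpn i k y) else 0) + qvar *: z).
Proof.
move=> jkm kn; rewrite /= -(E_wt (erefl (j + k)%N%:Z)).
have [z Lz hz] := ts_estring_lead (rd_d_gt0 D i) hE jkm kn.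
by exists z; [rewrite -[al i]scale1r -xi_shift; exact: E_TL | exact: E_estring].
Qed.

Lemma highest_pair_fstring_lead j k : (j + k < m)%N -> (k <= n)%N ->
  let eta := (a - j%:Z *: al i) + (b - k%:Z *: al i) in
  exists2 z, TL (eta - al i) z & tensor_fstring i eta (tens (dpm i j x) (dpn i k y))
    (tens (dpm i j.+1 x) (dpn i k y) + qvar *: z).
Proof.
move=> jkm kn; rewrite /= -(E_wt (erefl (j + k)%N%:Z)).
have [z Lz hz] := ts_fstring_lead (rd_d_gt0 D i) hE jkm kn.
exists z; last exact: E_fstring.
by rewrite -scaleN1r -xi_shift opprK; exact: E_TL.
Qed.

End HighestPair.

Lemma tens_suml N (F : 'I_N -> Vm) y : tens (\sum_j F j) y = \sum_j tens (F j) y.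
Proof. by apply: (big_morph (fun x => tens x y)) => [x x'|]; [exact: tensDl | exact: tens0l]. Qed.

Lemma tens_sumr N x (F : 'I_N -> Vn) : tens x (\sum_j F j) = \sum_j tens x (F j).
Proof. by apply: (big_morph (tens x)) => [y y'|]; [exact: tensDr | exact: tens0r]. Qed.

(** String components of lattice vectors lie in the lattice. So for each i the tensor lattice is
    generated by products of members of two i-strings, where the model of two strings applies. *)
Lemma TL_string_ind i xi (P : set T) : smodule regular0 P ->
  (forall x y a b (m n j k : nat),
     wtspace a x -> wtspace b y -> Lm x -> Ln y -> um_e Vm i x = 0 -> um_e Vn i y = 0 ->
     pairing (h i) a = m%:Z -> pairing (h i) b = n%:Z -> (j <= m)%N -> (k <= n)%N ->
     (a - j%:Z *: al i) + (b - k%:Z *: al i) = xi -> P (tens (dpm i j x) (dpn i k y))) ->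
  TL xi `<=` P.
Proof.
move=> hP hgen; apply: lspan_ind => // _ [x [y [a [b [[hx Lx] [hy Ly] abxi ->]]]]].
have hx0 : wtspace (a + 0 *: al i) x by rewrite scale0r addr0.
have hy0 : wtspace (b + 0 *: al i) y by rewrite scale0r addr0.
have [J [X hX]] := hstring_ex (rd_d_gt0 D i) (module_strip hM i a) hx0.
have [K [Y hY]] := hstring_ex (rd_d_gt0 D i) (module_strip hN i b) hy0.
have LX := hstring_hwL Lx hX; have LY := hstring_hwL Ly hY.
rewrite hX.2 hY.2 tens_suml; apply: (smodule_sum _ regular0_1 hP) => j _.
rewrite tens_sumr; apply: (smodule_sum _ regular0_1 hP) => k _.
have [X1 X2 X3] := hX.1 j; have [Y1 Y2 Y3] := hY.1 k.
case: (eqVneq (X j) 0) => [->|Xj]; first by rewrite divpow_at0 tens0l; case: hP.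
case: (eqVneq (Y k) 0) => [->|Yk]; first by rewrite divpow_at0 tens0r; case: hP.
have [m mE _] := module_highest hM X1 X2 Xj; have [n nE _] := module_highest hN Y1 Y2 Yk.
have [c1 _] := X3 Xj; have [c2 _] := Y3 Yk.
apply: (hgen _ _ _ _ m n j k X1 Y1 (LX j) (LY k) X2 Y2 mE nE).
- by move: mE c1; rewrite pairingD pairingZ rd_diag; lia.
- by move: nE c2; rewrite pairingD pairingZ rd_diag; lia.
- by rewrite !addrK.
Qed.

Lemma TL_estring i xi u : TL xi u -> exists w, tensor_estring i xi u w /\ TL (xi + al i) w.
Proof.
apply: (TL_string_ind (i := i) (P := [set u | exists w, _ /\ TL (xi + al i) w])).
  split=> [|r u' u'' rr [w [hw Lw]] [w' [hw' Lw']]] /=.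
    by exists 0; split; [exact: tensor_estring0 | case: (TL_smodule (xi + al i))].
  by exists (r *: w + w'); split; [exact: tensor_estring_lin | apply: (proj2 (TL_smodule _))].
move=> x y a b m n j k hx hy Lx Ly ex ey am bn _ _ <- /=.
exact: (highest_pair_estring hx hy Lx Ly ex ey am bn).
Qed.

Lemma TL_fstring i xi u : TL xi u -> exists w, tensor_fstring i xi u w /\ TL (xi - al i) w.
Proof.
apply: (TL_string_ind (i := i) (P := [set u | exists w, _ /\ TL (xi - al i) w])).
  split=> [|r u' u'' rr [w [hw Lw]] [w' [hw' Lw']]] /=.
    by exists 0; split; [exact: tensor_fstring0 | case: (TL_smodule (xi - al i))].
  by exists (r *: w + w'); split; [exact: tensor_fstring_lin | apply: (proj2 (TL_smodule _))].
move=> x y a b m n j k hx hy Lx Ly ex ey am bn _ _ <- /=.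
exact: (highest_pair_fstring hx hy Lx Ly ex ey am bn).
Qed.

Lemma qTL_estring i xi u w : qlat (TL xi) u -> tensor_estring i xi u w ->
  qlat (TL (xi + al i)) w.
Proof.
move=> [z Lz ->] hw; have [w' [hw' Lw']] := TL_estring i Lz; exists w' => //.
have := tensor_estring_lin qvar hw' (tensor_estring0 i xi); rewrite !addr0.
exact: tensor_estring_uniq hw.
Qed.

Lemma qTL_fstring i xi u w : qlat (TL xi) u -> tensor_fstring i xi u w ->
  qlat (TL (xi - al i)) w.
Proof.
move=> [z Lz ->] hw; have [w' [hw' Lw']] := TL_fstring i Lz; exists w' => //.
have := tensor_fstring_lin qvar hw' (tensor_fstring0 i xi); rewrite !addr0.
exact: tensor_fstring_uniq hw.
Qed.

(** When e_i kills the right factor, the condition j + k <= m reduces to j <= m, true of every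
    f_i^(j) in a decomposition of x. So modulo q etilde_i always acts on the left factor. *)
Lemma tens_highest_estring i x y a b (n : nat) : wtspace a x -> Lm x -> wtspace b y -> Ln y ->
  um_e Vn i y = 0 -> pairing (h i) b = n%:Z ->
  exists2 w, tensor_estring i (a + b) (tens x y) w
    & qlat (TL (a + b + al i)) (w - tens (etilde i x) y).
Proof.
move=> hx Lx hy Ly ey bn.
have hx0 : wtspace (a + 0 *: al i) x by rewrite scale0r addr0.
have [J [X hX]] := hstring_ex (rd_d_gt0 D i) (module_strip hM i a) hx0.
have LX := hstring_hwL Lx hX.
have -> : etilde i x = \sum_(j < J) dpm i j (X j.+1).
  by apply: (estring_etilde hM (xi := a)); exists J, X.
have sh : \sum_(j < J) dpm i j (X j.+1) = \sum_(j < J) (if j : nat is j'.+1 then dpm i j' (X j) else 0).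
  case: J hX {LX} => [|J] hX; first by rewrite !big_ord0.
  rewrite big_ord_recr [RHS]big_ord_recl /= add0r.
  have [_ _ h0] := hX.1 J.+1.
  have -> : X J.+1 = 0 by apply/eqP/negPn/negP => /h0 [_]; rewrite ltnn.
  by rewrite divpow_at0 addr0.
rewrite sh {1}hX.2 !tens_suml.
have hq := qTL_smodule (a + b + al i).
elim/big_rec2: _ => [|j w' u _ [w hw qw]].
  by exists 0; [exact: tensor_estring0 | rewrite subr0; case: hq].
have [w1 hw1 qw1] : exists2 w1, tensor_estring i (a + b) (tens (dpm i j (X j)) y) w1
    & qlat (TL (a + b + al i)) (w1 - tens (if j : nat is j'.+1 then dpm i j' (X j) else 0) y).
  case: (eqVneq (X j) 0) => [->|Xj].
    exists 0; first by rewrite divpow_at0 tens0l; exact: tensor_estring0.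
    by case: (nat_of_ord j) => [|j']; rewrite ?divpow_at0 tens0l subr0; case: hq.
  have [X1 X2 X3] := hX.1 j; have [m mE _] := module_highest hM X1 X2 Xj; have [c1 _] := X3 Xj.
  have jm : (j + 0 <= m)%N by move: mE c1; rewrite pairingD pairingZ rd_diag; lia.
  have [z Lz hz] := highest_pair_estring_lead X1 hy (LX j) Ly X2 ey mE bn jm (leq0n n).
  move: hz Lz; rewrite !addrK scale0r subr0 divpow0 => hz Lz; eexists; first exact: hz.
  exists z => //; case: (nat_of_ord j) => [|j'].
    by rewrite tens0l subr0 add0r.
  by rewrite addrAC subrr add0r.
exists (w1 + w); first by rewrite -[tens _ _]scale1r -[w1]scale1r; exact: tensor_estring_lin.
by rewrite opprD addrACA; apply: (smoduleD regular0_1 hq).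
Qed.

End TensorLattice.

(** * Comparison of V(mu + nu) with V(mu) (x) V(nu) *)

Section TensorGraph.
Variables (I : finType) (D : root_datum I) (lam mu nu : weight D).
Hypothesis lamE : lam = mu + nu.
Variables (Vl : hw_crystal lam) (Vm : hw_crystal mu) (Vn : hw_crystal nu).
Variable T : tensor_product Vm Vn.

Local Notation h i := (rd_coroot D i).
Local Notation al i := (rd_root D i).
Local Notation d i := (rd_d D i).
Local Notation Ll := (@hwL I D lam Vl).
Local Notation vl := (hw_vector Vl).
Local Notation vm := (hw_vector Vm).
Local Notation vn := (hw_vector Vn).
Local Notation tens := (@tens I D Vm Vn T).
Local Notation TL := (@tensor_lattice I D mu nu Vm Vn T).
Local Notation tensor_wt := (@tensor_wt I D Vm Vn T).
Let hL := hw_integrable Vl.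
Let hM := hw_integrable Vm.
Let hN := hw_integrable Vn.

Local Notation P := (Vl * T)%type.

Definition pair_e i (p : P) : P := (um_e Vl i p.1, tensor_e T i p.2).
Definition pair_f i (p : P) : P := (um_f Vl i p.1, tensor_f T i p.2).

Lemma pair_e_linear i : linear (pair_e i).
Proof. by move=> a p q; rewrite /pair_e /= !linearP. Qed.
Lemma pair_f_linear i : linear (pair_f i).
Proof. by move=> a p q; rewrite /pair_f /= !linearP. Qed.

HB.instance Definition _ i := GRing.isLinear.Build Qq P P _ (pair_e i) (pair_e_linear i).
HB.instance Definition _ i := GRing.isLinear.Build Qq P P _ (pair_f i) (pair_f_linear i).

Definition fpair (w : seq I) : P := foldr pair_f (vl, tens vm vn) w.

Lemma fpair1 w : (fpair w).1 = fword Vl w.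
Proof. by elim: w => //= i w ->. Qed.

Lemma fpair_wt w : wtspace (lam - rootsum D w) (fpair w).1 /\ tensor_wt (lam - rootsum D w) (fpair w).2.
Proof.
split; first by rewrite fpair1; exact: fword_wt.
elim: w => [|i w IH].
  by rewrite /rootsum big_nil subr0; have := tens_wt T (hw_vector_wt Vm) (hw_vector_wt Vn); rewrite -lamE.
by rewrite rootsum_cons opprD addrCA addrC; exact: tensor_wt_f.
Qed.

(* Spanned over Q(q) by the pairs (f_w v_lam, f_w (v_mu (x) v_nu)) with w of
   length z: the graph of the surjection of the submodule generated by
   v_mu (x) v_nu onto V(lam). *)
Definition graph (z : int) (xi : weight D) : set P :=
  lspan setT [set p | exists w, [/\ (size w)%:Z = z, lam - rootsum D w = xi & p = fpair w]].

Lemma graph_smodule z xi : smodule setT (graph z xi).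
Proof. exact: lspan_span. Qed.

Lemma graph_fpair w : graph (size w)%:Z (lam - rootsum D w) (fpair w).
Proof. by apply: mem_lspan => //; exists w. Qed.

Lemma graph_ind z xi (Q : set P) : smodule setT Q ->
  (forall w, (size w)%:Z = z -> lam - rootsum D w = xi -> Q (fpair w)) -> graph z xi `<=` Q.
Proof. by move=> hQ h'; apply: lspan_ind => // _ [w [h1 h2 ->]]; exact: h'. Qed.

Lemma graph_wt z xi p : graph z xi p -> wtspace xi p.1 /\ tensor_wt xi p.2.
Proof.
apply: (graph_ind (Q := [set p | _ /\ _])) => [|w _ <-]; last exact: fpair_wt.
split=> [|a p1 p2 _ [h1 h2] [h3 h4]] /=.
  by split; [case: (wtspace_smodule Vl xi) | case: (tensor_wt_smodule T xi)].
by split; [apply: (proj2 (wtspace_smodule Vl xi)) | apply: (proj2 (tensor_wt_smodule T xi))].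
Qed.

Lemma graph_f i z xi p : graph z xi p -> graph (z + 1) (xi - al i) (pair_f i p).
Proof.
apply: (graph_ind (smodule_preim (pair_f i) (graph_smodule _ _))) => w <- <- /=.
apply: mem_lspan => //; exists (i :: w); split=> //=; first by lia.
by rewrite rootsum_cons opprD addrCA addrC.
Qed.

Lemma graph_neg z xi p : z < 0 -> graph z xi p -> p = 0.
Proof.
move=> z0; apply: (graph_ind (Q := [set 0])) => [|w wz]; first exact: smodule0.
by have := wz; lia.
Qed.

Lemma pair_comm i j w : pair_e i (fpair (j :: w)) = pair_f j (pair_e i (fpair w))
  + (if i == j then qbr (qvar ^+ d i) (pairing (h i) (lam - rootsum D w)) else 0) *: fpair w.
Proof.
have [h1 h2] := fpair_wt w; have := wtspace_ef i j h1; have := tensor_wt_ef i j h2.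
move=> /(canRL (subrK _)) E2 /(canRL (subrK _)) E1.
rewrite [LHS]surjective_pairing [RHS]surjective_pairing /= E1 E2.
by case: eqP => _; rewrite ?scale0r ![_ + um_f _ _ _]addrC ![_ + tensor_f _ _ _]addrC.
Qed.

Lemma fpair_e i w : graph ((size w)%:Z - 1) (lam - rootsum D w + al i) (pair_e i (fpair w)).
Proof.
elim: w => [|j w IH].
  rewrite /pair_e /= (hw_vector_e Vl) (tens_e i _ (hw_vector_wt Vn)).
  rewrite (hw_vector_e Vm) (hw_vector_e Vn) tens0l tens0r scaler0 addr0.
  by case: (graph_smodule (0%:Z - 1) (lam - rootsum D [::] + al i)).
have hS := graph_smodule ((size (j :: w))%:Z - 1) (lam - rootsum D (j :: w) + al i).
rewrite pair_comm; apply: (smoduleD _ hS) => //.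
  have := graph_f j IH; have -> : (size w)%:Z - 1 + 1 = (size (j :: w))%:Z - 1 by rewrite /=; lia.
  by rewrite rootsum_cons opprD [- al j + _]addrC !addrA [_ + al i - al j]addrAC.
case: (i =P j) => [ij|_]; last by rewrite scale0r; case: hS.
apply: (smoduleZ hS) => //; have := graph_fpair w; rewrite -ij.
have -> : (size w)%:Z = (size (i :: w))%:Z - 1 by rewrite /=; lia.
by rewrite rootsum_cons opprD addrAC addrA addrK.
Qed.

Lemma graph_e i z xi p : graph z xi p -> graph (z - 1) (xi + al i) (pair_e i p).
Proof.
apply: (graph_ind (smodule_preim (pair_e i) (graph_smodule _ _))) => w <- <- /=.
exact: fpair_e.
Qed.

Lemma graph_strip i z xi : sl2_strip (d i) (pair_e i) (pair_f i) (pairing (h i) xi)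
  (fun j => graph (z - j) (xi + j *: al i)).
Proof.
split=> [j|j a x y|j x|j x|j x hx|j x hx|j x hx].
- by case: (graph_smodule (z - j) (xi + j *: al i)).
- exact: (proj2 (graph_smodule _ _)).
- by move=> /(graph_e i); rewrite scalerDl scale1r addrA opprD addrA; apply.
- by move=> /(graph_f i); rewrite scalerBl scale1r addrA opprB addrA addrAC; apply.
- have [h1 h2] := graph_wt hx; have := wtspace_ef i i h1; have := tensor_wt_ef i i h2.
  rewrite eqxx pairingD pairingZ rd_diag mulrC => E2 E1.
  by rewrite [LHS]surjective_pairing [RHS]surjective_pairing /= E1 E2.
- have key n : forall z xi p, graph z xi p -> z < n%:Z -> iter n (pair_e i) p = 0.
    elim: n => [|n IH] z' xi' p hp zn; first exact: (graph_neg zn hp).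
    by rewrite iterSr; apply: (IH _ _ _ (graph_e i hp)); lia.
  by exists (`|z - j|%N.+1); apply: (key _ _ _ _ hx); lia.
- have [h1 h2] := graph_wt hx; have [_ [_ hf]] := hL; have [n1 hn1] := hf i x.1.
  have h2' : tensor_wt (xi + j *: al i + 0 *: al i) x.2 by rewrite scale0r addr0.
  have [n2 hn2] := strip_fnil (tensor_strip T hM hN i (xi + j *: al i)) h2'.
  exists (n1 + n2)%N.
  have -> n : iter n (pair_f i) x = (iter n (um_f Vl i) x.1, iter n (tensor_f T i) x.2).
    by elim: n => [|n IH]; [case: (x) | rewrite !iterS IH].
  have -> : iter (n1 + n2) (um_f Vl i) x.1 = 0 by rewrite addnC iterD hn1 iter_at0.
  by rewrite iterD hn2 iter_at0.
Qed.

Local Notation chi := (tensor_coord T (@hw_coord I D mu Vm) (@hw_coord I D nu Vn)).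

Lemma chi_f i xi u : tensor_wt xi u -> chi (tensor_f T i u) = 0.
Proof.
apply: (tensor_wt_ind (P := [set u | chi (tensor_f T i u) = 0])).
  by split=> [|a x y _ hx hy] /=; [rewrite !linear0 | rewrite !linearP hx hy scaler0 addr0].
move=> x y a b hx hy _ /=; rewrite (tens_f i y hx) linearD linearZ /= !tensor_coordE.
by rewrite /= !hw_coord_f mul0r mulr0 scaler0 addr0.
Qed.

Lemma chi_fpair w : chi (fpair w).2 = (w == [::])%:R.
Proof.
case: w => [|i w]; first by rewrite /= tensor_coordE /= !hw_coord_vector mulr1.
by have [_ h2] := fpair_wt w; exact: (chi_f i h2).
Qed.

Lemma hw_coord_fpair w : hw_coord (fpair w).1 = (w == [::])%:R.
Proof. by case: w => [|i w]; rewrite /= ?hw_coord_vector ?hw_coord_f. Qed.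

(** Both coordinates are 1 on the pair of highest weight vectors and 0 after any f_i. *)
Lemma graph_coord z xi p : graph z xi p -> hw_coord p.1 = chi p.2.
Proof.
apply: (graph_ind (Q := [set p | hw_coord p.1 = chi p.2])) => [|w _ _] /=.
  by split=> [|a x y _ hx hy] /=; [rewrite !linear0 | rewrite !linearP /= hx hy].
by rewrite hw_coord_fpair chi_fpair.
Qed.

Lemma weight_top w : lam - rootsum D w = lam -> w = [::].
Proof.
move=> E; apply: (@rootsum_eq0 _ D); apply/eqP; rewrite -oppr_eq0; apply/eqP.
by apply: (addrI lam); rewrite addr0.
Qed.

Lemma graph_highest z p : graph z lam p -> p = chi p.2 *: (vl, tens vm vn).
Proof.
apply: (graph_ind (Q := [set p | p = chi p.2 *: (vl, tens vm vn)])) => [|w _ wl] /=.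
  split=> [|a x y _ hx hy] /=; first by rewrite linear0 scale0r.
  by rewrite linearP scalerDl -[_ *: chi _]/(_ * chi _) -scalerA -hx -hy.
rewrite (weight_top wl).
by rewrite chi_fpair scale1r.
Qed.

Lemma graph_length z xi p : graph z xi p -> z != 0 -> xi = lam -> p = 0.
Proof.
move=> hp z0 xil; move: hp; rewrite xil.
apply: (graph_ind (Q := [set 0])) => [|w wz wl]; first exact: smodule0.
case/eqP: z0; rewrite -wz.
by rewrite (weight_top wl).
Qed.

(** A string decomposition in the graph projects to one in each component, so a single pair computes
    the operator on both sides. *)
Lemma graph_map i z xi p w :
  estring (d i) (pair_e i) (pair_f i) (pairing (h i) xi)
    (fun j => graph (z - j) (xi + j *: al i)) p w ->
  etilde i p.1 = w.1 /\ tensor_estring i xi p.2 w.2.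
Proof.
move=> hw; split.
  apply: (estring_etilde hL (xi := xi)).
  apply: (estring_map (g := fst) (e' := um_e Vl i) (f' := um_f Vl i) _ _ _ hw) => // j x.
  by move=> /graph_wt [].
apply: (estring_map (g := snd) (e' := tensor_e T i) (f' := tensor_f T i) _ _ _ hw) => // j x.
by move=> /graph_wt [].
Qed.

Lemma graph_fmap i z xi p w :
  fstring (d i) (pair_e i) (pair_f i) (pairing (h i) xi)
    (fun j => graph (z - j) (xi + j *: al i)) p w ->
  ftilde i p.1 = w.1 /\ tensor_fstring i xi p.2 w.2.
Proof.
move=> hw; split.
  apply: (fstring_ftilde hL (xi := xi)).
  apply: (fstring_map (g := fst) (e' := um_e Vl i) (f' := um_f Vl i) _ _ _ hw) => // j x.
  by move=> /graph_wt [].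
apply: (fstring_map (g := snd) (e' := tensor_e T i) (f' := tensor_f T i) _ _ _ hw) => // j x.
by move=> /graph_wt [].
Qed.

Lemma graph_etilde i z xi p : graph z xi p ->
  exists w, graph (z - 1) (xi + al i) (etilde i p.1, w) /\ tensor_estring i xi p.2 w.
Proof.
move=> hp; have S := graph_strip i z xi.
have hp0 : graph (z - 0) (xi + 0 *: al i) p by rewrite subr0 scale0r addr0.
have [w hw] := estring_ex (rd_d_gt0 D i) S hp0; have [E1 E2] := graph_map hw.
exists w.2; split=> //; rewrite E1 -surjective_pairing.
by have := estring_mem (rd_d_gt0 D i) S hw; rewrite scale1r.
Qed.

Lemma graph_ftilde i z xi p : graph z xi p ->
  exists w, graph (z + 1) (xi - al i) (ftilde i p.1, w) /\ tensor_fstring i xi p.2 w.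
Proof.
move=> hp; have S := graph_strip i z xi.
have hp0 : graph (z - 0) (xi + 0 *: al i) p by rewrite subr0 scale0r addr0.
have [w hw] := fstring_ex (rd_d_gt0 D i) S hp0; have [E1 E2] := graph_fmap hw.
exists w.2; split=> //; rewrite E1 -surjective_pairing.
by have := fstring_mem (rd_d_gt0 D i) S hw; rewrite scaleN1r opprK.
Qed.

Lemma chi_regular xi u : TL xi u -> regular0 (chi u).
Proof.
apply: (@lspan_ind _ _ _ [set u | regular0 (chi u)]).
  split=> [|a x y ra rx ry] /=; first by rewrite linear0; exact: regular0_0.
  by rewrite linearP; apply: regular0D => //; exact: regular0M.
move=> _ [x [y [a [b [[_ Lx] [_ Ly] _ ->]]]]] /=.
by rewrite tensor_coordE; apply: regular0M; exact: hw_coord_regular.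
Qed.

(* By induction on the length z: the operators etilde_i preserve the tensor
   product lattice, commute with the surjection, and detect the lattice of V(lam). *)
Lemma graph_lattice z xi p : graph z xi p -> TL xi p.2 -> Ll p.1.
Proof.
case: z => [n|n]; last by move=> /graph_neg -> // _; case: (hwL_lattice Vl).
elim: n xi p => [|n IH] xi p hp Lp.
  (* The only generator of length 0 is the pair of highest weight vectors, so any other weight
     contains only 0. *)
  have xil : p = 0 \/ xi = lam.
    move: hp; apply: (graph_ind (Q := [set p | p = 0 \/ xi = lam])).
      case: (eqVneq xi lam) => [->|nxi]; first by split=> [|a x y]; right.
      split=> [|a x y _ [->|/eqP h1] [->|/eqP h2]] /=; left => //.
      - by rewrite scaler0 addr0.
      - by rewrite h2 in nxi.
      - by rewrite h1 in nxi.
      - by rewrite h1 in nxi.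
    by move=> [|//] _ <-; right; rewrite /rootsum big_nil subr0.
  case: xil => [->|xil]; first by case: (hwL_lattice Vl).
  move: hp; rewrite xil => /graph_highest ->.
  by apply: (smoduleZ (hwL_lattice Vl) (chi_regular Lp)); exact: (fword_tildeL Vl [::]).
case: (eqVneq xi lam) => [xil|/eqP xil].
  by rewrite (graph_length hp) //; case: (hwL_lattice Vl).
have [wp _] := graph_wt hp; apply: (crystal_lattice_detect wp xil) => i.
have [w [hw ew]] := graph_etilde i hp; have [w' [ew' Lw']] := TL_estring i Lp.
apply: (IH (xi + al i) (etilde i p.1, w)).
  by move: hw; have -> : n.+1%:Z - 1 = n%:Z by lia.
by rewrite /= (tensor_estring_uniq ew ew').
Qed.

(** The graph is a space over Q(q), so the pair may be divided by q. This makes the correspondence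
    well defined modulo q. *)
Lemma graph_qlattice z xi p : graph z xi p -> qlat (TL xi) p.2 -> qlat Ll p.1.
Proof.
move=> hp [u Lu pu]; have q0 := qvar_neq0.
exists (qvar^-1 *: p.1); last by rewrite scalerA divff ?scale1r.
have hp' := smoduleZ (graph_smodule z xi) (Logic.I : setT qvar^-1) hp.
apply: (graph_lattice hp'); rewrite /= pu scalerA mulVf ?scale1r //.
Qed.

(* a in V(lam) and t in V(mu) (x) V(nu) have the same image in the crystal of
   the tensor product. *)
Definition same_class (xi : weight D) (a : Vl) (t : T) : Prop :=
  exists z u, [/\ graph z xi (a, u), TL xi u & qlat (TL xi) (u - t)].

Lemma same_class_cong xi a t t' : same_class xi a t -> qlat (TL xi) (t - t') ->
  same_class xi a t'.
Proof.
move=> [z [u [h1 h2 h3]]] ht; exists z, u; split=> //.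
have -> : u - t' = (u - t) + (t - t') by rewrite addrA subrK.
exact: (smoduleD regular0_1 (qTL_smodule T xi)).
Qed.

Lemma same_class_etilde i xi a t w : same_class xi a t -> tensor_estring i xi t w ->
  same_class (xi + al i) (etilde i a) w.
Proof.
move=> [z [u [h1 h2 h3]]] tw; have [u' [hu' eu']] := graph_etilde i h1.
have [w' [ew' Lw']] := TL_estring i h2; have E := tensor_estring_uniq eu' ew'; rewrite E in hu'.
exists (z - 1), w'; split=> //; apply: (qTL_estring h3).
have := tensor_estring_lin (-1) tw ew'; rewrite !scaleN1r.
by rewrite [- t + u]addrC [- w + w']addrC.
Qed.

Lemma same_class_ftilde i xi a t w : same_class xi a t -> tensor_fstring i xi t w ->
  same_class (xi - al i) (ftilde i a) w.
Proof.
move=> [z [u [h1 h2 h3]]] tw; have [u' [hu' eu']] := graph_ftilde i h1.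
have [w' [ew' Lw']] := TL_fstring i h2; have E := tensor_fstring_uniq eu' ew'; rewrite E in hu'.
exists (z + 1), w'; split=> //; apply: (qTL_fstring h3).
have := tensor_fstring_lin (-1) tw ew'; rewrite !scaleN1r.
by rewrite [- t + u]addrC [- w + w']addrC.
Qed.

Lemma same_class_q xi a t : same_class xi a t -> qlat (TL xi) t -> qlat Ll a.
Proof.
move=> [z [u [h1 h2 h3]]] ht; apply: (graph_qlattice h1) => /=.
by rewrite -(subrK t u); apply: (smoduleD regular0_1 (qTL_smodule T xi)).
Qed.

(** The graph preserves the coordinate on the highest weight vectors: it is 1 modulo q on the
    tensor, and would be 0 modulo q for a in q L. *)
Lemma same_class_highest a : same_class lam a (tens vm vn) -> ~ qlat Ll a.
Proof.
move=> [z [u [h1 _ [y Ly uy]]]] [b Lb ab].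
have := graph_coord h1; rewrite /= ab linearZ /= => E.
have := congr1 chi uy; rewrite linearB linearZ /= tensor_coordE /= !hw_coord_vector mulr1 -E.
move=> E2; have E3 : Qq_const 1 = qvar * (hw_coord b - chi y).
  by rewrite mulrBr; apply/eqP; rewrite eq_sym subr_eq addrC -subr_eq /Qq_const tofrac1; apply/eqP.
have R : regular0 (hw_coord b - chi y).
  apply: regular0D; first exact: hw_coord_regular.
  by apply: regular0N; exact: (chi_regular Ly).
by have /eqP := Qq_const_qmul R E3; rewrite oner_eq0.
Qed.

End TensorGraph.

(** * Adapted strings *)

Section Strings.
Variables (I : finType) (D : root_datum I) (lam : weight D) (V : hw_crystal lam).
Local Notation h i := (rd_coroot D i).
Local Notation al i := (rd_root D i).
Local Notation d i := (rd_d D i).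
Local Notation L := (@hwL I D lam V).
Local Notation dp i := (dpow (qvar ^+ d i) (um_f V i)).
Let hM := hw_integrable V.

Lemma qlat_wt xi x : qlat L x -> wtspace xi x ->
  exists z, [/\ L z, wtspace xi z & x = qvar *: z].
Proof.
have q0 := qvar_neq0.
move=> [z Lz ->] wx; exists z; split=> //.
have -> : z = qvar^-1 *: (qvar *: z) by rewrite scalerA mulVf ?scale1r.
exact: (smoduleZ (wtspace_smodule V xi)).
Qed.

Lemma iter_ftilde_wt i k xi x : wtspace xi x ->
  wtspace (xi - k%:Z *: al i) (iter k (@ftilde I D V i) x).
Proof.
move=> hx; elim: k => [|k IH]; first by rewrite scale0r subr0.
have -> : xi - k.+1%:Z *: al i = (xi - k%:Z *: al i) - al i.
  by rewrite intS scalerDl scale1r opprD addrA addrAC.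
exact: wtspace_ftilde.
Qed.

Lemma iter_ftilde_cong i k (x y : V) : qlat L (x - y) ->
  qlat L (iter k (@ftilde I D V i) x - iter k (@ftilde I D V i) y).
Proof. by move=> h; elim: k => //= k; rewrite -ftildeB; exact: ftilde_hwqL. Qed.

Lemma iter_ftilde_dpow i k xi x : wtspace xi x -> um_e V i x = 0 ->
  iter k (@ftilde I D V i) x = dp i k x.
Proof.
move=> hx ex; elim: k => [|k IH]; first by rewrite divpow0.
by rewrite iterS IH (ftilde_dpow hM k hx ex).
Qed.

Lemma iter_etilde_dpow i k xi x : wtspace xi x -> um_e V i x = 0 ->
  k%:Z <= pairing (h i) xi -> iter k (@etilde I D V i) (dp i k x) = x.
Proof.
move=> hx ex; elim: k => [|k IH] hk; first by rewrite divpow0.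
rewrite iterSr (etilde_dpow hM hx ex hk) IH //.
by apply: le_trans hk; rewrite lez_nat.
Qed.

Lemma iter_etilde_hwqL i k x : qlat L x -> qlat L (iter k (@etilde I D V i) x).
Proof. by move=> qx; elim: k => //= k; exact: etilde_hwqL. Qed.

(** x0 is the term [X 0] of the string decomposition; the other terms form ftilde_i (etilde_i x),
    which lies in q L along with etilde_i x. *)
Lemma highest_part i xi x : L x -> wtspace xi x -> qlat L (etilde i x) ->
  exists x0, [/\ L x0, wtspace xi x0, um_e V i x0 = 0 & qlat L (x - x0)].
Proof.
move=> Lx wx hx.
have wx0 : wtspace (xi + 0 *: al i) x by rewrite scale0r addr0.
have [J [X hX]] := hstring_ex (rd_d_gt0 D i) (module_strip hM i xi) wx0.
have LX := hstring_hwL Lx hX.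
have [W0 e0 _] := hX.1 0%N; exists (X 0%N); split=> //.
  by move: W0; rewrite scale0r addr0.
suff -> : x - X 0%N = ftilde i (etilde i x) by exact: ftilde_hwqL.
have -> : etilde i x = \sum_(j < J) dp i j (X j.+1).
  by apply: (estring_etilde hM (xi := xi)); exists J, X.
have ftD : {morph (@ftilde I D V i) : u w / u + w}.
  by move=> u w; rewrite -[u]scale1r ftilde_linear // !scale1r.
have ft0 : ftilde i (0 : V) = 0 by have := ftildeB i (0 : V) 0; rewrite !subrr.
rewrite (big_morph _ ftD ft0).
have -> : \sum_(j < J) ftilde i (dp i j (X j.+1)) = \sum_(j < J) dp i j.+1 (X j.+1).
  by apply: eq_bigr => j _; have [w1 e1 _] := hX.1 j.+1; exact: (ftilde_dpow hM j w1 e1).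
rewrite {1}hX.2; case: J hX => [|J] hX.
  rewrite !big_ord0; have [_ _ h0] := hX.1 0%N.
  by rewrite sub0r; apply/eqP; rewrite oppr_eq0; apply/negPn/negP => /h0 [_]; rewrite ltn0.
rewrite big_ord_recl big_ord_recr /= divpow0.
have [_ _ h0] := hX.1 J.+1.
have -> : X J.+1 = 0 by apply/eqP/negPn/negP => /h0 [_]; rewrite ltnn.
by rewrite divpow_at0 addr0 addrAC subrr add0r.
Qed.

(* l lists the pairs (i_k, a_k). *)
Definition string_vector (l : seq (I * nat)) : V :=
  foldr (fun p x => iter p.2 (@ftilde I D V p.1) x) (hw_vector V) l.

Fixpoint adapted (l : seq (I * nat)) : Prop :=
  if l is p :: l' then qlat L (etilde p.1 (string_vector l')) /\ adapted l' else True.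

Lemma string_vector_word l : exists w, string_vector l = fword_tilde V w.
Proof.
elim: l => [|[i k] l [w IH]]; first by exists [::].
exists (nseq k i ++ w); rewrite /string_vector /= -/(string_vector l) IH.
by elim: k => //= k ->.
Qed.

Lemma string_vector_hwL l : L (string_vector l).
Proof. by have [w ->] := string_vector_word l; exact: fword_tildeL. Qed.

Lemma adapted_split l1 p l2 : adapted (l1 ++ p :: l2) -> qlat L (etilde p.1 (string_vector l2)).
Proof. by elim: l1 => [|p' l1 IH] /= []. Qed.

End Strings.

Section StringWeights.
Variables (I : finType) (D : root_datum I).
Local Notation h i := (rd_coroot D i).
Local Notation al i := (rd_root D i).

Definition string_wt (lam : weight D) (l : seq (I * nat)) : weight D :=
  lam - \sum_(p <- l) p.2%:Z *: al p.1.

Lemma string_wt_cons lam p l : string_wt lam (p :: l) = string_wt lam l - p.2%:Z *: al p.1.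
Proof. by rewrite /string_wt big_cons opprD addrCA addrC. Qed.

Lemma string_wt_pairing lam i l :
  pairing (h i) (string_wt lam l) = pairing (h i) lam - \sum_(p <- l) cartan D i p.1 * p.2%:Z.
Proof.
elim: l => [|p l IH]; first by rewrite /string_wt !big_nil !subr0.
rewrite string_wt_cons -scaleNr pairingD pairingZ IH big_cons /cartan; ring.
Qed.

(** This is the condition t + s <= m of the tensor product rule: t is the exponent of the letter, m
    the weight of the vector it acts on, and c the depth s of the right factor in its own string. *)
Fixpoint fits (c : I -> nat) (lam : weight D) (l : seq (I * nat)) : Prop :=
  if l is p :: l' then
    (p.2 + c p.1)%N%:Z <= pairing (h p.1) (string_wt lam l') /\ fits c lam l'
  else True.

Lemma fits_split c lam l : (forall l1 p l2, l = l1 ++ p :: l2 ->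
  (p.2 + c p.1)%N%:Z <= pairing (h p.1) (string_wt lam l2)) -> fits c lam l.
Proof.
elim: l => //= p l IH H; split; first exact: (H [::]).
by apply: IH => l1 p' l2 E; apply: (H (p :: l1)); rewrite E.
Qed.

Lemma fits_at c lam l1 p l2 : fits c lam (l1 ++ p :: l2) ->
  (p.2 + c p.1)%N%:Z <= pairing (h p.1) (string_wt lam l2).
Proof. by elim: l1 => [|p' l1 IH] /= []. Qed.

Lemma fitsW c lam l : fits c lam l -> fits (fun=> 0%N) lam l.
Proof. by elim: l => //= p l IH [h1 /IH]; split=> //; lia. Qed.

Lemma string_vector_wt lam (V : hw_crystal lam) l : wtspace (string_wt lam l) (string_vector V l).
Proof.
elim: l => [|p l IH]; first by rewrite /string_wt big_nil subr0; exact: hw_vector_wt.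
by rewrite string_wt_cons; exact: iter_ftilde_wt.
Qed.

(** Adaptedness allows the vector before each power to be replaced, modulo q, by one killed by e_i.
    As the exponent k is at most its weight, etilde_i^k undoes ftilde_i^k, so the string vanishes
    modulo q only if its tail does. *)
Lemma adapted_nqL lam (V : hw_crystal lam) l : fits (fun=> 0%N) lam l -> adapted V l ->
  ~ qlat (@hwL I D lam V) (string_vector V l).
Proof.
elim: l => [_ _|[i k] l IH /= [hk hl] [he ha]]; first exact: hw_vector_nqL.
move=> hq; apply: (IH hl ha); move: hk; rewrite addn0 => hk.
have [x0 [Lx0 wx0 ex0 hx0]] := highest_part (string_vector_hwL V l) (string_vector_wt V l) he.
have h1 : qlat (@hwL I D lam V) (iter k (@ftilde I D V i) x0).
  have := qlatD hq (qlatN (iter_ftilde_cong i k hx0)).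
  by rewrite opprB addrCA subrr addr0.
have h2 : qlat (@hwL I D lam V) x0.
  rewrite -(iter_etilde_dpow wx0 ex0 hk) -(iter_ftilde_dpow k wx0 ex0).
  exact: iter_etilde_hwqL.
by have := qlatD hx0 h2; rewrite subrK.
Qed.

End StringWeights.

Section StringComparison.
Variables (I : finType) (D : root_datum I) (lam mu nu : weight D).
Hypothesis lamE : lam = mu + nu.
Variables (Vl : hw_crystal lam) (Vm : hw_crystal mu) (Vn : hw_crystal nu).
Let T := fun_tensor_product Vm Vn.

Local Notation h i := (rd_coroot D i).
Local Notation al i := (rd_root D i).
Local Notation d i := (rd_d D i).
Local Notation Ll := (@hwL I D lam Vl).
Local Notation Lm := (@hwL I D mu Vm).
Local Notation Ln := (@hwL I D nu Vn).
Local Notation vl := (hw_vector Vl).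
Local Notation vm := (hw_vector Vm).
Local Notation vn := (hw_vector Vn).
Local Notation tens := (@tens I D Vm Vn T).
Local Notation TL := (@tensor_lattice I D mu nu Vm Vn T).
Local Notation same_class := (@same_class I D lam mu nu Vl Vm Vn T).
Local Notation dpm i := (dpow (qvar ^+ d i) (um_f Vm i)).
Local Notation dpn i := (dpow (qvar ^+ d i) (um_f Vn i)).
Let hM := hw_integrable Vm.
Let hN := hw_integrable Vn.

Lemma tens_qTL x y a b : qlat Lm x -> wtspace a x -> Ln y -> wtspace b y ->
  qlat (TL (a + b)) (tens x y).
Proof.
move=> qx wx Ly wy; have [z [Lz wz ->]] := qlat_wt qx wx.
by exists (tens z y); [exact: tens_TL | rewrite tensZl].
Qed.

Lemma tens_cong x x' y a b : qlat Lm (x - x') -> wtspace a x -> wtspace a x' ->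
  Ln y -> wtspace b y -> qlat (TL (a + b)) (tens x y - tens x' y).
Proof.
move=> qx wx wx' Ly wy; have -> : tens x y - tens x' y = tens (x - x') y.
  by rewrite tensDl -[in RHS]scaleN1r tensZl scaleN1r.
apply: tens_qTL => //; rewrite -scaleN1r addrC.
exact: (proj2 (wtspace_smodule Vm a)).
Qed.

Section Step.
Variables (i : I) (y : Vn) (a b : weight D) (m n s : nat).
Hypotheses (wy : wtspace b y) (Ly : Ln y).
Hypotheses (ey : um_e Vn i y = 0) (am : pairing (h i) a = m%:Z) (bn : pairing (h i) b = n%:Z).
Hypothesis sn : (s <= n)%N.

Let eta t := (a - t%:Z *: al i) + (b - s%:Z *: al i).

Let etaS t : eta t - al i = eta t.+1.
Proof.
rewrite /eta addrAC; congr (_ + _).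
by rewrite intS scalerDl scale1r opprD addrA [RHS]addrAC.
Qed.

Lemma same_class_highest_string x a' t : wtspace a x -> Lm x -> um_e Vm i x = 0 -> (t + s <= m)%N ->
  same_class (eta 0) a' (tens x (dpn i s y)) ->
  same_class (eta t) (iter t (@ftilde I D Vl i) a') (tens (dpm i t x) (dpn i s y)).
Proof.
move=> wx Lx ex tm h0; elim: t tm => [|t IH] tm; first by rewrite divpow0.
have := highest_pair_fstring_lead T wx wy Lx Ly ex ey am bn tm sn.
move=> /= [z Lz hz].
have := same_class_ftilde lamE (IH (ltnW tm)) hz; rewrite -/(eta t) etaS => hc.
apply: (same_class_cong hc); exists z; last by rewrite addrAC subrr add0r.
by rewrite -etaS.
Qed.

(* Modulo q, x may be replaced by a vector killed by e_i, to which the tensor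
   product rule applies: as t + s <= m, only the left factor moves. *)
Lemma same_class_string x a' t : wtspace a x -> Lm x -> qlat Lm (etilde i x) -> (t + s <= m)%N ->
  same_class (eta 0) a' (tens x (dpn i s y)) ->
  qlat Ll (etilde i a') /\
  same_class (eta t) (iter t (@ftilde I D Vl i) a')
    (tens (iter t (@ftilde I D Vm i) x) (dpn i s y)).
Proof.
move=> wx Lx hx tm hc; have [x0 [Lx0 wx0 ex0 hx0]] := highest_part Lx wx hx.
have wys := wtspace_dpow hN i s wy; have Lys := dpow_hwL s wy ey Ly.
have eta0 : eta 0 = a + (b - s%:Z *: al i) by rewrite /eta scale0r subr0.
have hc0 : same_class (eta 0) a' (tens x0 (dpn i s y)).
  by apply: (same_class_cong hc); rewrite eta0; exact: tens_cong.
split.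
  (* The case j = 0 of the tensor product rule: since s <= m, etilde_i would act on the left factor
     x0, which e_i kills, so it gives 0 modulo q. *)
  have sm : (0 + s <= m)%N by apply: leq_trans tm; rewrite leq_addl.
  have := highest_pair_estring_lead T wx0 wy Lx0 Ly ex0 ey am bn sm sn.
  rewrite /= divpow0 => -[z Lz hz]; apply: (same_class_q lamE (same_class_etilde lamE hc0 hz)).
  by rewrite add0r; exists z.
have hq : qlat (TL (eta t)) (tens (iter t (@ftilde I D Vm i) x0) (dpn i s y)
                        - tens (iter t (@ftilde I D Vm i) x) (dpn i s y)).
  by apply: tens_cong => //; [apply: iter_ftilde_cong; rewrite -opprB; exact: qlatN
                            | exact: iter_ftilde_wt | exact: iter_ftilde_wt].
apply: same_class_cong hq; rewrite (iter_ftilde_dpow t wx0 ex0).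
by apply: same_class_highest_string.
Qed.

End Step.

Lemma string_step p l y b s a' :
  (p.2 + s)%N%:Z <= pairing (h p.1) (string_wt mu l) ->
  s%:Z <= pairing (h p.1) b -> wtspace b y -> Ln y -> um_e Vn p.1 y = 0 ->
  qlat Lm (etilde p.1 (string_vector Vm l)) ->
  same_class (string_wt mu l + (b - s%:Z *: al p.1)) a'
    (tens (string_vector Vm l) (dpn p.1 s y)) ->
  qlat Ll (etilde p.1 a') /\
  same_class (string_wt mu (p :: l) + (b - s%:Z *: al p.1)) (iter p.2 (@ftilde I D Vl p.1) a')
    (tens (string_vector Vm (p :: l)) (dpn p.1 s y)).
Proof.
move=> hm hn wy Ly ey he hc.
have [m am] : exists m : nat, pairing (h p.1) (string_wt mu l) = m%:Z.
  by exists `|pairing (h p.1) (string_wt mu l)|%N; rewrite gez0_abs //; apply: le_trans hm.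
have [n bn] : exists n : nat, pairing (h p.1) b = n%:Z.
  by exists `|pairing (h p.1) b|%N; rewrite gez0_abs //; apply: le_trans hn.
rewrite string_wt_cons; rewrite am lez_nat in hm; rewrite bn lez_nat in hn.
apply: (same_class_string (m := m) (n := n)) => //.
- exact: string_vector_wt.
- exact: string_vector_hwL.
- by rewrite scale0r subr0.
Qed.

Lemma same_class_hw_vector : same_class (mu + nu) vl (tens vm vn).
Proof.
exists 0, (tens vm vn); split; last by rewrite subrr; case: (qTL_smodule T (mu + nu)).
  by rewrite -lamE; have := graph_fpair Vl T [::]; rewrite /rootsum big_nil subr0.
by apply: tens_TL; [exact: hw_vector_wt | exact: (fword_tildeL Vm [::])
  | exact: hw_vector_wt | exact: (fword_tildeL Vn [::])].
Qed.

(* A nonzero crystal element is brought back to the highest weight element by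
   the operators etilde, so its class in the tensor product cannot vanish. *)
Lemma same_class_nqL w c y a : dominant nu -> wtspace c y -> Lm y ->
  qlat Lm (y - fword_tilde Vm w) -> ~ qlat Lm (fword_tilde Vm w) ->
  same_class (c + nu) a (tens y vn) -> ~ qlat Ll a.
Proof.
move=> nu0; elim: w c y a => [|i w IH] c y a wy Ly hy nz hc qa.
  (* In another weight the coordinate of y would be 0, while y - v_mu in q L makes it 1 modulo q. *)
  have cmu : c = mu.
    apply/eqP/negPn/negP => /eqP /(hw_coord_wt wy) y0.
    have [b Lb E] := hy; have := congr1 (@hw_coord I D mu Vm) E.
    rewrite /= linearB /= y0 hw_coord_vector linearZ /= => E2.
    have E3 : Qq_const (-1) = qvar * hw_coord b by rewrite -[qvar * _]E2 /Qq_const polyCN tofracN tofrac1 sub0r.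
    by have /eqP := Qq_const_qmul (hw_coord_regular Lb) E3; rewrite oppr_eq0 oner_eq0.
  subst c; have hq : qlat (TL (mu + nu)) (tens y vn - tens vm vn).
    by apply: tens_cong => //; [exact: hw_vector_wt | exact: (fword_tildeL Vn [::]) | exact: hw_vector_wt].
  have := same_class_cong hc hq; rewrite -lamE => /(same_class_highest lamE); exact.
have [n bn] : exists n : nat, pairing (h i) nu = n%:Z.
  by exists `|pairing (h i) nu|%N; rewrite gez0_abs //; exact: (forallP nu0 i).
have [w' hw' qw'] := tens_highest_estring T wy Ly (hw_vector_wt Vn) (fword_tildeL Vn [::]) (hw_vector_e Vn i) bn.
have := same_class_cong (same_class_etilde lamE hc hw') qw'.
rewrite addrAC => hc'; apply: (IH _ _ _ _ _ _ _ hc').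
- exact: (wtspace_etilde hM).
- exact: etilde_hwL.
- have := qlatD (etilde_hwqL i hy) (fword_tilde_etilde nz).
  by rewrite etildeB addrA subrK.
- by move=> h0; apply: nz; exact: ftilde_hwqL.
- exact: etilde_hwqL.
Qed.

(** Along the word, the vector in V(lam) corresponds to the one in V(mu) tensored with v_nu. If
    etilde_i of the latter were nonzero modulo q it would be a crystal element of V(mu), and by
    [same_class_nqL] its counterpart in V(lam) would be nonzero too, against adaptedness there. *)
Lemma adapted_tensor_left l : dominant nu -> fits (fun=> 0%N) mu l -> adapted Vl l ->
  adapted Vm l.
Proof.
move=> nu0 hf ha; suff [] : adapted Vm l /\
  same_class (string_wt mu l + nu) (string_vector Vl l) (tens (string_vector Vm l) vn) by [].
elim: l hf ha => [_ _|p l IH [hp hf] [hq ha]].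
  split=> //; rewrite /string_wt big_nil subr0; exact: same_class_hw_vector.
have [am hc] := IH hf ha.
have hx : qlat Lm (etilde p.1 (string_vector Vm l)).
  apply: contrapT => nz; have Lx := string_vector_hwL Vm l.
  have [w0 ew0] := string_vector_word Vm l.
  have hB : hwB (lat_coset Lm (string_vector Vm l)).
    by apply/hwB_coset; exists w0; rewrite ew0; split=> // h0; apply: nz; rewrite ew0; exact: etilde_hwqL.
  have := hwB_etilde Lx hB nz => /hwB_coset [w [/lat_coset_eq hw nzw]].
  have [n bn] : exists n : nat, pairing (h p.1) nu = n%:Z.
    by exists `|pairing (h p.1) nu|%N; rewrite gez0_abs //; exact: (forallP nu0 p.1).
  have [w' hw' qw'] := tens_highest_estring T (string_vector_wt Vm l) Lx (hw_vector_wt Vn)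
    (fword_tildeL Vn [::]) (hw_vector_e Vn p.1) bn.
  have := same_class_cong (same_class_etilde lamE hc hw') qw'; rewrite addrAC => hc'.
  apply: (same_class_nqL nu0 _ _ hw nzw hc') => //.
  - by apply: (wtspace_etilde hM); exact: (string_vector_wt Vm l).
  - exact: etilde_hwL.
have hn : 0%:Z <= pairing (h p.1) nu := forallP nu0 p.1.
have hc0 : same_class (string_wt mu l + (nu - 0%:Z *: al p.1)) (string_vector Vl l)
    (tens (string_vector Vm l) (dpn p.1 0 vn)) by rewrite scale0r subr0 divpow0.
have [_ ] := string_step hp hn (hw_vector_wt Vn) (fword_tildeL Vn [::]) (hw_vector_e Vn p.1) hx hc0.
by rewrite scale0r subr0 divpow0.
Qed.

Section Right.
Variables (i : I) (n0 : nat).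
Hypotheses (mui : pairing (h i) mu = 0) (nun : n0%:Z <= pairing (h i) nu).

Let f_vm : um_f Vm i vm = 0.
Proof.
have [m mE] := module_highest hM (hw_vector_wt Vm) (hw_vector_e Vm i) (hw_vector_neq0 Vm).
have -> : m = 0%N by move: mE; rewrite mui => -[].
by move=> /eqP; rewrite (divpow_eq0 (rd_d_gt0 D i)) => /eqP.
Qed.

Let tensor_f_vm y : tensor_f T i (tens vm y) = tens vm (um_f Vn i y).
Proof. by rewrite (tens_f i y (hw_vector_wt Vm)) f_vm tens0l mui add0r expr0z scale1r. Qed.

Let dpow_vm k y : dpow (qvar ^+ d i) (tensor_f T i) k (tens vm y) = tens vm (dpn i k y).
Proof.
elim: k => [|k IH]; first by rewrite !divpow0.
by rewrite !divpowS IH tensor_f_vm tensZr.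
Qed.

(** As f_i kills v_mu and <h_i, mu> = 0, the i-string of v_mu (x) v_nu consists exactly of the v_mu
    (x) f_i^(k) v_nu, with no correction in q. *)
Lemma same_class_right k : (k <= n0)%N ->
  same_class (mu + (nu - k%:Z *: al i)) (iter k (@ftilde I D Vl i) vl) (tens vm (dpn i k vn)).
Proof.
elim: k => [|k IH] kn.
  by rewrite scale0r subr0 divpow0; exact: same_class_hw_vector.
have -> : mu + (nu - k.+1%:Z *: al i) = mu + (nu - k%:Z *: al i) - al i.
  by rewrite -!addrA intS scalerDl scale1r opprD [- al i - _]addrC.
apply: (same_class_ftilde lamE (IH (ltnW kn))); rewrite -!dpow_vm.
apply: (fstring_divf (tensor_strip T hM hN i (mu + (nu - k%:Z *: al i)))).
- by rewrite addrA subrK; apply: tens_wt; exact: hw_vector_wt.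
- rewrite (tens_e i _ (hw_vector_wt Vn)) (hw_vector_e Vm) (hw_vector_e Vn) tens0l tens0r.
  by rewrite scaler0 addr0.
- move=> _; rewrite -scaleNr !pairingD pairingZ rd_diag mui; move: nun kn; lia.
Qed.

Let e_dpow j k : j != i -> um_e Vn j (dpn i k vn) = 0.
Proof.
move=> ji; elim: k => [|k IH]; first by rewrite divpow0 (hw_vector_e Vn).
rewrite divpowS linearZ; have := wtspace_ef j i (wtspace_dpow hN i k (hw_vector_wt Vn)).
by rewrite (negbTE ji) IH linear0 subr0 => ->; rewrite /= scaler0.
Qed.

(** [string_step] wants the right factor f_i^(n0) v_nu in the form f_j^(s) y with e_j y = 0. For j =
    i take s = n0 and y = v_nu, which uses the spare room; for j other than i take s = 0 and y =
    f_i^(n0) v_nu, killed by e_j because e_j commutes with f_i. *)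
Lemma adapted_tensor_right l : dominant nu -> adapted Vm l ->
  fits (fun j => if j == i then n0 else 0%N) mu l -> adapted Vl (rcons l (i, n0)).
Proof.
move=> nu0 ha hf; suff [] : adapted Vl (rcons l (i, n0)) /\
  same_class (string_wt mu l + (nu - n0%:Z *: al i)) (string_vector Vl (rcons l (i, n0)))
    (tens (string_vector Vm l) (dpn i n0 vn)) by [].
elim: l ha hf => [_ _|p l IH [hp ha] [hq hf]].
  split; last by rewrite /string_wt big_nil subr0; exact: same_class_right.
  split=> //=; have := etilde_dpow (hw_integrable Vl) (hw_vector_wt Vl) (hw_vector_e Vl i) (k := 0).
  rewrite divpow0 => ->; first by case: (hwqL Vl).
  by rewrite lamE pairingD mui add0r; exact: (forallP nu0 i).
have [hal hc] := IH ha hf; have Lvn := fword_tildeL Vn [::].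
case: p hq hp => [j k] /= hq hp; case: (eqVneq j i) hq hp => [->|ji] hq hp.
  have [h1 h2] := @string_step (i, k) l vn nu n0 _ hq nun (hw_vector_wt Vn) Lvn
    (hw_vector_e Vn i) hp hc.
  by split.
have wy := wtspace_dpow hN i n0 (hw_vector_wt Vn).
have Ly := dpow_hwL n0 (hw_vector_wt Vn) (hw_vector_e Vn i) Lvn.
have hn : 0%:Z <= pairing (h j) (nu - n0%:Z *: al i).
  rewrite -scaleNr pairingD pairingZ.
  have := rd_offdiag D ji; have := forallP nu0 j; nia.
have := @string_step (j, k) l (dpn i n0 vn) (nu - n0%:Z *: al i) 0 _ hq hn wy Ly
  (e_dpow n0 ji) hp.
by rewrite /= scale0r subr0 divpow0 => /(_ _ hc) [].
Qed.

End Right.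

End StringComparison.

(** * Induction on the word for the tight cone *)

Section Tight.
Variables (I : finType) (D : root_datum I).
Local Notation h i := (rd_coroot D i).
Local Notation al i := (rd_root D i).

Definition tight_word (l : seq (I * nat)) : Prop :=
  forall l1 p l2 p' l3, l = l1 ++ p :: l2 ++ p' :: l3 -> p.1 = p'.1 ->
  p.2%:Z + p'.2%:Z + \sum_(t <- l2) cartan D p.1 t.1 * t.2%:Z <= 0.

Lemma tight_word_rcons l p : tight_word (rcons l p) -> tight_word l.
Proof.
move=> H l1 t l2 t' l3 E; apply: (H l1 t l2 t' (rcons l3 p)).
by rewrite E rcons_cat /= rcons_cat.
Qed.

Definition rho : weight D := \sum_j rd_fweight D j.

Lemma pairing_rho i : pairing (h i) rho = 1.
Proof.
rewrite /rho (big_morph (pairing (h i)) (pairingD (h i)) (_ : pairing (h i) 0 = 0)); last first.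
  by rewrite -(scale0r 0) pairingZ mul0r.
rewrite (bigD1 i) //= rd_fweightP eqxx big1 ?addr0 // => j ji.
by rewrite rd_fweightP eq_sym (negbTE ji).
Qed.

Lemma string_wt_rcons (lam : weight D) l p : string_wt lam (rcons l p) = string_wt lam l - p.2%:Z *: al p.1.
Proof. by rewrite /string_wt -cats1 big_cat big_seq1 /= opprD addrA. Qed.

Variable V : forall lam : dominant_weight D, hw_crystal (sval lam).

Lemma tight_adapted l : tight_word l -> forall lam : dominant_weight D,
  fits (fun=> 0%N) (sval lam) l -> adapted (V lam) l.
Proof.
elim/last_ind: l => // l [i n0] IH htl [lam dl] /= hf.
have tl := tight_word_rcons htl.
(* Large enough for the letters other than i to fit mu below. *)
pose N : int := n0%:Z * \sum_j `|cartan D j i|.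
have N0 : 0 <= N by rewrite mulr_ge0 // sumr_ge0.
have NE j : - (n0%:Z * cartan D j i) <= N.
  rewrite -mulrN ler_wpM2l // (bigD1 j) //= -normrN.
  by apply: le_trans (ler_norm _) _; rewrite lerDl sumr_ge0.
pose lam' := lam + N *: rho.
have lamj j : pairing (h j) lam' = pairing (h j) lam + N by rewrite pairingD pairingZ pairing_rho mulr1.
pose nu := pairing (h i) lam' *: rd_fweight D i.
have nuj j : pairing (h j) nu = pairing (h i) lam' * (j == i)%:R by rewrite pairingZ rd_fweightP.
pose mu := lam' - nu.
have lamE : lam' = mu + nu by rewrite subrK.
have muj j : pairing (h j) mu = pairing (h j) lam' * (j != i)%:R.
  rewrite /mu -scaleN1r pairingD pairingZ nuj; case: eqP => [->|_] /=; ring.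
have dl' : dominant lam'.
  by apply/forallP => j; rewrite lamj addr_ge0 //; exact: (forallP dl j).
have dnu : dominant nu.
  by apply/forallP => j; rewrite nuj mulr_ge0 // ?(forallP dl' i) //; case: eqP.
have dmu : dominant mu.
  by apply/forallP => j; rewrite muj mulr_ge0 // ?(forallP dl' j) //; case: eqP.
have dN : dominant (N *: rho) by apply/forallP => j; rewrite pairingZ pairing_rho mulr1.
have nn0 : n0%:Z <= pairing (h i) nu.
  rewrite nuj eqxx mulr1 lamj.
  have := @fits_at I D _ _ l (i, n0) [::]; rewrite cats1 => /(_ _ _ hf).
  rewrite /string_wt big_nil subr0 /=; lia.
have hc : fits (fun j => if j == i then n0 else 0%N) mu l.
  apply: fits_split => l1 [j k] l2 E /=; rewrite string_wt_pairing muj.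
  case: (eqVneq j i) => [ji|ji] /=.
    rewrite mulr0 sub0r.
    have := htl l1 (j, k) l2 (i, n0) [::]; rewrite E -cats1 -catA /= => /(_ erefl ji).
    rewrite ji; lia.
  (* Fitting of lam at this position counts the last letter, which adds - n0 <h_j, alpha_i> to the
     weight; for mu this is replaced by N. *)
  rewrite mulr1 lamj addn0.
  have := @fits_at I D (fun=> 0%N) lam l1 (j, k) (rcons l2 (i, n0)); rewrite -rcons_cons -rcons_cat -E.
  move=> /(_ hf) /=; rewrite addn0 string_wt_rcons -scaleNr pairingD pairingZ string_wt_pairing /=.
  by move: (NE j); rewrite /cartan; lia.
have hmu := IH tl (exist _ mu dmu) (fitsW hc).
have := adapted_tensor_right lamE (V (exist _ lam' dl')) (V (exist _ nu dnu)) _ nn0 dnu hmu hc.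
move=> /(_ _); rewrite muj eqxx mulr0 => /(_ erefl) hl'.
exact: (@adapted_tensor_left I D lam' lam (N *: rho) erefl (V (exist _ lam' dl')) (V (exist _ lam dl))
  (V (exist _ (N *: rho) dN)) (rcons l (i, n0)) dN hf hl').
Qed.

(** Since rho pairs to 1 with every coroot, each letter asks only that N be at least its exponent
    plus a sum fixed by the tail. *)
Lemma fits_rho l : exists N0 : int, forall N, N0 <= N -> fits (fun=> 0%N) (N *: rho) l.
Proof.
elim: l => [|p l [N0 IH]]; first by exists 0.
pose S := \sum_(t <- l) cartan D p.1 t.1 * t.2%:Z.
exists (Num.max N0 (p.2%:Z + S)) => N; rewrite ge_max => /andP[h1 h2] /=.
split; last exact: IH.
by rewrite string_wt_pairing -/S pairingZ pairing_rho; lia.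
Qed.

End Tight.

Section Words.
Variables (I : finType) (D : root_datum I) (r : nat) (w : r.-tuple I) (a : r.-tuple nat).

Definition tuple_word (s : seq 'I_r) : seq (I * nat) := [seq (tnth w j, tnth a j) | j <- s].

Lemma string_tail_coset (lam : weight D) (V : hw_crystal lam) k :
  @string_tail I D lam V r w a k
  = lat_coset (@hwL I D lam V) (string_vector V (tuple_word (drop k (enum 'I_r)))).
Proof.
rewrite /string_tail; elim: (drop k (enum 'I_r)) => //= j s ->.
by elim: (tnth a j) => //= n ->; rewrite cr_f_coset.
Qed.

Lemma tight_cone_word : tight_cone D w a -> tight_word D (tuple_word (enum 'I_r)).
Proof.
move=> H l1 p l2 p' l3 E pp'; pose l := tuple_word (enum 'I_r).
have sl : (size l1 + (size l2 + size l3).+2)%N = r.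
  have := congr1 size E; rewrite size_map size_enum_ord size_cat /= size_cat /=; lia.
have nthl (k : 'I_r) : nth p l k = (tnth w k, tnth a k).
  by rewrite (nth_map k) ?size_enum_ord // nth_ord_enum.
have P0 : (size l1 < r)%N by lia.
have S0 : (size l2 + (size l1).+1 < r)%N by lia.
have := H (Ordinal P0) (Ordinal S0).
have := nthl (Ordinal P0); rewrite /l E nth_cat /= ltnn subnn /= => Ep.
have := nthl (Ordinal S0); rewrite /l E nth_cat /= -cat_cons.
rewrite (_ : (_ + _ < size l1)%N = false); last by lia.
rewrite (_ : (size l2 + (size l1).+1 - size l1)%N = (size l2).+1); last by lia.
rewrite /= nth_cat ltnn subnn /= => Ep'.
move: pp'; rewrite Ep Ep' /= => pp' /(_ _ pp') H'.
apply: le_trans (H' _); last by lia.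
rewrite lerD2l le_eqVlt; apply/orP; left; apply/eqP.
pose G (t : I * nat) := cartan D (tnth w (Ordinal P0)) t.1 * t.2%:Z.
have -> : \sum_(k < r | (size l1 < k < size l2 + (size l1).+1)%N)
    cartan D (tnth w (Ordinal P0)) (tnth w k) * (tnth a k)%:Z
  = \sum_(0 <= k < r | (true && (k < size l2 + (size l1).+1)%N) && ((size l1).+1 <= k)%N) G (nth p l k).
  rewrite big_mkord; apply: eq_big => [k|k _]; first by rewrite andbC.
  by rewrite nthl.
rewrite -big_nat_widenl // -big_nat_widen; last exact: ltnW.
rewrite -{1}[(size l1).+1]add0n big_addn addnK (big_nth p) [LHS]big_nat [RHS]big_nat.
apply: eq_bigr => k /andP[_ kl]; rewrite /G /l E nth_cat.
rewrite (_ : (_ + _ < size l1)%N = false); last by lia.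
rewrite (_ : (k + (size l1).+1 - size l1)%N = k.+1); last by lia.
by rewrite /= nth_cat kl.
Qed.

End Words.

Theorem proposition3p3 (I : finType) (D : root_datum I)
    (V : forall lam : dominant_weight D, hw_crystal (sval lam))
    (r : nat) (w : r.-tuple I) (hw : reduced D w) :
  tight_cone D w `<=` adapted_strings_infty V w.
Proof.
move=> a /tight_cone_word tw; have [N0 hN] := fits_rho D (tuple_word w a (enum 'I_r)).
(* The absolute value keeps the multiple of rho dominant and at least N0. *)
have dom : dominant (`|N0| *: rho D) by apply/forallP => j; rewrite pairingZ pairing_rho mulr1.
pose lam : dominant_weight D := exist _ (`|N0| *: rho D) dom.
have hf := hN _ (ler_norm N0); have ha := @tight_adapted I D V _ tw lam hf.
exists lam => //; exists (@string_tail I D _ (V lam) r w a 0); rewrite ?string_tail_coset drop0.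
  apply/hwB_coset; have [u ew] := string_vector_word (V lam) (tuple_word w a (enum 'I_r)).
  by exists u; rewrite -ew; split=> //; exact: (adapted_nqL hf ha).
split=> [|k]; first by rewrite string_tail_coset drop0.
rewrite string_tail_coset cr_e_coset; apply/lat_coset_eq0.
apply: (adapted_split (l1 := tuple_word w a (take k (enum 'I_r))) (p := (tnth w k, tnth a k))).
have := ha; rewrite -{1}(cat_take_drop k (enum 'I_r)) (drop_nth k) ?size_enum_ord // nth_ord_enum.
by rewrite /tuple_word map_cat.
Qed.
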